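(* Let $\mathcal{A}$ be a connected cochain DG algebra over $\Bbbk$ such that $$H(\mathcal{A})=\Bbbk[\lceil y_1\rceil,\cdots,\lceil y_m\rceil]$$ for some central, cocycle, degree $1$ elements $y_1,\cdots,y_m$ in $\mathcal{A}$. Then $\mathcal{A}$ is a Koszul, homologically smooth and Gorenstein DG algebra. Moreover, $\mathcal{A}$ is $0$-Calabi-Yau if and only if $m$ is an odd integer.
   Context: $\Bbbk$ is an algebraically closed field of characteristic $0$. A cochain DG algebra is a graded $\Bbbk$-algebra $\mathcal{A}$ with a $\Bbbk$-linear differential $\partial_{\mathcal{A}}$ of degree $1$, $\partial_{\mathcal{A}}^2=0$, satisfying $\partial_{\mathcal{A}}(ab)=(\partial_{\mathcal{A}}a)b+(-1)^{|a|}a(\partial_{\mathcal{A}}b)$; it is connected if $\mathcal{A}^0=\Bbbk$ and $\mathcal{A}^i=0$ for $i<0$, and then $\Bbbk$ is a DG $\mathcal{A}$-module via the augmentation $\mathcal{A}\to\mathcal{A}/\mathfrak{m}_{\mathcal{A}}=\Bbbk$, where $\mathfrak{m}_{\mathcal{A}}=\bigoplus_{i\ge1}\mathcal{A}^i$. $H(\mathcal{A})$ is the cohomology graded algebra, and $\lceil z\rceil\in H(\mathcal{A})$ is the class of a cocycle $z$. The notation $\Bbbk[\lceil y_1\rceil,\dots,\lceil y_m\rceil]$ means the ordinary commutative polynomial algebra (no signs) on the indicated classes, and central means commuting, without signs, with all elements. The opposite DG algebra $\mathcal{A}^{op}$ has multiplication $a\cdot b=(-1)^{|a||b|}ba$;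 the enveloping DG algebra is $\mathcal{A}^e=\mathcal{A}\otimes\mathcal{A}^{op}$. $\mathrm{D}(\mathcal{A})$ is the derived category of left DG $\mathcal{A}$-modules and $\mathrm{D}((\mathcal{A}^e)^{op})$ that of right DG $\mathcal{A}^e$-modules. A DG module is compact if $\mathrm{Hom}$ in the derived category out of it preserves all coproducts. A semi-free resolution is a quasi-isomorphism from a semi-free DG module $F$ (one having a semi-basis); it is minimal if $\partial_F(F)\subseteq\mathfrak{m}_{\mathcal{A}}F$. The $j$-th suspension of a graded space $W$ is $(\Sigma^jW)^i=W^{i+j}$. $\mathcal{A}$ is: Gorenstein if $\dim_{\Bbbk}H(R\mathrm{Hom}_{\mathcal{A}}(\Bbbk,\mathcal{A}))=1$; Koszul if ${}_{\mathcal{A}}\Bbbk$ (equivalently ${}_{\mathcal{A}^e}\mathcal{A}$) has a minimal semi-free resolution with a semi-basis concentrated in degree $0$; homologically smooth if ${}_{\mathcal{A}}\Bbbk$ (equivalently the DG $\mathcal{A}^e$-module $\mathcal{A}$) is compact; $d$-Calabi-Yau ($d\in\mathbb{Z}$) if it is homologically smooth and $R\mathrm{Hom}_{\mathcal{A}^e}(\mathcal{A},\mathcal{A}^e)\cong\Sigma^{-d}\mathcal{A}$ in $\mathrm{D}((\mathcal{A}^e)^{op})$. *)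

(* Defs.v *)
From HB Require Import structures.
From mathcomp Require Import all_boot all_order all_algebra generic_quotient.
From mathcomp Require Import zify.
From mathcomp Require Import boolp classical_sets functions fsbigop.

Set Implicit Arguments.
Unset Strict Implicit.
Unset Printing Implicit Defensive.

Import Order.TTheory GRing.Theory Num.Theory.
Local Open Scope ring_scope.
Local Open Scope quotient_scope.

(* (-1)^i x *)
Definition ksign (M : zmodType) (i : int) (x : M) : M :=
  if odd (absz i) then - x else x.

Section KoszulSign.
Variable M : zmodType.
Implicit Types (i j : int) (x y : M).

Lemma oddzD i j : odd (absz (i + j)) = odd (absz i) (+) odd (absz j).
Proof. lia. Qed.

Lemma oddzM i j : odd (absz (i * j)) = odd (absz i) && odd (absz j).
Proof. by rewrite abszM oddM. Qed.

Lemma oddzN i : odd (absz (- i)) = odd (absz i).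
Proof. by rewrite abszN. Qed.

Definition oddzE := (oddzD, oddzM, oddzN).

Lemma ksignD i x y : ksign i (x + y) = ksign i x + ksign i y.
Proof. by rewrite /ksign; case: odd => //; rewrite opprD. Qed.

Lemma ksign0 i : ksign i (0 : M) = 0.
Proof. by rewrite /ksign oppr0 if_same. Qed.

Lemma ksign_comp i j x : ksign i (ksign j x) = ksign (i + j) x.
Proof. by rewrite /ksign oddzD; do 2!case: odd => //=; rewrite opprK. Qed.

Lemma eq_ksign i j x : odd (absz i) = odd (absz j) -> ksign i x = ksign j x.
Proof. by rewrite /ksign => ->. Qed.

Lemma ksign_morph (N : zmodType) (f : M -> N) i x :
  {morph f : x y / x + y} -> f (ksign i x) = ksign i (f x).
Proof.
move=> fD; rewrite /ksign; case: odd => //.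
have f0 : f 0 = 0 by apply: (addrI (f 0)); rewrite -fD !addr0.
by apply: (addrI (f x)); rewrite -fD !subrr.
Qed.

End KoszulSign.

Lemma ksignMl (R : pzRingType) i (x y : R) : ksign i x * y = ksign i (x * y).
Proof. by rewrite /ksign; case: odd => //; rewrite mulNr. Qed.

Lemma ksignMr (R : pzRingType) i (x y : R) : x * ksign i y = ksign i (x * y).
Proof. by rewrite /ksign; case: odd => //; rewrite mulrN. Qed.

Lemma ksignZ (R : pzRingType) (V : lmodType R) i a (x : V) :
  a *: ksign i x = ksign i (a *: x).
Proof. by rewrite /ksign; case: odd => //; rewrite scalerN. Qed.

Lemma ksignZl (R : pzRingType) (V : lmodType R) i (a : R) (x : V) :
  ksign i a *: x = ksign i (a *: x).
Proof. by rewrite /ksign; case: odd => //; rewrite scaleNr. Qed.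

(* A direct sum decomposition indexed by the integers, given by its family of
   projections. *)
Record grading (M : zmodType) := Grading {
  comp :> int -> M -> M;
  compD : forall i, {morph comp i : x y / x + y};
  comp_comp : forall i j x, comp i (comp j x) = if i == j then comp j x else 0;
  comp_sum : forall x, exists2 s : seq int,
    uniq s & x = \sum_(i <- s) comp i x }.

Definition homogeneous (M : zmodType) (G : grading M) (i : int) (x : M) : Prop :=
  G i x = x.

Section AdditiveFacts.
Variables (M N : zmodType) (f : M -> N).
Hypothesis fD : {morph f : x y / x + y}.

Lemma morphD0 : f 0 = 0.
Proof. by apply: (addrI (f 0)); rewrite -fD !addr0. Qed.

Lemma morphDN x : f (- x) = - f x.
Proof. by apply: (addrI (f x)); rewrite -fD !subrr morphD0. Qed.

Lemma morphDsum (I : Type) (s : seq I) (F : I -> M) :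
  f (\sum_(i <- s) F i) = \sum_(i <- s) f (F i).
Proof. exact: (big_morph f fD morphD0). Qed.

End AdditiveFacts.

(* [gsum G g] is the additive map equal to [g i] on elements of degree [i]. *)
Definition gsum (M V : zmodType) (G : grading M) (g : int -> M -> V) (x : M) : V :=
  \sum_(i \in [set: int]) g i (G i x).

Section Grading.
Variables (M : zmodType) (G : grading M).
Implicit Types (i j : int) (x y : M).

Lemma comp0 i : G i 0 = 0. Proof. exact: morphD0 (compD G i). Qed.

Lemma homog_comp i x : homogeneous G i (G i x).
Proof. by rewrite /homogeneous comp_comp eqxx. Qed.

Lemma homogD i x y : homogeneous G i x -> homogeneous G i y -> homogeneous G i (x + y).
Proof. by rewrite /homogeneous compD => -> ->. Qed.

Lemma homog0 i : homogeneous G i 0. Proof. exact: comp0. Qed.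

Lemma homogN i x : homogeneous G i x -> homogeneous G i (- x).
Proof. by rewrite /homogeneous (morphDN (compD G i)) => ->. Qed.

Lemma homog_ksign i j x : homogeneous G i x -> homogeneous G i (ksign j x).
Proof. by rewrite /ksign; case: odd => //; exact: homogN. Qed.

Lemma homog_sum (I : Type) (s : seq I) (F : I -> M) i :
  (forall t, homogeneous G i (F t)) -> homogeneous G i (\sum_(t <- s) F t).
Proof.
by move=> h; elim/big_ind: _ => //; [exact: homog0 | exact: homogD].
Qed.

Lemma compE i j x : homogeneous G j x -> G i x = if i == j then x else 0.
Proof. by move=> <-; rewrite comp_comp. Qed.

Lemma comp_support x : exists2 s : seq int,
  uniq s & forall i, i \notin s -> G i x = 0.
Proof.
have [s us xE] := comp_sum G x; exists s => // i iNs.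
rewrite xE (morphDsum (compD G i)) big_seq big1// => j js.
by rewrite comp_comp; case: eqP => // ij; rewrite -ij in js; rewrite js in iNs.
Qed.

Lemma grind (P : M -> Prop) : P 0 -> (forall x y, P x -> P y -> P (x + y)) ->
  (forall i x, homogeneous G i x -> P x) -> forall x, P x.
Proof.
move=> P0 PD Ph x; have [s _ ->] := comp_sum G x.
by elim/big_ind: _ => // i _; apply: Ph; exact: homog_comp.
Qed.

Lemma grext (V : zmodType) (f g : M -> V) :
  {morph f : x y / x + y} -> {morph g : x y / x + y} ->
  (forall i x, homogeneous G i x -> f x = g x) -> forall x, f x = g x.
Proof.
move=> fD gD fg; apply: grind => [|x y fx fy|]; last exact: fg.
- by rewrite !morphD0.
- by rewrite fD gD fx fy.
Qed.

Lemma gsumE (V : zmodType) (g : int -> M -> V) s x :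
  (forall i, {morph g i : x y / x + y}) ->
  uniq s -> (forall i, i \notin s -> G i x = 0) ->
  gsum G g x = \sum_(i <- s) g i (G i x).
Proof.
move=> gD us xs; rewrite /gsum (@fsbigE _ _ _ _ _ s)//; last first.
  by move=> i _ /xs ->; rewrite (morphD0 (gD i)).
by apply: eq_bigl => i; rewrite in_setT.
Qed.

Lemma gsum_homog (V : zmodType) (g : int -> M -> V) i x :
  (forall i, {morph g i : x y / x + y}) -> homogeneous G i x -> gsum G g x = g i x.
Proof.
move=> gD hx; rewrite (@gsumE _ _ [:: i])//.
  by rewrite big_seq1 hx.
by move=> j; rewrite inE (compE j hx) => /negbTE ->.
Qed.

Lemma gsumD (V : zmodType) (g : int -> M -> V) :
  (forall i, {morph g i : x y / x + y}) -> {morph gsum G g : x y / x + y}.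
Proof.
move=> gD x y.
have [s us xs] := comp_support x; have [t ut yt] := comp_support y.
pose r := undup (s ++ t).
have ur : uniq r by exact: undup_uniq.
have xr i : i \notin r -> G i x = 0.
  by rewrite mem_undup mem_cat negb_or => /andP[/xs].
have yr i : i \notin r -> G i y = 0.
  by rewrite mem_undup mem_cat negb_or => /andP[_ /yt].
have xyr i : i \notin r -> G i (x + y) = 0.
  by move=> ir; rewrite compD xr ?yr ?addr0.
rewrite !(@gsumE _ _ r)// -big_split/=.
by apply: eq_bigr => i _; rewrite compD gD.
Qed.

(* multiplication by (-1)^(j |x|) *)
Definition twist (j : int) : M -> M := gsum G (fun i => ksign (i * j)).

Lemma twistD j : {morph twist j : x y / x + y}.
Proof. by apply: gsumD => i x y; exact: ksignD. Qed.

Lemma twist_homog i j x : homogeneous G i x -> twist j x = ksign (i * j) x.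
Proof. by move=> hx; rewrite /twist (gsum_homog _ hx)// => *; exact: ksignD. Qed.

Lemma homog_twist i j x : homogeneous G i x -> homogeneous G i (twist j x).
Proof. by move=> hx; rewrite (twist_homog _ hx); exact: homog_ksign. Qed.

End Grading.

Section GradingOf.
Variables (M : zmodType) (c : int -> M -> M).
Hypothesis cD : forall i, {morph c i : x y / x + y}.
Hypothesis cP : forall x, exists2 s : seq (int * M), x = \sum_(p <- s) p.2 &
  {in s, forall p n, c n p.2 = if n == p.1 then p.2 else 0}.

Lemma grading_of_comp i j x : c i (c j x) = if i == j then c j x else 0.
Proof.
have [s -> sP] := cP x; rewrite !(morphDsum (cD _)).
transitivity (\sum_(p <- s) if i == j then c j p.2 else 0); last first.
  by case: eqP => // _; rewrite big1.
rewrite !big_seq; apply: eq_bigr => p /sP pP; rewrite !pP.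
case: (eqVneq j p.1) => [->|_]; first by rewrite pP.
by rewrite (morphD0 (cD _)); case: ifP.
Qed.

Lemma grading_of_sum x : exists2 s : seq int,
  uniq s & x = \sum_(i <- s) c i x.
Proof.
have [s xE sP] := cP x; exists (undup [seq p.1 | p <- s]).
  exact: undup_uniq.
set r := undup _.
transitivity (\sum_(i <- r) \sum_(p <- s) c i p.2); last first.
  by apply: eq_bigr => i _; rewrite [in RHS]xE (morphDsum (cD _)).
rewrite {1}xE exchange_big /= !big_seq; apply: eq_bigr => p ps.
rewrite (bigD1_seq p.1) ?undup_uniq ?mem_undup ?map_f//= big1 ?addr0.
  by rewrite sP// eqxx.
by move=> i ip; rewrite sP// (negbTE ip).
Qed.

Definition grading_of : grading M :=
  Grading cD grading_of_comp grading_of_sum.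

End GradingOf.

Definition bilin (k : fieldType) (U V W : lmodType k) (b : U -> V -> W) : Prop :=
  (forall v, linear (b^~ v)) /\ (forall u, linear (b u)).

Section Tensor.
Variables (k : fieldType) (U V : lmodType k).
Implicit Types s t : seq (U * V).

Definition teval (W : lmodType k) (b : U -> V -> W) s : W :=
  \sum_(p <- s) b p.1 p.2.

Definition trel s t : bool :=
  `[< forall (W : lmodType k) (b : U -> V -> W),
        bilin b -> teval b s = teval b t >].

Lemma trel_refl : reflexive trel. Proof. by move=> s; apply/asboolP. Qed.

Lemma trel_sym : symmetric trel.
Proof. by move=> s t; apply/asboolP/asboolP => st W b bb; rewrite (st W b). Qed.

Lemma trel_trans : transitive trel.
Proof.
move=> s t r /asboolP ts /asboolP sr; apply/asboolP => W b bb.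
by rewrite (ts W b)// (sr W b).
Qed.

Canonical trel_equiv := EquivRel trel trel_refl trel_sym trel_trans.

(* The vector space U (x) V: formal sums of pairs, two of them being identified
   when every bilinear map takes the same value on both. *)
Definition tens : Type := {eq_quot trel}.

HB.instance Definition _ := Choice.on tens.
HB.instance Definition _ := EqQuotient.on tens.

Definition tpi s : tens := \pi_tens s.

Definition tlift (W : lmodType k) (b : U -> V -> W) (x : tens) : W :=
  teval b (repr x).

Lemma tlift_pi (W : lmodType k) b s : @bilin k U V W b -> tlift b (tpi s) = teval b s.
Proof.
move=> bb; rewrite /tlift /tpi; case: piP => t /eqquotP /asboolP st.
by rewrite (st W b).
Qed.

Lemma tpiP x : exists s, x = tpi s.
Proof. by exists (repr x); rewrite /tpi reprK. Qed.

Lemma eq_tpi s t : (forall (W : lmodType k) (b : U -> V -> W),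
  bilin b -> teval b s = teval b t) -> tpi s = tpi t.
Proof. by move=> st; apply/eqquotP/asboolP. Qed.

Definition tscale_seq (c : k) s := [seq (c *: p.1, p.2) | p <- s].

Definition tadd (x y : tens) := tpi (repr x ++ repr y).
Definition tscale c (x : tens) := tpi (tscale_seq c (repr x)).

Lemma teval_cat (W : lmodType k) (b : U -> V -> W) s t :
  teval b (s ++ t) = teval b s + teval b t.
Proof. exact: big_cat. Qed.

Lemma teval_scale (W : lmodType k) (b : U -> V -> W) c s : bilin b ->
  teval b (tscale_seq c s) = c *: teval b s.
Proof.
move=> [bl _]; rewrite /teval big_map scaler_sumr; apply: eq_bigr => p _ /=.
have b0 : b 0 p.2 = 0.
  by apply: (addIr (b 0 p.2)); have := bl p.2 1 0 0; rewrite /= !scale1r !addr0 add0r => <-.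
by have := bl p.2 c p.1 0; rewrite /= b0 !addr0.
Qed.

Lemma tlift_add (W : lmodType k) b x y : @bilin k U V W b ->
  tlift b (tadd x y) = tlift b x + tlift b y.
Proof. by move=> bb; rewrite tlift_pi// teval_cat. Qed.

Lemma tlift_scale (W : lmodType k) b c x : @bilin k U V W b ->
  tlift b (tscale c x) = c *: tlift b x.
Proof. by move=> bb; rewrite tlift_pi// teval_scale. Qed.

Lemma tlift_inj x y : (forall (W : lmodType k) (b : U -> V -> W),
  bilin b -> tlift b x = tlift b y) -> x = y.
Proof.
move: (tpiP x) (tpiP y) => [s ->] [t ->] st; apply: eq_tpi => W b bb.
by rewrite -!tlift_pi// st.
Qed.

Lemma tlift_nil (W : lmodType k) b : @bilin k U V W b -> tlift b (tpi [::]) = 0.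
Proof. by move=> bb; rewrite tlift_pi// /teval big_nil. Qed.

Lemma taddA : associative tadd.
Proof. by move=> x y z; apply: tlift_inj => W b bb; rewrite !tlift_add// addrA. Qed.
Lemma taddC : commutative tadd.
Proof. by move=> x y; apply: tlift_inj => W b bb; rewrite !tlift_add// addrC. Qed.
Lemma tadd0 : left_id (tpi [::]) tadd.
Proof. by move=> x; apply: tlift_inj => W b bb; rewrite tlift_add// tlift_nil// add0r. Qed.
Lemma taddN : left_inverse (tpi [::]) (tscale (-1)) tadd.
Proof.
move=> x; apply: tlift_inj => W b bb.
by rewrite tlift_add// tlift_scale// tlift_nil// scaleN1r addNr.
Qed.

HB.instance Definition _ := GRing.isZmodule.Build tens taddA taddC tadd0 taddN.

Lemma tscaleA a c x : tscale a (tscale c x) = tscale (a * c) x.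
Proof. by apply: tlift_inj => W b bb; rewrite !tlift_scale// scalerA. Qed.
Lemma tscale1 : left_id 1 tscale.
Proof. by move=> x; apply: tlift_inj => W b bb; rewrite !tlift_scale// scale1r. Qed.
Lemma tscaleDr : right_distributive tscale +%R.
Proof.
by move=> c x y; apply: tlift_inj => W b bb; rewrite !(tlift_scale,tlift_add)// scalerDr.
Qed.
Lemma tscaleDl x : {morph tscale^~ x : a c / a + c}.
Proof.
by move=> a c; apply: tlift_inj => W b bb; rewrite !(tlift_scale,tlift_add)// scalerDl.
Qed.

HB.instance Definition _ := GRing.Zmodule_isLmodule.Build k tens
  tscaleA tscale1 tscaleDr tscaleDl.

Definition tpure (u : U) (v : V) : tens := tpi [:: (u, v)].

Lemma tlift_linear (W : lmodType k) (b : U -> V -> W) : bilin b -> linear (tlift b).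
Proof. by move=> bb c x y; rewrite tlift_add// tlift_scale. Qed.

Lemma tliftD (W : lmodType k) (b : U -> V -> W) :
  bilin b -> {morph tlift b : x y / x + y}.
Proof. by move=> bb x y; exact: tlift_add. Qed.

Lemma tlift_pure (W : lmodType k) (b : U -> V -> W) u v : bilin b -> tlift b (tpure u v) = b u v.
Proof. by move=> bb; rewrite tlift_pi// /teval big_seq1. Qed.

Lemma tpure_bilin : bilin tpure.
Proof.
split=> [v c u u'|u c v v'] /=; apply: tlift_inj => W b bb.
  by rewrite tlift_add// tlift_scale// !tlift_pure//; case: bb => + _ => ->.
by rewrite tlift_add// tlift_scale// !tlift_pure//; case: bb => _ ->.
Qed.

Lemma tens_sum x : exists s : seq (U * V), x = \sum_(p <- s) tpure p.1 p.2.
Proof.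
have [s ->] := tpiP x; exists s; elim: s => [|p s IH]; first by rewrite big_nil.
rewrite big_cons -IH; apply: tlift_inj => W b bb.
by rewrite tlift_add// !tlift_pi// /teval big_cons big_seq1.
Qed.

End Tensor.

Section Bilinear.
Variables (k : fieldType) (U V W : lmodType k) (b : U -> V -> W).
Hypothesis bb : bilin b.

Lemma linD (X Y : lmodType k) (f : X -> Y) :
  linear f -> {morph f : x y / x + y}.
Proof. by move=> fl x y; have := fl 1 x y; rewrite !scale1r. Qed.

Lemma linZ (X Y : lmodType k) (f : X -> Y) : linear f -> scalable f.
Proof.
by move=> fl c x; have := fl c x 0; rewrite (morphD0 (linD fl)) !addr0.
Qed.

Lemma bilinDl v : {morph b^~ v : x y / x + y}.
Proof. exact: (linD (proj1 bb v)). Qed.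
Lemma bilinDr u : {morph b u : x y / x + y}.
Proof. exact: (linD (proj2 bb u)). Qed.
Lemma bilinZl c u v : b (c *: u) v = c *: b u v.
Proof. exact: (linZ (proj1 bb v)). Qed.
Lemma bilinZr c u v : b u (c *: v) = c *: b u v.
Proof. exact: (linZ (proj2 bb u)). Qed.
Lemma bilin0l v : b 0 v = 0. Proof. exact: (morphD0 (bilinDl v)). Qed.
Lemma bilin0r u : b u 0 = 0. Proof. exact: (morphD0 (bilinDr u)). Qed.
Lemma bilin_suml v (I : Type) (s : seq I) (F : I -> U) :
  b (\sum_(i <- s) F i) v = \sum_(i <- s) b (F i) v.
Proof. exact: (morphDsum (bilinDl v)). Qed.
Lemma bilin_sumr u (I : Type) (s : seq I) (F : I -> V) :
  b u (\sum_(i <- s) F i) = \sum_(i <- s) b u (F i).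
Proof. exact: (morphDsum (bilinDr u)). Qed.
Lemma bilin_ksignl i u v : b (ksign i u) v = ksign i (b u v).
Proof. exact: (ksign_morph i u (bilinDl v)). Qed.
Lemma bilin_ksignr i u v : b u (ksign i v) = ksign i (b u v).
Proof. exact: (ksign_morph i v (bilinDr u)). Qed.

End Bilinear.

Lemma bilinP (k : fieldType) (U V W : lmodType k) (b : U -> V -> W) :
  (forall v, {morph b^~ v : x y / x + y}) ->
  (forall u, {morph b u : x y / x + y}) ->
  (forall c u v, b (c *: u) v = c *: b u v) ->
  (forall c u v, b u (c *: v) = c *: b u v) -> bilin b.
Proof.
move=> Dl Dr Zl Zr; split=> [v c x y|u c x y] /=.
  by rewrite Dl Zl.
by rewrite Dr Zr.
Qed.

Lemma functional_ex (k : fieldType) (U : lmodType k) (u : U) : u != 0 ->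
  exists f : U -> k^o, linear f /\ f u = 1.
Proof.
move=> u0.
pose sub (S : set U) := forall c x y, S x -> S y -> S (c *: x + y).
pose P (S : set U) := sub S /\ ~ S u.
have [F FP Ftot|S [[Ssub Su] Smax]] := @Zorn_bigcup U P.
  split=> [c x y [X FX Xx] [Y FY Yy]|[X FX /= Xu]]; last by have [] := FP _ FX.
  have [XY|YX] := Ftot _ _ FX FY.
    by exists Y => //=; apply: (FP _ FY).1 => //; exact: XY.
  by exists X => //=; apply: (FP _ FX).1 => //; exact: YX.
have S0 : S 0.
  apply: contrapT => nS0; apply: (Smax (S `|` [set 0])%classic).
    split; first by move=> x Sx; left.
    by move=> /(_ 0 (or_intror erefl)).
  split=> [c x y|[//|/= u00]]; last by rewrite u00 eqxx in u0.
  move=> [Sx|/= ->] [Sy|/= ->].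
  - by left; exact: Ssub.
  - exfalso; apply: nS0.
    by have := Ssub (-1) _ _ Sx Sx; rewrite scaleN1r addNr.
  - by left; rewrite scaler0 add0r.
  - by right; rewrite /= scaler0 addr0.
have SZ c x : S x -> S (c *: x) by move=> Sx; rewrite -[_ *: _]addr0; exact: Ssub.
have SD x y : S x -> S y -> S (x + y).
  by move=> Sx; rewrite -[x in x + y]scale1r; exact: Ssub.
have SN x : S x -> S (- x) by move=> Sx; rewrite -scaleN1r; exact: SZ.
have ex x : exists c : k, S (x - c *: u).
  have [Sx|nSx] := pselect (S x); first by exists 0; rewrite scale0r subr0.
  pose S' : set U := [set z | exists2 y, S y & exists a : k, z = y + a *: x]%classic.
  have : ~ ~ S' u.
    move=> nu; apply: (Smax S').
      split; first by move=> y Sy; exists y => //; exists 0; rewrite scale0r addr0.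
      by move=> /(_ x) h; apply: nSx; apply: h; exists 0 => //; exists 1; rewrite scale1r add0r.
    split=> // c _ _ [y Sy [a ->]] [z Sz [a' ->]].
    exists (c *: y + z); first exact: Ssub.
    by exists (c * a + a'); rewrite scalerDr scalerDl scalerA addrACA.
  move=> /contrapT[y Sy [a ua]].
  have a0 : a != 0.
    by apply/eqP => a0; apply: Su; rewrite ua a0 scale0r addr0.
  exists a^-1; rewrite ua scalerDr scalerA mulVf// scale1r opprD addrCA subrr addr0.
  by apply: SN; exact: SZ.
have uni x c c' : S (x - c *: u) -> S (x - c' *: u) -> c = c'.
  move=> Sc Sc'; apply: contrapT => /eqP cc'.
  have := SD _ _ Sc' (SN _ Sc); rewrite opprB addrC addrA addrNK -scalerBl.
  move=> /(SZ (c - c')^-1); rewrite scalerA mulVf ?subr_eq0// scale1r.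
  exact: Su.
exists (fun x => projT1 (cid (ex x))); split=> [c x y|].
  case: cid => a /= Sa; case: cid => a1 /= Sa1; case: cid => a2 /= Sa2.
  apply: uni Sa _; have := Ssub c _ _ Sa1 Sa2.
  by rewrite scalerBr addrACA scalerA -opprD -scalerDl.
by case: cid => a /= Sa; apply: uni Sa _; rewrite scale1r subrr.
Qed.

Lemma tpure_neq0 (k : fieldType) (U V : lmodType k) (u : U) (v : V) :
  u != 0 -> v != 0 -> tpure u v != 0.
Proof.
move=> /functional_ex[f [fl fu]] /functional_ex[g [gl gv]].
pose b u v : k^o := f u * g v.
have bb : bilin b.
  split=> [y c x x'|x c y y'] /=; rewrite /b ?fl ?gl.
    by rewrite mulrDl -mulrA.
  by rewrite mulrDr mulrCA.
apply/eqP => /(congr1 (tlift b)); rewrite tlift_pure// /b fu gv mulr1.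
by rewrite (morphD0 (tliftD bb)) => /eqP; rewrite oner_eq0.
Qed.

Lemma grextD (M V : zmodType) (G : grading M) (f g h : M -> V) :
  {morph f : x y / x + y} -> {morph g : x y / x + y} ->
  {morph h : x y / x + y} ->
  (forall i x, homogeneous G i x -> f x = g x + h x) -> forall x, f x = g x + h x.
Proof.
move=> fD gD hD fgh; apply: (grext (G := G) (g := fun x => g x + h x)) => //.
by move=> x y; rewrite gD hD addrACA.
Qed.

Lemma grextZ (k : pzRingType) (V : lmodType k) (M : zmodType) (G : grading M)
    (c : k) (f g : M -> V) :
  {morph f : x y / x + y} -> {morph g : x y / x + y} ->
  (forall i x, homogeneous G i x -> f x = c *: g x) -> forall x, f x = c *: g x.
Proof.
move=> fD gD fg; apply: (grext (G := G) (g := fun x => c *: g x)) => //.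
by move=> x y; rewrite gD scalerDr.
Qed.

Record dgAlgebra (k : fieldType) := DGAlgebra {
  dga_alg :> algType k;
  dga_gr : grading dga_alg;
  dga_d : dga_alg -> dga_alg;
  dga_grZ : forall i, scalable (dga_gr i);
  dga_1 : homogeneous dga_gr 0 1;
  dga_mul : forall i j x y,
    homogeneous dga_gr i x -> homogeneous dga_gr j y -> homogeneous dga_gr (i + j) (x * y);
  dga_dlin : linear dga_d;
  dga_ddeg : forall i x, homogeneous dga_gr i x -> homogeneous dga_gr (i + 1) (dga_d x);
  dga_dd : forall x, dga_d (dga_d x) = 0;
  dga_leibniz : forall i x y, homogeneous dga_gr i x ->
    dga_d (x * y) = dga_d x * y + ksign i (x * dga_d y) }.

Arguments dga_gr {k} _.
Arguments dga_d {k _} _.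

Section DGAlgebraFacts.
Variables (k : fieldType) (A : dgAlgebra k).
Local Notation gr := (dga_gr A).

Lemma dga_dD : {morph (@dga_d k A) : x y / x + y}.
Proof. exact: (linD (@dga_dlin k A)). Qed.

Lemma dga_dZ : scalable (@dga_d k A).
Proof. exact: (linZ (@dga_dlin k A)). Qed.

Lemma dga_d_ksign i (x : A) : dga_d (ksign i x) = ksign i (dga_d x).
Proof. exact: (ksign_morph i x dga_dD). Qed.

Lemma dga_d1 : dga_d (1 : A) = 0.
Proof.
have := dga_leibniz 1 (dga_1 A); rewrite !mulr1 mul1r /ksign /=.
by rewrite -[LHS]addr0 => /addrI.
Qed.

Lemma homogZ i (c : k) (x : A) : homogeneous gr i x -> homogeneous gr i (c *: x).
Proof. by rewrite /homogeneous dga_grZ => ->. Qed.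

Lemma twistZ j (c : k) (x : A) : twist gr j (c *: x) = c *: twist gr j x.
Proof.
apply: (@grext _ gr _ (fun x => twist gr j (c *: x))
                      (fun x => c *: twist gr j x)).
- by move=> y z; rewrite scalerDr twistD.
- by move=> y z; rewrite twistD scalerDr.
- move=> i y hy; rewrite (twist_homog j hy) (twist_homog j (homogZ c hy)).
  by rewrite ksignZ.
Qed.

Lemma twist1 j : twist gr j (1 : A) = 1.
Proof. by rewrite (twist_homog j (dga_1 A)) mul0r. Qed.

Lemma twistM j (x y : A) : twist gr j (x * y) = twist gr j x * twist gr j y.
Proof.
move: x; apply: (grext (G := gr)) => [x x'|x x'|i x hx].
- by rewrite mulrDl twistD.
- by rewrite twistD mulrDl.
move: y; apply: (grext (G := gr)) => [y y'|y y'|l y hy].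
- by rewrite mulrDr twistD.
- by rewrite twistD mulrDr.
rewrite (twist_homog j hx) (twist_homog j hy) (twist_homog j (dga_mul hx hy)).
rewrite ksignMl ksignMr ksign_comp; apply: eq_ksign; rewrite !oddzE; by do 3!case: odd.
Qed.

Lemma twist_comp i j (x : A) : twist gr i (twist gr j x) = twist gr (i + j) x.
Proof.
move: x; apply: (grext (G := gr)) => [x x'|x x'|l x hx]; rewrite ?twistD//.
rewrite (twist_homog j hx) (twist_homog _ (homog_ksign _ hx)) (twist_homog _ hx).
by rewrite ksign_comp mulrDr.
Qed.

End DGAlgebraFacts.

Definition opp_type (k : fieldType) (A : dgAlgebra k) : Type := A.

Section Opposite.
Variables (k : fieldType) (A : dgAlgebra k).
Local Notation gr := (dga_gr A).

(* The bilinear product with  a . b = (-1)^(|a| |b|) b a  on homogeneous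
   elements. *)
Definition opmul (a b : A) : A := gsum gr (fun i x => twist gr i b * x) a.

Let opmul_aux b i : {morph (fun x => twist gr i b * x) : x y / x + y}.
Proof. by move=> x y; exact: mulrDr. Qed.

Lemma opmul_homogl i a b : homogeneous gr i a -> opmul a b = twist gr i b * a.
Proof. by move=> ha; rewrite /opmul (gsum_homog _ ha). Qed.

Lemma opmul_homog i j a b : homogeneous gr i a -> homogeneous gr j b ->
  opmul a b = ksign (i * j) (b * a).
Proof.
move=> ha hb; rewrite (opmul_homogl b ha) (twist_homog i hb) ksignMl.
by rewrite mulrC.
Qed.

Lemma opmulDl : left_distributive opmul +%R.
Proof. by move=> a a' b; apply: gsumD. Qed.

Lemma opmulDr : right_distributive opmul +%R.
Proof.
move=> a b b'; move: a; apply: (grext (G := gr)) => [a a'|a a'|i a ha].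
- exact: opmulDl.
- by rewrite !opmulDl addrACA.
- by rewrite !(opmul_homogl _ ha) twistD mulrDl.
Qed.

Lemma opmulZl c a b : opmul (c *: a) b = c *: opmul a b.
Proof.
apply: (@grext _ gr _ (fun a => opmul (c *: a) b) (fun a => c *: opmul a b)).
- by move=> x y; rewrite scalerDr opmulDl.
- by move=> x y; rewrite opmulDl scalerDr.
- move=> i x hx; rewrite (opmul_homogl b (homogZ c hx)) (opmul_homogl b hx).
  by rewrite scalerAr.
Qed.

Lemma opmulZr c a b : opmul a (c *: b) = c *: opmul a b.
Proof.
apply: (@grext _ gr _ (fun a => opmul a (c *: b)) (fun a => c *: opmul a b)).
- by move=> x y; rewrite opmulDl.
- by move=> x y; rewrite opmulDl scalerDr.
- move=> i x hx; rewrite !(opmul_homogl _ hx).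
  by rewrite twistZ scalerAl.
Qed.

Lemma opmulA : associative opmul.
Proof.
move=> a b c; move: a; apply: (grext (G := gr)) => [a a'|a a'|i a ha].
- exact: opmulDl.
- by rewrite !opmulDl.
move: b; apply: (grext (G := gr)) => [b b'|b b'|j b hb].
- by rewrite !(opmulDl, opmulDr).
- by rewrite !(opmulDl, opmulDr).
move: c; apply: (grext (G := gr)) => [c c'|c c'|l c hc].
- by rewrite !opmulDr.
- by rewrite !opmulDr.
have hcb := dga_mul hc hb; have hba := dga_mul hb ha.
rewrite (opmul_homog hb hc) (opmul_homog ha hb).
rewrite (opmul_homog ha (homog_ksign _ hcb)) (opmul_homog (homog_ksign _ hba) hc).
rewrite ksignMl ksignMr mulrA !ksign_comp; apply: eq_ksign.
by rewrite !oddzE; do 3!case: odd.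
Qed.

Lemma opmul1l : left_id 1 opmul.
Proof.
apply: (grext (G := gr)) => [a b|a b|i a ha]; rewrite ?opmulDr//.
by rewrite (opmul_homog (dga_1 A) ha) mul0r mulr1.
Qed.

Lemma opmul1r : right_id 1 opmul.
Proof.
apply: (grext (G := gr)) => [a b|a b|i a ha]; rewrite ?opmulDl//.
by rewrite (opmul_homog ha (dga_1 A)) mulr0 mul1r.
Qed.

HB.instance Definition _ := GRing.Lmodule.copy (opp_type A) (A : lmodType k).
HB.instance Definition _ := GRing.Zmodule_isNzRing.Build (opp_type A)
  opmulA opmul1l opmul1r opmulDl opmulDr (oner_neq0 A).
HB.instance Definition _ := GRing.Lmodule_isLalgebra.Build k (opp_type A)
  (fun c a b => esym (opmulZl c a b)).
HB.instance Definition _ := GRing.Lalgebra_isAlgebra.Build k (opp_type A)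
  (fun c a b => esym (opmulZr c a b)).

Definition op_gr : grading (opp_type A) := gr.

Lemma op_mul i j (x y : opp_type A) :
  homogeneous op_gr i x -> homogeneous op_gr j y -> homogeneous op_gr (i + j) (x * y).
Proof.
move=> hx hy; rewrite [_ * _](opmul_homog hx hy); apply: homog_ksign.
by rewrite addrC; exact: dga_mul.
Qed.

Lemma op_leibniz i (x y : A) : homogeneous gr i x ->
  dga_d (opmul x y) = opmul (dga_d x) y + ksign i (opmul x (dga_d y)).
Proof.
move=> hx; move: y; apply: (grext (G := gr)) => [y y'|y y'|j y hy].
- by rewrite opmulDr dga_dD.
- by rewrite dga_dD !opmulDr ksignD addrACA.
rewrite (opmul_homog hx hy) (opmul_homog (dga_ddeg hx) hy).
rewrite (opmul_homog hx (dga_ddeg hy)).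
rewrite dga_d_ksign (dga_leibniz _ hy) ksignD addrC !ksign_comp.
by congr (_ + _); apply: eq_ksign; rewrite !oddzE; do 2!case: odd.
Qed.

Definition opDGA : dgAlgebra k := @DGAlgebra k (opp_type A) op_gr
  (@dga_d k A) (@dga_grZ k A) (dga_1 A) op_mul
  (@dga_dlin k A) (@dga_ddeg k A) (@dga_dd k A) op_leibniz.

End Opposite.

Arguments opmul {k} A _ _.
Arguments op_leibniz {k} A {i x} y _.

Section TensorDGA.
Variables (k : fieldType) (A B : dgAlgebra k).
Local Notation grA := (dga_gr A).
Local Notation grB := (dga_gr B).
Local Notation T := (tens A B).

Lemma thind (P : T -> Prop) : P 0 -> (forall x y, P x -> P y -> P (x + y)) ->
  (forall i j a b, homogeneous grA i a -> homogeneous grB j b -> P (tpure a b)) ->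
  forall x, P x.
Proof.
move=> P0 PD Ph x; have [s ->] := tens_sum x.
elim/big_ind: _ => // -[a b] _ /=; move: a; apply: (@grind _ grA).
- by rewrite (bilin0l (tpure_bilin _ _)).
- by move=> a a' Pa Pa'; rewrite (bilinDl (tpure_bilin _ _)); exact: PD.
move=> i a ha; move: b; apply: (@grind _ grB).
- by rewrite (bilin0r (tpure_bilin _ _)).
- by move=> b b' Pb Pb'; rewrite (bilinDr (tpure_bilin _ _)); exact: PD.
by move=> j b hb; exact: Ph ha hb.
Qed.

Lemma thext (V : zmodType) (f g : T -> V) :
  {morph f : x y / x + y} -> {morph g : x y / x + y} ->
  (forall i j a b, homogeneous grA i a -> homogeneous grB j b ->
     f (tpure a b) = g (tpure a b)) -> forall x, f x = g x.
Proof.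
move=> fD gD fg; apply: thind => [|x y fx fy|]; last exact: fg.
- by rewrite !morphD0.
- by rewrite fD gD fx fy.
Qed.

Definition tmul2 (a : A) (b : B) (a' : A) (b' : B) : T :=
  gsum grB (fun j x => tpure (a * twist grA j a') (x * b')) b.

Let tmul2_aux (a a' : A) (b' : B) j :
  {morph (fun x => tpure (a * twist grA j a') (x * b')) : x y / x + y}.
Proof. by move=> x y /=; rewrite mulrDl (bilinDr (tpure_bilin _ _)). Qed.

Lemma tmul2_homogb j a b a' b' : homogeneous grB j b ->
  tmul2 a b a' b' = tpure (a * twist grA j a') (b * b').
Proof. by move=> hb; rewrite /tmul2 (gsum_homog _ hb). Qed.

Lemma tmul2_homog i j a b a' b' : homogeneous grB j b -> homogeneous grA i a' ->
  tmul2 a b a' b' = ksign (j * i) (tpure (a * a') (b * b')).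
Proof.
move=> hb ha; rewrite (tmul2_homogb _ _ _ hb) (twist_homog _ ha) ksignMr.
by rewrite (bilin_ksignl (tpure_bilin _ _)) mulrC.
Qed.

Lemma tmul2Db (a a' : A) (b' : B) : {morph (fun b => tmul2 a b a' b') : x y / x + y}.
Proof. exact: gsumD. Qed.

Lemma tmul2_bilin a b : bilin (tmul2 a b).
Proof.
apply: bilinP => [b' x y|a' x y|c a' b'|c a' b'] /=.
- apply: (grextD (G := grB) (f := fun b => tmul2 a b (x + y) b')
    (g := fun b => tmul2 a b x b') (h := fun b => tmul2 a b y b')).
  1-3: exact: tmul2Db.
  move=> j {}b hb; rewrite !(tmul2_homogb _ _ _ hb) twistD mulrDr.
  exact: (bilinDl (tpure_bilin _ _)).
- apply: (grextD (G := grB) (f := fun b => tmul2 a b a' (x + y))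
    (g := fun b => tmul2 a b a' x) (h := fun b => tmul2 a b a' y)).
  1-3: exact: tmul2Db.
  move=> j {}b hb; rewrite !(tmul2_homogb _ _ _ hb) mulrDr.
  exact: (bilinDr (tpure_bilin _ _)).
- apply: (grextZ (G := grB) (f := fun b => tmul2 a b (c *: a') b')
    (g := fun b => tmul2 a b a' b')).
  1-2: exact: tmul2Db.
  move=> j {}b hb; rewrite !(tmul2_homogb _ _ _ hb) twistZ -scalerAr.
  exact: (bilinZl (tpure_bilin _ _)).
- apply: (grextZ (G := grB) (f := fun b => tmul2 a b a' (c *: b'))
    (g := fun b => tmul2 a b a' b')).
  1-2: exact: tmul2Db.
  move=> j {}b hb; rewrite !(tmul2_homogb _ _ _ hb) -scalerAr.
  exact: (bilinZr (tpure_bilin _ _)).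
Qed.

Lemma tmul2Da (b : B) (a' : A) (b' : B) :
  {morph (fun a => tmul2 a b a' b') : x y / x + y}.
Proof.
move=> x y; apply: (grextD (G := grB) (f := fun b => tmul2 (x + y) b a' b')
    (g := fun b => tmul2 x b a' b') (h := fun b => tmul2 y b a' b')).
1-3: exact: tmul2Db.
move=> j {}b hb; rewrite !(tmul2_homogb _ _ _ hb) mulrDl.
exact: (bilinDl (tpure_bilin _ _)).
Qed.

Lemma tmul2Za c (a : A) (b : B) (a' : A) (b' : B) :
  tmul2 (c *: a) b a' b' = c *: tmul2 a b a' b'.
Proof.
apply: (grextZ (G := grB) (f := fun b => tmul2 (c *: a) b a' b')
    (g := fun b => tmul2 a b a' b')).
1-2: exact: tmul2Db.
move=> j {}b hb; rewrite !(tmul2_homogb _ _ _ hb) -scalerAl.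
exact: (bilinZl (tpure_bilin _ _)).
Qed.

Lemma tmul2Zb c (a : A) (b : B) (a' : A) (b' : B) :
  tmul2 a (c *: b) a' b' = c *: tmul2 a b a' b'.
Proof.
apply: (grextZ (G := grB) (f := fun b => tmul2 a (c *: b) a' b')
    (g := fun b => tmul2 a b a' b')).
- by move=> x y; rewrite scalerDr tmul2Db.
- exact: tmul2Db.
move=> j {}b hb; rewrite (tmul2_homogb _ _ _ hb).
rewrite (tmul2_homogb _ _ _ (homogZ c hb)) -scalerAl.
exact: (bilinZr (tpure_bilin _ _)).
Qed.

(* The product with (a (x) b) (a' (x) b') = (-1)^(|b| |a'|) a a' (x) b b'. *)
Definition tmul (x y : T) : T := tlift (fun a b => tlift (tmul2 a b) y) x.

Lemma thextD (V : zmodType) (f g h : T -> V) :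
  {morph f : x y / x + y} -> {morph g : x y / x + y} ->
  {morph h : x y / x + y} ->
  (forall i j a b, homogeneous grA i a -> homogeneous grB j b ->
     f (tpure a b) = g (tpure a b) + h (tpure a b)) ->
  forall x, f x = g x + h x.
Proof.
move=> fD gD hD fgh; apply: (thext (g := fun x => g x + h x)) => //.
by move=> x y; rewrite gD hD addrACA.
Qed.

Lemma thextZ (V : lmodType k) (c : k) (f g : T -> V) :
  {morph f : x y / x + y} -> {morph g : x y / x + y} ->
  (forall i j a b, homogeneous grA i a -> homogeneous grB j b ->
     f (tpure a b) = c *: g (tpure a b)) -> forall x, f x = c *: g x.
Proof.
move=> fD gD fg; apply: (thext (g := fun x => c *: g x)) => //.
by move=> x y; rewrite gD scalerDr.
Qed.

Let tmul_bilin y : bilin (fun a b => tlift (tmul2 a b) y).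
Proof.
have tl a b : {morph tlift (tmul2 a b) : x y / x + y}.
  exact: tliftD (tmul2_bilin _ _).
apply: bilinP => [b a1 a2|a b1 b2|c a b|c a b] /=; move: y.
- apply: thextD => // i j a' b' _ _.
  rewrite !(tlift_pure _ _ (tmul2_bilin _ _)); exact: tmul2Da.
- apply: thextD => // i j a' b' _ _.
  rewrite !(tlift_pure _ _ (tmul2_bilin _ _)); exact: tmul2Db.
- apply: thextZ => // i j a' b' _ _.
  rewrite !(tlift_pure _ _ (tmul2_bilin _ _)); exact: tmul2Za.
- apply: thextZ => // i j a' b' _ _.
  rewrite !(tlift_pure _ _ (tmul2_bilin _ _)); exact: tmul2Zb.
Qed.

Lemma tmul_pure i j a b a' b' : homogeneous grB j b -> homogeneous grA i a' ->
  tmul (tpure a b) (tpure a' b') = ksign (j * i) (tpure (a * a') (b * b')).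
Proof.
move=> hb ha; rewrite /tmul (tlift_pure _ _ (tmul_bilin _)).
by rewrite (tlift_pure _ _ (tmul2_bilin _ _)) (tmul2_homog _ _ hb ha).
Qed.

Lemma tmulDl : left_distributive tmul +%R.
Proof. by move=> x y z; rewrite /tmul (tliftD (tmul_bilin _)). Qed.

Lemma tmulDr : right_distributive tmul +%R.
Proof.
move=> x y z; move: x; apply: thext => [x x'|x x'|i j a b ha hb].
- exact: tmulDl.
- by rewrite !tmulDl addrACA.
- by rewrite /tmul !(tlift_pure _ _ (tmul_bilin _)) (tliftD (tmul2_bilin _ _)).
Qed.

Lemma tmulZl c x y : tmul (c *: x) y = c *: tmul x y.
Proof. exact: (linZ (tlift_linear (tmul_bilin y))). Qed.

Lemma tmulZr c x y : tmul x (c *: y) = c *: tmul x y.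
Proof.
move: x; apply: thext => [x x'|x x'|i j a b ha hb].
- exact: tmulDl.
- by rewrite !tmulDl scalerDr.
- rewrite /tmul !(tlift_pure _ _ (tmul_bilin _)).
  exact: (linZ (tlift_linear (tmul2_bilin _ _))).
Qed.

Lemma tmul_ksignl i x y : tmul (ksign i x) y = ksign i (tmul x y).
Proof. by apply: (ksign_morph (f := tmul^~ y)) => u v; exact: tmulDl. Qed.

Lemma tmul_ksignr i x y : tmul x (ksign i y) = ksign i (tmul x y).
Proof. by apply: ksign_morph => u v; exact: tmulDr. Qed.

Lemma tmulA : associative tmul.
Proof.
move=> x y z; move: x; apply: thext => [x x'|x x'|i j a b ha hb].
- exact: tmulDl.
- by rewrite !tmulDl.
move: y; apply: thext => [x x'|x x'|i' j' a' b' ha' hb'].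
- by rewrite tmulDl tmulDr.
- by rewrite tmulDr tmulDl.
move: z; apply: thext => [x x'|x x'|i2 j2 a2 b2 ha2 hb2].
- by rewrite !tmulDr.
- by rewrite tmulDr.
rewrite (tmul_pure _ _ hb' ha2) (tmul_pure _ _ hb ha') tmul_ksignl tmul_ksignr.
rewrite (tmul_pure _ _ hb (dga_mul ha' ha2)) (tmul_pure _ _ (dga_mul hb hb') ha2).
rewrite !ksign_comp !mulrA; apply: eq_ksign.
by rewrite !oddzE; do 4!case: odd.
Qed.

Definition tone : T := tpure 1 1.

Lemma tmul1l : left_id tone tmul.
Proof.
apply: thext => [x y|x y|i j a b ha hb]; rewrite ?tmulDr//.
by rewrite (tmul_pure _ _ (dga_1 B) ha) !mul1r mul0r.
Qed.

Lemma tmul1r : right_id tone tmul.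
Proof.
apply: thext => [x y|x y|i j a b ha hb]; rewrite ?tmulDl//.
by rewrite (tmul_pure _ _ hb (dga_1 A)) !mulr1 mulr0.
Qed.

Lemma tone_neq0 : tone != 0.
Proof. by apply: tpure_neq0; exact: oner_neq0. Qed.

Definition tens_type : Type := T.
HB.instance Definition _ := GRing.Lmodule.copy tens_type T.
HB.instance Definition _ := GRing.Zmodule_isNzRing.Build tens_type
  tmulA tmul1l tmul1r tmulDl tmulDr tone_neq0.
HB.instance Definition _ := GRing.Lmodule_isLalgebra.Build k tens_type
  (fun c a b => esym (tmulZl c a b)).
HB.instance Definition _ := GRing.Lalgebra_isAlgebra.Build k tens_type
  (fun c a b => esym (tmulZr c a b)).

Definition tcomp2 (n : int) (a : A) (b : B) : T :=
  gsum grA (fun i x => tpure x (grB (n - i) b)) a.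

Let tcomp2_aux n (b : B) i :
  {morph (fun x => tpure x (grB (n - i) b) : T) : x y / x + y}.
Proof. by move=> x y; rewrite (bilinDl (tpure_bilin _ _)). Qed.

Lemma tcomp2_homog n i a b :
  homogeneous grA i a -> tcomp2 n a b = tpure a (grB (n - i) b).
Proof. by move=> ha; rewrite /tcomp2 (gsum_homog _ ha). Qed.

Lemma tcomp2_bilin n : bilin (tcomp2 n).
Proof.
have Dl b : {morph tcomp2 n ^~ b : x y / x + y} by exact: gsumD.
apply: bilinP => [//|a b b'|c a b|c a b]; move: a.
- apply: (grextD (G := grA)); [exact: Dl..|move=> i a ha].
  rewrite !(tcomp2_homog n _ ha) compD; exact: (bilinDr (tpure_bilin _ _)).
- apply: (grextZ (G := grA) (f := fun a => tcomp2 n (c *: a) b)).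
  + by move=> x y; rewrite scalerDr Dl.
  + exact: Dl.
  move=> i a ha; rewrite (tcomp2_homog n _ ha).
  rewrite (tcomp2_homog n _ (homogZ c ha)); exact: (bilinZl (tpure_bilin _ _)).
- apply: (grextZ (G := grA)); [exact: Dl..|move=> i a ha].
  rewrite !(tcomp2_homog n _ ha) dga_grZ; exact: (bilinZr (tpure_bilin _ _)).
Qed.

Definition tcomp n (x : tens_type) : tens_type := tlift (tcomp2 n) x.

Lemma tcompD n : {morph tcomp n : x y / x + y}.
Proof. exact: tliftD (tcomp2_bilin n). Qed.

Lemma tcomp_pure n i j a b : homogeneous grA i a -> homogeneous grB j b ->
  tcomp n (tpure a b) = if n == i + j then tpure a b else 0.
Proof.
move=> ha hb; rewrite /tcomp (tlift_pure _ _ (tcomp2_bilin n)).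
rewrite (tcomp2_homog n _ ha) (compE _ hb) subr_eq addrC.
by case: eqP => // _; rewrite (bilin0r (tpure_bilin _ _)).
Qed.

Lemma tcomp_fin (x : tens_type) : exists2 s : seq (int * tens_type),
  x = \sum_(p <- s) p.2 &
  {in s, forall p n, tcomp n p.2 = if n == p.1 then p.2 else 0}.
Proof.
move: x; apply: thind => [|x y [s xs sP] [t yt tP]|i j a b ha hb].
- by exists [::]; rewrite ?big_nil.
- exists (s ++ t); first by rewrite big_cat -xs -yt.
  by move=> p; rewrite mem_cat => /orP[/sP|/tP].
- exists [:: (i + j, tpure a b)]; first by rewrite big_seq1.
  by move=> p; rewrite inE => /eqP -> n /=; exact: tcomp_pure.
Qed.

Definition tgr : grading tens_type := grading_of tcompD tcomp_fin.

Lemma tens_scalable i : scalable (tgr i).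
Proof. exact: (linZ (tlift_linear (tcomp2_bilin i))). Qed.

Lemma homog_tpure i j a b : homogeneous grA i a -> homogeneous grB j b ->
  homogeneous tgr (i + j) (tpure a b).
Proof. by move=> ha hb; rewrite /homogeneous [LHS](tcomp_pure _ ha hb) eqxx. Qed.

Lemma homog_tone : homogeneous tgr 0 1.
Proof. by rewrite -[0]addr0; apply: homog_tpure; exact: dga_1. Qed.

Lemma thomog_ind n (P : tens_type -> Prop) :
  P 0 -> (forall x y, P x -> P y -> P (x + y)) ->
  (forall i j a b, i + j = n -> homogeneous grA i a -> homogeneous grB j b ->
     P (tpure a b)) ->
  forall x, homogeneous tgr n x -> P x.
Proof.
move=> P0 PD Ph x <-; move: x; apply: thind => [|x y Px Py|i j a b ha hb].
- by rewrite (morphD0 (compD tgr n)).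
- by rewrite (compD tgr n); exact: PD.
rewrite [tgr _ _](tcomp_pure n ha hb); case: eqP => // e.
by apply: Ph ha hb; rewrite e.
Qed.

Lemma tens_mul i j (x y : tens_type) :
  homogeneous tgr i x -> homogeneous tgr j y -> homogeneous tgr (i + j) (x * y).
Proof.
move=> hx hy; move: x hx; apply: thomog_ind => [|x x' hx hx'|p q a b pq ha hb].
- by rewrite mul0r; exact: homog0.
- by rewrite mulrDl; exact: homogD.
move: y hy; apply: thomog_ind => [|y y' hy hy'|p' q' a' b' pq' ha' hb'].
- by rewrite mulr0; exact: homog0.
- by rewrite mulrDr; exact: homogD.
rewrite [_ * _](tmul_pure _ _ hb ha'); apply: homog_ksign.
rewrite -pq -pq' addrACA.
by apply: homog_tpure; exact: dga_mul.
Qed.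

Definition td2 (a : A) (b : B) : tens_type :=
  (tpure (dga_d a) b : T) + tpure (twist grA 1 a) (dga_d b).

Lemma td2_bilin : bilin td2.
Proof.
apply: bilinP => [b x y|a x y|c a b|c a b]; rewrite /td2 /=.
- by rewrite dga_dD twistD !(bilinDl (tpure_bilin _ _)) addrACA.
- by rewrite dga_dD !(bilinDr (tpure_bilin _ _)) addrACA.
- by rewrite dga_dZ twistZ !(bilinZl (tpure_bilin _ _)) scalerDr.
- by rewrite dga_dZ !(bilinZr (tpure_bilin _ _)) scalerDr.
Qed.

(* d (a (x) b) = d a (x) b + (-1)^|a| a (x) d b *)
Definition td (x : tens_type) : tens_type := tlift td2 x.

Lemma tdD : {morph td : x y / x + y}.
Proof. exact: tliftD td2_bilin. Qed.

Lemma td_ksign i x : td (ksign i x) = ksign i (td x).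
Proof. exact: (ksign_morph i x tdD). Qed.

Lemma td_pure i a b : homogeneous grA i a ->
  td (tpure a b) = (tpure (dga_d a) b : T) + ksign i (tpure a (dga_d b) : T).
Proof.
move=> ha; rewrite /td (tlift_pure _ _ td2_bilin) /td2 (twist_homog 1 ha) mulr1.
by rewrite (bilin_ksignl (tpure_bilin _ _)).
Qed.

Lemma tens_ddeg i x : homogeneous tgr i x -> homogeneous tgr (i + 1) (td x).
Proof.
move: x; apply: thomog_ind => [|x x' hx hx'|p q a b <- ha hb].
- by rewrite (morphD0 tdD); exact: homog0.
- by rewrite tdD; exact: homogD.
rewrite (td_pure _ ha); apply: homogD; last apply: homog_ksign.
  by rewrite addrAC; apply: homog_tpure => //; exact: dga_ddeg.
by rewrite -addrA; apply: homog_tpure => //; exact: dga_ddeg.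
Qed.

Lemma tens_dd x : td (td x) = 0.
Proof.
move: x; apply: (@thext _ (td \o td) (fun=> 0)) => [x y|x y|i j a b ha hb] /=.
- by rewrite !tdD.
- by rewrite addr0.
rewrite (td_pure _ ha) tdD td_ksign (td_pure _ (dga_ddeg ha)) (td_pure _ ha).
rewrite !dga_dd (bilin0l (tpure_bilin _ _)) (bilin0r (tpure_bilin _ _)).
rewrite add0r /ksign !oddzE; case: odd; rewrite /= ?oppr0 addr0 ?subrr//.
by rewrite addNr.
Qed.

Lemma tens_leibniz i x y : homogeneous tgr i x ->
  td (x * y) = td x * y + ksign i (x * td y).
Proof.
move: x; apply: thomog_ind => [|x x' hx hx'|p q a b <- ha hb].
- by rewrite (morphD0 tdD) !mul0r (morphD0 tdD) add0r /ksign oppr0 if_same.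
- by rewrite mulrDl !tdD !mulrDl hx hx' ksignD addrACA.
move: y; apply: thext => [y y'|y y'|p' q' a' b' ha' hb'].
- by rewrite mulrDr tdD.
- by rewrite tdD !mulrDr ksignD addrACA.
rewrite [X in td X](tmul_pure _ _ hb ha') td_ksign.
rewrite (td_pure _ (dga_mul ha ha')) (td_pure _ ha) (td_pure _ ha').
rewrite mulrDl mulrDr (dga_leibniz _ ha) (dga_leibniz _ hb) ksignMl ksignMr.
have ME (x y : tens_type) : x * y = tmul x y by [].
rewrite !ME.
rewrite [in RHS](tmul_pure (dga_d a) b' hb ha').
rewrite [in RHS](tmul_pure a b' (dga_ddeg hb) ha').
rewrite [in RHS](tmul_pure a b' hb (dga_ddeg ha')).
rewrite [in RHS](tmul_pure a (dga_d b') hb ha').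
rewrite (bilinDl (tpure_bilin _ _)) (bilinDr (tpure_bilin _ _)).
rewrite (bilin_ksignl (tpure_bilin _ _)) (bilin_ksignr (tpure_bilin _ _)).
rewrite !ksignD !ksign_comp -!addrA; congr (_ + _).
rewrite [LHS]addrCA; congr (_ + (_ + _)).
all: by apply: eq_ksign; rewrite !oddzE /=; case: (odd (absz p)) (odd (absz q)) (odd (absz p')) => [] [] [].
Qed.

Definition tensDGA : dgAlgebra k := @DGAlgebra k tens_type tgr td
  tens_scalable homog_tone tens_mul (tlift_linear td2_bilin)
  tens_ddeg tens_dd tens_leibniz.

End TensorDGA.

Definition envDGA (k : fieldType) (A : dgAlgebra k) : dgAlgebra k :=
  tensDGA A (opDGA A).

(* k-linearity of the components and of the differential is automatic, since
   k.1 consists of cocycles of degree 0. *)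
Record dgModule (k : fieldType) (A : dgAlgebra k) := DGModule {
  dgm_mod :> lmodType A;
  dgm_gr : grading dgm_mod;
  dgm_d : dgm_mod -> dgm_mod;
  dgm_act : forall i j (a : A) x, homogeneous (dga_gr A) i a -> homogeneous dgm_gr j x ->
    homogeneous dgm_gr (i + j) (a *: x);
  dgm_dD : {morph dgm_d : x y / x + y};
  dgm_ddeg : forall i x, homogeneous dgm_gr i x -> homogeneous dgm_gr (i + 1) (dgm_d x);
  dgm_dd : forall x, dgm_d (dgm_d x) = 0;
  dgm_leibniz : forall i (a : A) x, homogeneous (dga_gr A) i a ->
    dgm_d (a *: x) = dga_d a *: x + ksign i (a *: dgm_d x) }.

Arguments dgm_gr {k A} _.
Arguments dgm_d {k A _} _.

Record dgHom (k : fieldType) (A : dgAlgebra k) (M N : dgModule A) := DGHom {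
  dgh_fun :> {linear M -> N};
  dgh_gr : forall i x, dgh_fun (dgm_gr M i x) = dgm_gr N i (dgh_fun x);
  dgh_d : forall x, dgh_fun (dgm_d x) = dgm_d (dgh_fun x) }.

Section DGCategory.
Variables (k : fieldType) (A : dgAlgebra k).
Implicit Types M N P : dgModule A.

Definition dgid M : dgHom M M :=
  @DGHom k A M M idfun (fun _ _ => erefl) (fun _ => erefl).

Lemma dgcomp_gr M N P (g : dgHom N P) (f : dgHom M N) i x :
  (g \o f) (dgm_gr M i x) = dgm_gr P i ((g \o f) x).
Proof. by rewrite /= !dgh_gr. Qed.

Lemma dgcomp_d M N P (g : dgHom N P) (f : dgHom M N) x :
  (g \o f) (dgm_d x) = dgm_d ((g \o f) x).
Proof. by rewrite /= !dgh_d. Qed.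

Definition dgcomp M N P (g : dgHom N P) (f : dgHom M N) : dgHom M P :=
  @DGHom k A M P (g \o f) (dgcomp_gr g f) (dgcomp_d g f).

Lemma dgzero_gr M N i x :
  (\0 : {linear M -> N}) (dgm_gr M i x) = dgm_gr N i ((\0 : {linear M -> N}) x).
Proof. by rewrite /= comp0. Qed.

Lemma dgzero_d M N x :
  (\0 : {linear M -> N}) (dgm_d x) = dgm_d ((\0 : {linear M -> N}) x).
Proof. by rewrite /= (morphD0 (@dgm_dD k A N)). Qed.

Definition dgzero M N : dgHom M N :=
  @DGHom k A M N \0 (@dgzero_gr M N) (@dgzero_d M N).

(* H(f) is bijective *)
Definition quasi_iso M N (f : dgHom M N) : Prop :=
  (forall n : N, dgm_d n = 0 ->
     exists m : M, dgm_d m = 0 /\ exists w : N, n = f m + dgm_d w) /\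
  (forall m : M, dgm_d m = 0 -> (exists w : N, f m = dgm_d w) ->
     exists v : M, m = dgm_d v).

Definition homotopic M N (f g : dgHom M N) : Prop :=
  exists h : M -> N,
    [/\ {morph h : x y / x + y},
        forall i x, homogeneous (dgm_gr M) i x -> homogeneous (dgm_gr N) (i - 1) (h x),
        forall i (a : A) x, homogeneous (dga_gr A) i a ->
          h (a *: x) = ksign i (a *: h x) &
        forall x, f x - g x = dgm_d (h x) + h (dgm_d x)].

(* A morphism M -> N of D(A), the localization of the homotopy category at the
   quasi-isomorphisms, is a roof M <- X -> N up to [req]. *)
Record roof M N := Roof {
  apex : dgModule A;
  den : dgHom apex M;
  num : dgHom apex N;
  den_qis : quasi_iso den }.

Definition req M N (p q : roof M N) : Prop :=
  exists (Y : dgModule A) (u : dgHom Y (apex p)) (v : dgHom Y (apex q)),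
    [/\ quasi_iso u,
        homotopic (dgcomp (den p) u) (dgcomp (den q) v) &
        homotopic (dgcomp (num p) u) (dgcomp (num q) v)].

Lemma dgid_qis M : quasi_iso (dgid M).
Proof.
split=> [n dn|m dm [w wE]]; last by exists w; exact: wE.
by exists n; split=> //; exists 0; rewrite (morphD0 (@dgm_dD k A M)) addr0.
Qed.

Definition roof_of M N (f : dgHom M N) : roof M N := Roof f (dgid_qis M).

(* [r] is the composite of [p] followed by [q]. *)
Definition rcomp M N P (p : roof M N) (q : roof N P) (r : roof M P) : Prop :=
  exists (Y : dgModule A) (u : dgHom Y (apex p)) (v : dgHom Y (apex q))
         (t : quasi_iso (dgcomp (den p) u)),
    [/\ quasi_iso u,
        homotopic (dgcomp (num p) u) (dgcomp (den q) v) &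
        req r (Roof (dgcomp (num q) v) t)].

Definition diso M N : Prop :=
  exists (p : roof M N) (q : roof N M),
    rcomp p q (roof_of (dgid M)) /\ rcomp q p (roof_of (dgid N)).

(* S, with the injections [inj], is the direct sum of the family N; direct sums
   are the coproducts of D(A). *)
Definition is_dsum (I : choiceType) (N : I -> dgModule A) (S : dgModule A)
    (inj : forall i, dgHom (N i) S) : Prop :=
  (forall x : S, exists (s : seq I) (y : forall i, N i),
     uniq s /\ x = \sum_(i <- s) inj i (y i)) /\
  (forall (s : seq I) (y : forall i, N i), uniq s ->
     \sum_(i <- s) inj i (y i) = 0 -> forall i, i \in s -> y i = 0).

(* [r] is the sum over [i <- s] of the composites inj_i o p_i in D(A); the sum
   is computed after reduction of the p_i to a common denominator. *)
Definition rsum M (I : choiceType) (N : I -> dgModule A) (S : dgModule A)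
    (inj : forall i, dgHom (N i) S) (s : seq I) (p : forall i, roof M (N i))
    (r : roof M S) : Prop :=
  exists (Y : dgModule A) (q : dgHom Y M) (Q : quasi_iso q)
         (g : forall i, dgHom Y (N i)) (h : dgHom Y S),
    [/\ forall i, i \in s -> req (p i) (Roof (g i) Q),
        forall y, h y = \sum_(i <- s) inj i (g i y) &
        req r (Roof h Q)].

(* For every direct sum, the canonical map from the direct sum of the
   Hom(M, N_i) to Hom(M, S) is surjective and injective. *)
Definition dcompact M : Prop :=
  forall (I : choiceType) (N : I -> dgModule A) (S : dgModule A)
         (inj : forall i, dgHom (N i) S), is_dsum inj ->
    (forall r : roof M S, exists (s : seq I) (p : forall i, roof M (N i)),
       uniq s /\ rsum inj s p r) /\
    (forall (s : seq I) (p : forall i, roof M (N i)), uniq s ->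
       rsum inj s p (roof_of (dgzero M S)) ->
       forall i, i \in s -> req (p i) (roof_of (dgzero M (N i)))).

(* E is a basis of the graded module underlying F, made of homogeneous
   elements, and the differential of an element of E of level u lies in the
   submodule generated by the elements of E of level < u. *)
Definition semi_basis (F : dgModule A) (E : set F) : Prop :=
  [/\ forall e, E e -> exists i, homogeneous (dgm_gr F) i e,
      forall x : F, exists (s : seq F) (c : F -> A),
        (forall e, e \in s -> E e) /\ x = \sum_(e <- s) c e *: e,
      forall (s : seq F) (c : F -> A), uniq s -> (forall e, e \in s -> E e) ->
        \sum_(e <- s) c e *: e = 0 -> forall e, e \in s -> c e = 0 &
      exists lvl : F -> nat, forall e, E e ->
        exists (s : seq F) (c : F -> A),
          (forall e', e' \in s -> E e' /\ (lvl e' < lvl e)%N) /\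
          dgm_d e = \sum_(e' <- s) c e' *: e'].

Definition semi_free (F : dgModule A) : Prop := exists E : set F, semi_basis E.

Definition semi_free_resolution M (F : dgModule A) (f : dgHom F M) : Prop :=
  semi_free F /\ quasi_iso f.

(* the augmentation ideal, when A is connected *)
Definition in_mideal (a : A) : Prop :=
  forall i : int, (i <= 0)%R -> dga_gr A i a = 0.

Definition minimal (F : dgModule A) : Prop :=
  forall x : F, exists s : seq (A * F),
    (forall p, p \in s -> in_mideal p.1) /\
    dgm_d x = \sum_(p <- s) p.1 *: p.2.

End DGCategory.

Definition connected (k : fieldType) (A : dgAlgebra k) : Prop :=
  (forall i (a : A), i < 0 -> homogeneous (dga_gr A) i a -> a = 0) /\
  (forall a : A, homogeneous (dga_gr A) 0 a -> exists c : k, a = c%:A).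

Section Trivial.
Variables (k : fieldType) (A : dgAlgebra k) (cA : connected A).
Local Notation gr := (dga_gr A).

Definition aug (a : A) : k := projT1 (cid (cA.2 _ (homog_comp gr 0 a))).

Lemma augE a : gr 0 a = (aug a)%:A.
Proof. by rewrite /aug; case: cid. Qed.

Lemma aug_uniq a c : gr 0 a = c%:A -> aug a = c.
Proof.
rewrite augE => /eqP; rewrite -subr_eq0 -scalerBl scaler_eq0 oner_eq0 orbF.
by rewrite subr_eq0 => /eqP.
Qed.

Lemma aug_neq0 i a : homogeneous gr i a -> i != 0 -> aug a = 0.
Proof.
by move=> ha i0; apply: aug_uniq; rewrite (compE _ ha) eq_sym (negbTE i0) scale0r.
Qed.

Lemma augD : {morph aug : x y / x + y}.
Proof. by move=> x y; apply: aug_uniq; rewrite compD !augE scalerDl. Qed.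

Lemma aug1 : aug 1 = 1.
Proof. by apply: aug_uniq; rewrite (dga_1 A) scale1r. Qed.

Lemma augM x y : aug (x * y) = aug x * aug y.
Proof.
move: x; apply: (grext (G := gr)) => [x x'|x x'|i x hx].
- by rewrite mulrDl augD.
- by rewrite augD mulrDl.
move: y; apply: (grext (G := gr)) => [y y'|y y'|j y hy].
- by rewrite mulrDr augD.
- by rewrite augD mulrDr.
have aug0 : aug 0 = 0 by exact: morphD0 augD.
have [i0|i0|i0] := ltgtP i 0.
- by rewrite (cA.1 _ _ i0 hx) mul0r aug0 mul0r.
- rewrite (aug_neq0 hx) ?gt_eqF// mul0r.
  have [j0|j0|j0] := ltgtP j 0.
  + by rewrite (cA.1 _ _ j0 hy) mulr0 aug0.
  + by rewrite (aug_neq0 (dga_mul hx hy))// gt_eqF// addr_gt0.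
  + by rewrite (aug_neq0 (dga_mul hx hy))// j0 addr0 gt_eqF.
subst i; have [c xE] := cA.2 _ hx.
have -> : aug x = c by apply: aug_uniq; rewrite hx.
by apply: aug_uniq; rewrite xE -scalerAl mul1r dga_grZ augE scalerA.
Qed.

(* k as a left DG module, concentrated in degree 0, through the augmentation A -> A/m_A = k *)
Definition triv_type : Type := let _ := cA in k.

HB.instance Definition _ := GRing.Zmodule.copy triv_type k.

Definition triv_scale (a : A) (x : triv_type) : triv_type := aug a * (x : k).

Lemma triv_scaleA a b x : triv_scale a (triv_scale b x) = triv_scale (a * b) x.
Proof. by rewrite /triv_scale augM mulrA. Qed.
Lemma triv_scale1 : left_id 1 triv_scale.
Proof. by move=> x; rewrite /triv_scale aug1 mul1r. Qed.
Lemma triv_scaleDr : right_distributive triv_scale +%R.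
Proof. by move=> a x y; exact: mulrDr. Qed.
Lemma triv_scaleDl x : {morph triv_scale^~ x : a b / a + b}.
Proof. by move=> a b; rewrite /triv_scale augD; exact: mulrDl. Qed.

HB.instance Definition _ := GRing.Zmodule_isLmodule.Build A triv_type
  triv_scaleA triv_scale1 triv_scaleDr triv_scaleDl.

Definition triv_comp (i : int) (x : triv_type) : triv_type :=
  if i == 0 then x else 0.

Lemma triv_compD i : {morph triv_comp i : x y / x + y}.
Proof. by move=> x y; rewrite /triv_comp; case: eqP; rewrite ?addr0. Qed.

Lemma triv_fin (x : triv_type) : exists2 s : seq (int * triv_type),
  x = \sum_(p <- s) p.2 &
  {in s, forall p n, triv_comp n p.2 = if n == p.1 then p.2 else 0}.
Proof.
exists [:: (0, x)]; first by rewrite big_seq1.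
by move=> p; rewrite inE => /eqP ->.
Qed.

Definition triv_gr : grading triv_type := grading_of triv_compD triv_fin.

Lemma triv_homog i x : homogeneous triv_gr i x -> i != 0 -> x = 0.
Proof. by move=> hx i0; rewrite -hx /= /triv_comp (negbTE i0). Qed.

Lemma triv_act i j a (x : triv_type) : homogeneous gr i a -> homogeneous triv_gr j x ->
  homogeneous triv_gr (i + j) (a *: x).
Proof.
move=> ha hx; have [j0|j0] := eqVneq j 0; last first.
  by rewrite (triv_homog hx j0) scaler0; exact: homog0.
have [i0|i0] := eqVneq i 0; first by rewrite i0 j0 /homogeneous /= /triv_comp eqxx.
rewrite [_ *: _](_ : _ = 0); first exact: homog0.
by rewrite [LHS](_ : _ = aug a * (x : k))// (aug_neq0 ha i0) mul0r.
Qed.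

Lemma triv_leibniz i a (x : triv_type) : homogeneous gr i a ->
  (0 : triv_type) = dga_d a *: x + ksign i (a *: (0 : triv_type)).
Proof.
move=> ha; rewrite scaler0 ksign0 addr0.
rewrite [RHS](_ : _ = aug (dga_d a) * (x : k))//.
have [i0|i0] := eqVneq (i + 1) 0; last first.
  by rewrite (aug_neq0 (dga_ddeg ha) i0) mul0r.
have il : i < 0 by rewrite -(ltrD2r 1) i0.
rewrite (cA.1 _ _ il ha) (morphD0 (@dga_dD k A)).
by rewrite (morphD0 augD) mul0r.
Qed.

Definition trivMod : dgModule A.
Proof.
refine (@DGModule k A triv_type triv_gr (fun=> 0) triv_act _ _ _ triv_leibniz).
- by move=> x y; rewrite addr0.
- by move=> *; exact: homog0.
- by [].
Defined.

End Trivial.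

Section Suspension.
Variables (k : fieldType) (A : dgAlgebra k) (j : int) (M : dgModule A).
Local Notation gr := (dga_gr A).
Local Notation grM := (dgm_gr M).

Definition susp_type : Type := let _ := j in M.
HB.instance Definition _ := GRing.Zmodule.copy susp_type M.

Definition susp_scale (a : A) (x : susp_type) : susp_type :=
  twist gr j a *: (x : M).

Lemma susp_scaleA a b x : susp_scale a (susp_scale b x) = susp_scale (a * b) x.
Proof. by rewrite /susp_scale twistM [LHS]scalerA. Qed.
Lemma susp_scale1 : left_id 1 susp_scale.
Proof. by move=> x; rewrite /susp_scale twist1 [LHS]scale1r. Qed.
Lemma susp_scaleDr : right_distributive susp_scale +%R.
Proof. by move=> a x y; exact: scalerDr. Qed.
Lemma susp_scaleDl x : {morph susp_scale^~ x : a b / a + b}.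
Proof. by move=> a b; rewrite /susp_scale twistD; exact: scalerDl. Qed.

HB.instance Definition _ := GRing.Zmodule_isLmodule.Build A susp_type
  susp_scaleA susp_scale1 susp_scaleDr susp_scaleDl.

Definition susp_comp (i : int) (x : susp_type) : susp_type := grM (i + j) x.

Lemma susp_compD i : {morph susp_comp i : x y / x + y}.
Proof. exact: compD. Qed.

Lemma susp_fin (x : susp_type) : exists2 s : seq (int * susp_type),
  x = \sum_(p <- s) p.2 &
  {in s, forall p n, susp_comp n p.2 = if n == p.1 then p.2 else 0}.
Proof.
have [s us xE] := comp_sum grM x.
exists [seq (i - j, grM i x) | i <- s]; first by rewrite big_map.
move=> p /mapP[i _ ->] n /=.
by rewrite /susp_comp comp_comp (_ : (n + j == i) = (n == i - j)) //; lia.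
Qed.

Definition susp_gr : grading susp_type := grading_of susp_compD susp_fin.

Lemma susp_homog i (x : susp_type) : homogeneous susp_gr i x <-> homogeneous grM (i + j) x.
Proof. by []. Qed.

Lemma susp_scale_homog i a (x : susp_type) : homogeneous gr i a ->
  a *: x = ksign (i * j) ((a *: (x : M)) : M).
Proof. by move=> ha; rewrite [LHS](_ : _ = susp_scale a x)// /susp_scale (twist_homog _ ha) ksignZl. Qed.

Lemma susp_act i l a (x : susp_type) : homogeneous gr i a -> homogeneous susp_gr l x ->
  homogeneous susp_gr (i + l) (a *: x).
Proof.
move=> ha /susp_homog hx; apply/susp_homog.
rewrite (susp_scale_homog _ ha); apply: homog_ksign; rewrite -addrA.
exact: dgm_act.
Qed.

Definition susp_d (x : susp_type) : susp_type := ksign j (dgm_d (x : M)).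

Lemma dgm_d_ksign i (x : M) : dgm_d (ksign i x) = ksign i (dgm_d x).
Proof. exact: (ksign_morph i x (@dgm_dD k A M)). Qed.

(* (Sigma^j M)^i = M^(i+j), with differential (-1)^j d and action
   a . x = (-1)^(j |a|) a x *)
Definition suspMod : dgModule A.
Proof.
refine (@DGModule k A susp_type susp_gr susp_d susp_act _ _ _ _).
- by move=> x y; rewrite /susp_d dgm_dD ksignD.
- move=> i x /susp_homog hx; apply/susp_homog; apply: homog_ksign.
  by rewrite addrAC; exact: dgm_ddeg.
- by move=> x; rewrite /susp_d dgm_d_ksign dgm_dd !ksign0.
- move=> i a x ha.
  change (ksign j (dgm_d (twist gr j a *: (x : M))) =
    twist gr j (dga_d a) *: (x : M) +
    ksign i (twist gr j a *: ksign j (dgm_d (x : M)))).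
  rewrite (twist_homog _ ha) (twist_homog _ (dga_ddeg ha)) !ksignZl ksignZ.
  rewrite dgm_d_ksign (dgm_leibniz _ ha) !ksignD !ksign_comp.
  congr (_ + _); apply: eq_ksign; rewrite !oddzE /=;
  by case: (odd (absz i)) (odd (absz j)) => [] [].
Defined.

End Suspension.

Section Diagonal.
Variables (k : fieldType) (A : dgAlgebra k).
Local Notation gr := (dga_gr A).
Local Notation E := (envDGA A).

Lemma opmul_ksignl i (x y : A) : opmul A (ksign i x) y = ksign i (opmul A x y).
Proof. by apply: (ksign_morph (f := (opmul A)^~ y)) => u v; exact: opmulDl. Qed.

Lemma opmul_ksignr i (x y : A) : opmul A x (ksign i y) = ksign i (opmul A x y).
Proof. by apply: ksign_morph => u v; exact: opmulDr. Qed.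

(* A as a left A^e-module: (a (x) b) . x = (-1)^(|b| |x|) a x b *)
Definition dl_type : Type := A.
HB.instance Definition _ := GRing.Zmodule.copy dl_type A.

Definition dl2 (x a b : A) : A := a * opmul A b x.

Lemma dl2_bilin x : @bilin k A (opDGA A) A (dl2 x).
Proof.
apply: bilinP => [b a a'|a b b'|c a b|c a b] /=; rewrite /dl2.
- exact: mulrDl.
- by rewrite -mulrDr; congr (_ * _); exact: opmulDl.
- by rewrite -scalerAl.
- by rewrite scalerAr; congr (_ * _); exact: opmulZl.
Qed.

Definition dl_scale (u : E) (x : dl_type) : dl_type := tlift (V := opDGA A) (dl2 x) u.

Lemma dl_pure (a b x : A) :
  dl_scale (@tpure k A (opDGA A) a b) x = a * opmul A b x.
Proof. by rewrite /dl_scale (tlift_pure _ _ (dl2_bilin x)). Qed.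

Lemma dl_scaleDl x : {morph dl_scale^~ x : a b / a + b}.
Proof. exact: tliftD (dl2_bilin x). Qed.

Lemma dl_scaleDr : right_distributive dl_scale +%R.
Proof.
move=> u x y; move: u.
apply: (thextD (f := dl_scale^~ (x + y)) (g := dl_scale^~ x)
  (h := dl_scale^~ y)); [exact: dl_scaleDl..|move=> i j a b _ _].
by rewrite !dl_pure opmulDr mulrDr.
Qed.

Lemma dl_scale_ksignl i u x : dl_scale (ksign i u) x = ksign i (dl_scale u x).
Proof. exact: (ksign_morph i u (dl_scaleDl x)). Qed.

Lemma dl_scaleA u v x : dl_scale u (dl_scale v x) = dl_scale (u * v) x.
Proof.
move: u; apply: thext => [u u'|u u'|i j a b ha hb].
- exact: dl_scaleDl.
- by rewrite mulrDl dl_scaleDl.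
move: v; apply: thext => [v v'|v v'|i' j' a' b' ha' hb'].
- by rewrite dl_scaleDl dl_scaleDr.
- by rewrite mulrDr dl_scaleDl.
move: x; apply: (grext (G := gr)) => [x y|x y|l x hx].
- by rewrite !dl_scaleDr.
- by rewrite !dl_scaleDr.
have hb0 : homogeneous gr j b := hb; have hb0' : homogeneous gr j' b' := hb'.
rewrite [X in _ = dl_scale X _](tmul_pure _ _ hb ha') dl_scale_ksignl !dl_pure.
rewrite [b * b'](_ : _ = opmul A b b')// -opmulA (opmul_homog hb0' hx).
rewrite !ksignMr !opmul_ksignr ksignMr.
rewrite (opmul_homog hb0 (dga_mul ha' (dga_mul hx hb0'))).
rewrite (opmul_homog hb0 (dga_mul hx hb0')) !ksignMr !ksign_comp !mulrA.
by apply: eq_ksign; rewrite !oddzE;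
  case: (odd (absz i')) (odd (absz j)) (odd (absz j')) (odd (absz l))
    => [] [] [] [].
Qed.

Lemma dl_scale1 : left_id 1 dl_scale.
Proof. by move=> x; rewrite [LHS]dl_pure opmul1l mul1r. Qed.

HB.instance Definition _ := GRing.Zmodule_isLmodule.Build E dl_type
  dl_scaleA dl_scale1 dl_scaleDr dl_scaleDl.

Definition dl_gr : grading dl_type := gr.

Lemma dl_act i j (u : E) (x : dl_type) : homogeneous (dga_gr E) i u ->
  homogeneous dl_gr j x -> homogeneous dl_gr (i + j) (u *: x).
Proof.
move=> + hx; move: u; apply: thomog_ind => [|u v hu hv|p q a b <- ha hb].
- by rewrite scale0r; exact: homog0.
- by rewrite scalerDl; exact: homogD.
have hb0 : homogeneous gr q b := hb.
rewrite [_ *: _]dl_pure (opmul_homog hb0 hx) ksignMr; apply: homog_ksign.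
rewrite -addrA; apply: dga_mul => //; rewrite addrC; exact: dga_mul.
Qed.

Lemma dl_leibniz i (u : E) (x : A) : homogeneous (dga_gr E) i u ->
  dga_d (dl_scale u x) = dl_scale (dga_d u) x + ksign i (dl_scale u (dga_d x)).
Proof.
move: u; apply: thomog_ind => [|u v hu hv|p q a b <- ha hb].
- rewrite (morphD0 (@dga_dD k E)) !(morphD0 (dl_scaleDl _)).
  by rewrite (morphD0 (@dga_dD k A)) ksign0 addr0.
- by rewrite !(dl_scaleDl, dga_dD) hu hv ksignD addrACA.
have hb0 : homogeneous gr q b := hb.
rewrite [X in dl_scale X x + _](td_pure _ ha) dl_scaleDl dl_scale_ksignl !dl_pure.
rewrite (dga_leibniz _ ha) -addrA; congr (_ + _).
have -> := op_leibniz A x hb0.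
by rewrite mulrDr ksignD ksignMr ksign_comp.
Qed.

Definition diagL : dgModule E := @DGModule k E dl_type dl_gr (@dga_d k A)
  dl_act (@dga_dD k A) (@dga_ddeg k A) (@dga_dd k A) dl_leibniz.

(* A as a right A^e-module, x . (a (x) b) = (-1)^(|b| (|x| + |a|)) b x a, seen
   as a left module over the opposite of A^e: on homogeneous elements
   u . x = (-1)^(|u| |x|) x . u, that is
   (a (x) b) . x = (-1)^(|a| (|b| + |x|)) b x a. *)
Definition dr_type : Type := A.
HB.instance Definition _ := GRing.Zmodule.copy dr_type A.

Definition dr2 (x a b : A) : A := opmul A a (b * x).

Lemma dr2_bilin x : @bilin k A (opDGA A) A (dr2 x).
Proof.
apply: bilinP => [b a a'|a b b'|c a b|c a b] /=; rewrite /dr2.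
- exact: opmulDl.
- by rewrite -opmulDr; congr (opmul A _ _); exact: mulrDl.
- exact: opmulZl.
- by rewrite -opmulZr; congr (opmul A _ _); rewrite scalerAl.
Qed.

Definition dr_scale (u : opDGA E) (x : dr_type) : dr_type := tlift (V := opDGA A) (dr2 x) u.

Lemma dr_pure (a b x : A) :
  dr_scale (@tpure k A (opDGA A) a b) x = opmul A a (b * x).
Proof. by rewrite /dr_scale (tlift_pure _ _ (dr2_bilin x)). Qed.

Lemma dr_scaleDl x : {morph dr_scale^~ x : a b / a + b}.
Proof. exact: tliftD (dr2_bilin x). Qed.

Lemma dr_scaleDr : right_distributive dr_scale +%R.
Proof.
move=> u x y; move: u.
apply: (thextD (f := dr_scale^~ (x + y)) (g := dr_scale^~ x)
  (h := dr_scale^~ y)); [exact: dr_scaleDl..|move=> i j a b _ _].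
by rewrite !dr_pure mulrDr opmulDr.
Qed.

Lemma dr_scale_ksignl i u x : dr_scale (ksign i u) x = ksign i (dr_scale u x).
Proof. exact: (ksign_morph i u (dr_scaleDl x)). Qed.

Lemma dr_scaleA u v x : dr_scale u (dr_scale v x) = dr_scale (u * v) x.
Proof.
move: u; apply: thext => [u u'|u u'|i j a b ha hb].
- exact: dr_scaleDl.
- by rewrite mulrDl dr_scaleDl.
move: v; apply: thext => [v v'|v v'|i' j' a' b' ha' hb'].
- by rewrite dr_scaleDl dr_scaleDr.
- by rewrite mulrDr dr_scaleDl.
move: x; apply: (grext (G := gr)) => [x y|x y|l x hx].
- by rewrite !dr_scaleDr.
- by rewrite !dr_scaleDr.
have hb0 : homogeneous gr j b := hb; have hb0' : homogeneous gr j' b' := hb'.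
have hu : homogeneous (dga_gr E) (i + j) (tpure a b) by exact: homog_tpure.
have hv : homogeneous (dga_gr E) (i' + j') (tpure a' b') by exact: homog_tpure.
rewrite [X in _ = dr_scale X _](opmul_homog hu hv) dr_scale_ksignl.
rewrite [X in _ = ksign _ (dr_scale X _)](tmul_pure _ _ hb' ha) dr_scale_ksignl !dr_pure.
rewrite [(b' * b : opDGA A)](_ : _ = opmul A (b' : A) (b : A))//.
rewrite (opmul_homog hb0' hb0) ksignMl opmul_ksignr.
rewrite (opmul_homog ha' (dga_mul hb0' hx)) ksignMr opmul_ksignr.
rewrite (opmul_homog ha (dga_mul hb0 (dga_mul (dga_mul hb0' hx) ha'))).
rewrite (opmul_homog (dga_mul ha' ha) (dga_mul (dga_mul hb0 hb0') hx)).
rewrite !ksign_comp !mulrA; apply: eq_ksign; rewrite !oddzE;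
by case: (odd (absz i)) (odd (absz i')) (odd (absz j)) (odd (absz j'))
  (odd (absz l)) => [] [] [] [] [].
Qed.

Lemma dr_scale1 : left_id 1 dr_scale.
Proof. by move=> x; rewrite [LHS]dr_pure opmul1l mul1r. Qed.

HB.instance Definition _ := GRing.Zmodule_isLmodule.Build (opDGA E) dr_type
  dr_scaleA dr_scale1 dr_scaleDr dr_scaleDl.

Definition dr_gr : grading dr_type := gr.

Lemma dr_act i j (u : opDGA E) (x : dr_type) : homogeneous (dga_gr (opDGA E)) i u ->
  homogeneous dr_gr j x -> homogeneous dr_gr (i + j) (u *: x).
Proof.
move=> + hx; move: u; apply: thomog_ind => [|u v hu hv|p q a b <- ha hb].
- by rewrite scale0r; exact: homog0.
- by rewrite scalerDl; exact: homogD.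
have hb0 : homogeneous gr q b := hb.
rewrite [_ *: _]dr_pure (opmul_homog ha (dga_mul hb0 hx)); apply: homog_ksign.
rewrite -addrA addrC; apply: dga_mul => //; exact: dga_mul.
Qed.

Lemma dr_leibniz i (u : E) (x : A) : homogeneous (dga_gr E) i u ->
  dga_d (dr_scale u x) = dr_scale (dga_d u) x + ksign i (dr_scale u (dga_d x)).
Proof.
move: u; apply: thomog_ind => [|u v hu hv|p q a b <- ha hb].
- rewrite (morphD0 (@dga_dD k E)) !(morphD0 (dr_scaleDl _)).
  by rewrite (morphD0 (@dga_dD k A)) ksign0 addr0.
- by rewrite !(dr_scaleDl, dga_dD) hu hv ksignD addrACA.
have hb0 : homogeneous gr q b := hb.
rewrite [X in dr_scale X x + _](td_pure _ ha) dr_scaleDl dr_scale_ksignl !dr_pure.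
rewrite (op_leibniz A _ ha) -addrA; congr (_ + _).
rewrite (dga_leibniz x hb0) opmulDr ksignD opmul_ksignr ksign_comp.
by [].
Qed.

Definition diagR : dgModule (opDGA E) := @DGModule k (opDGA E) dr_type dr_gr
  (@dga_d k A) dr_act (@dga_dD k A) (@dga_ddeg k A) (@dga_dd k A) dr_leibniz.

End Diagonal.

Section Dual.
Variables (k : fieldType) (B : dgAlgebra k) (F : dgModule B).
Local Notation grB := (dga_gr B).
Local Notation grF := (dgm_gr F).
Local Notation opB := (opDGA B).
Local Notation FB := (F -> opB^o).

(* f is B-linear of degree n: f (b x) = (-1)^(n |b|) b f(x) *)
Definition hom_deg (n : int) (f : F -> B) : Prop :=
  [/\ {morph f : x y / x + y},
      forall i x, homogeneous grF i x -> homogeneous grB (i + n) (f x) &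
      forall i (b : B) x, homogeneous grB i b -> f (b *: x) = ksign (n * i) (b * f x)].

Definition hom_pred : {pred FB} := fun f =>
  `[< exists2 s : seq (int * FB),
        f = \sum_(p <- s) p.2 & forall p, p \in s -> hom_deg p.1 p.2 >].

Lemma hom_predP n (f : FB) : hom_deg n f -> f \in hom_pred.
Proof.
move=> hf; apply/asboolP; exists [:: (n, f)]; first by rewrite big_seq1.
by move=> p; rewrite inE => /eqP ->.
Qed.

Lemma hom_pred0 : 0 \in hom_pred.
Proof. by apply/asboolP; exists [::]; rewrite ?big_nil. Qed.

Lemma hom_predD f g : f \in hom_pred -> g \in hom_pred -> f + g \in hom_pred.
Proof.
move=> /asboolP[s -> sP] /asboolP[t -> tP]; apply/asboolP.
exists (s ++ t); first by rewrite big_cat.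
by move=> p; rewrite mem_cat => /orP[/sP|/tP].
Qed.

Lemma hom_pred_ind (P : FB -> Prop) : P 0 ->
  (forall f g, P f -> P g -> P (f + g)) ->
  (forall n f, hom_deg n f -> P f) -> forall f, f \in hom_pred -> P f.
Proof.
move=> P0 PD Ph f /asboolP[s -> sP]; rewrite big_seq.
by elim/big_ind: _ => // p /sP; exact: Ph.
Qed.

Lemma hom_actE (b : opB) (f : FB) x : (b *: f) x = opmul B b (f x).
Proof. by []. Qed.

Lemma hom_degZ i n (b : opB) (f : FB) : homogeneous grB i b -> hom_deg n f ->
  hom_deg (i + n) (b *: f).
Proof.
move=> hb [fD fg fl]; split=> [x y|j x hx|j c x hc].
- by rewrite !hom_actE fD opmulDr.
- rewrite hom_actE.
  rewrite (opmul_homog hb (fg _ _ hx)); apply: homog_ksign.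
  by rewrite [i + n]addrC addrA; apply: dga_mul => //; exact: fg.
- rewrite !hom_actE.
  move: x; apply: (grext (G := grF)) => [x y|x y|l x hx].
  + by rewrite scalerDr fD opmulDr.
  + by rewrite fD opmulDr mulrDr ksignD.
  rewrite (fl _ _ _ hc) opmul_ksignr.
  rewrite (opmul_homog hb (dga_mul hc (fg _ _ hx))) (opmul_homog hb (fg _ _ hx)).
  rewrite ksignMr !ksign_comp mulrA; apply: eq_ksign; rewrite !oddzE;
  by case: (odd (absz i)) (odd (absz n)) (odd (absz j)) (odd (absz l))
    => [] [] [] [].
Qed.

Lemma hom_predZ : GRing.scaler_closed hom_pred.
Proof.
move=> b f; move: f; apply: hom_pred_ind => [|f g hf hg|n f hf].
- by rewrite scaler0; exact: hom_pred0.
- by rewrite scalerDr; exact: hom_predD.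
move: b; apply: (grind (G := dga_gr opB)) => [|b c hb hc|i b hb].
- by rewrite scale0r; exact: hom_pred0.
- by rewrite scalerDl; exact: hom_predD.
exact: hom_predP (hom_degZ hb hf).
Qed.

Lemma hom_pred_submod : GRing.subsemimod_closed hom_pred.
Proof.
by split; [split; [exact: hom_pred0|exact: hom_predD]|exact: hom_predZ].
Qed.

HB.instance Definition _ :=
  GRing.isSubmodClosed.Build opB FB hom_pred hom_pred_submod.

Record dual_type := Dual { dual_fun :> FB; _ : dual_fun \in hom_pred }.
HB.instance Definition _ := [isSub for dual_fun].
HB.instance Definition _ := [Choice of dual_type by <:].
HB.instance Definition _ := [SubChoice_isSubLmodule of dual_type by <:].

Definition mkdual n (f : FB) (hf : hom_deg n f) : dual_type :=
  Dual (hom_predP hf).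

Lemma dual_eq (f g : dual_type) : (forall x, f x = g x) -> f = g.
Proof. by move=> fg; apply/val_inj/funext. Qed.

Lemma dual_addE (f g : dual_type) x : (f + g) x = (f x : B) + (g x : B) :> B.
Proof. by []. Qed.

Lemma dual0E x : (0 : dual_type) x = 0 :> B. Proof. by []. Qed.

Lemma dual_ind2 (P : dual_type -> Prop) : P 0 ->
  (forall f g, P f -> P g -> P (f + g)) ->
  (forall n f (hf : hom_deg n f), P (mkdual hf)) -> forall f, P f.
Proof.
move=> P0 PD Ph [f hf].
suff : forall f, f \in hom_pred -> exists2 g : dual_type, val g = f & P g.
  move=> /(_ f hf)[g gf Pg].
  by rewrite (_ : Dual hf = g)//; apply: val_inj.
apply: hom_pred_ind => [|f1 f2 [g1 <- P1] [g2 <- P2]|n g hg].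
- by exists 0.
- by exists (g1 + g2) => //; exact: PD.
- by exists (mkdual hg).
Qed.

Lemma dual_add (f : dual_type) : {morph (f : F -> B) : x y / x + y}.
Proof.
move: f; apply: dual_ind2 => [x y|f g fD gD x y|n f [fD _ _] //].
  by rewrite !dual0E addr0.
by rewrite !dual_addE fD gD addrACA.
Qed.

Definition dcomp_fun (n : int) (f : dual_type) : F -> B :=
  gsum grF (fun i x => grB (i + n) (f x : B)).

Let dcomp_aux n (f : dual_type) i :
  {morph (fun x => grB (i + n) (f x : B)) : x y / x + y}.
Proof. by move=> x y; rewrite dual_add compD. Qed.

Lemma dcomp_fun_homog n f i x : homogeneous grF i x ->
  dcomp_fun n f x = grB (i + n) (f x).
Proof. by move=> hx; rewrite /dcomp_fun (gsum_homog _ hx). Qed.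

Lemma dcomp_fun_add n f : {morph dcomp_fun n f : x y / x + y}.
Proof. exact: gsumD. Qed.

Lemma dcomp_funD n f g x :
  dcomp_fun n (f + g) x = dcomp_fun n f x + dcomp_fun n g x.
Proof.
move: x; apply: (grextD (G := grF)); [exact: dcomp_fun_add..|move=> i x hx].
by rewrite !(dcomp_fun_homog _ _ hx) -compD.
Qed.

Lemma dcomp_fun_hom n m f (hf : hom_deg m f) x :
  dcomp_fun n (mkdual hf) x = if n == m then f x else 0.
Proof.
move: x; apply: (grext (G := grF)); first exact: dcomp_fun_add.
  by move=> x y; case: eqP => _; [case: hf => -> | rewrite addr0].
move=> i x hx; rewrite (dcomp_fun_homog _ _ hx) /=; case: hf => _ fg _.
by rewrite (compE _ (fg _ _ hx)) (inj_eq (addrI i)).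
Qed.

Lemma dcomp_pred n (f : dual_type) : (dcomp_fun n f : FB) \in hom_pred.
Proof.
move: f; apply: dual_ind2 => [|f g hf hg|m f hf].
- rewrite (_ : dcomp_fun n 0 = 0 :> FB); first exact: hom_pred0.
  apply/funext; apply: (grext (G := grF)); first exact: dcomp_fun_add.
    by move=> x y; rewrite [RHS](_ : _ = 0 + 0 :> B)// addr0.
  by move=> i x hx; rewrite (dcomp_fun_homog _ _ hx) [LHS](comp0 grB).
- rewrite (_ : dcomp_fun n (f + g) = (dcomp_fun n f : FB) + dcomp_fun n g :> FB).
    exact: hom_predD.
  by apply/funext => x; exact: dcomp_funD.
- rewrite (_ : dcomp_fun n (mkdual hf) = if n == m then f else 0 :> FB).
    by case: eqP => _; [exact: hom_predP hf | exact: hom_pred0].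
  by apply/funext => x; rewrite dcomp_fun_hom; case: eqP.
Qed.

Definition dcomp n f : dual_type := Dual (dcomp_pred n f).

Lemma dcompD n : {morph dcomp n : f g / f + g}.
Proof. by move=> f g; apply: dual_eq => x; exact: dcomp_funD. Qed.

Lemma dcomp_hom n m f (hf : hom_deg m f) :
  dcomp n (mkdual hf) = if n == m then mkdual hf else 0.
Proof.
apply: dual_eq => x; rewrite [LHS]dcomp_fun_hom.
by case: (n == m).
Qed.

Lemma dcomp_fin f : exists2 s : seq (int * dual_type),
  f = \sum_(p <- s) p.2 &
  {in s, forall p n, dcomp n p.2 = if n == p.1 then p.2 else 0}.
Proof.
move: f; apply: dual_ind2 => [|f g [s fs sP] [t gt tP]|m f hf].
- by exists [::]; rewrite ?big_nil.
- exists (s ++ t); first by rewrite big_cat -fs -gt.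
  by move=> p; rewrite mem_cat => /orP[/sP|/tP].
- exists [:: (m, mkdual hf)]; first by rewrite big_seq1.
  by move=> p; rewrite inE => /eqP -> n; exact: dcomp_hom.
Qed.

Definition dual_gr : grading dual_type := grading_of dcompD dcomp_fin.

Lemma dual_homog_hom n f (hf : hom_deg n f) : homogeneous dual_gr n (mkdual hf).
Proof. by rewrite /homogeneous [LHS]dcomp_hom eqxx. Qed.

Lemma dual_homog_ind n (P : dual_type -> Prop) : P 0 ->
  (forall f g, P f -> P g -> P (f + g)) ->
  (forall f (hf : hom_deg n f), P (mkdual hf)) ->
  forall f, homogeneous dual_gr n f -> P f.
Proof.
move=> P0 PD Ph f <-; move: f; apply: dual_ind2 => [|f g Pf Pg|m f hf].
- by rewrite comp0.
- by rewrite compD; exact: PD.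
rewrite [dual_gr n _]dcomp_hom; case: eqP => // e; subst m; exact: Ph.
Qed.

Lemma dual_act i n (b : opB) f : homogeneous (dga_gr opB) i b -> homogeneous dual_gr n f ->
  homogeneous dual_gr (i + n) (b *: f).
Proof.
move=> hb; move: f; apply: dual_homog_ind => [|f g hf hg|f hf].
- by rewrite scaler0; exact: homog0.
- by rewrite scalerDr; exact: homogD.
rewrite (_ : b *: mkdual hf = mkdual (hom_degZ hb hf)); first exact: dual_homog_hom.
exact: val_inj.
Qed.

Definition dual_d_fun (f : dual_type) : F -> B := fun x =>
  dga_d (f x : B) - (twist dual_gr 1 f (dgm_d x) : B).

Lemma dual_d_funD f g x :
  dual_d_fun (f + g) x = dual_d_fun f x + dual_d_fun g x.
Proof.
rewrite /dual_d_fun twistD.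
rewrite dual_addE dga_dD.
by rewrite dual_addE opprD addrACA.
Qed.

Lemma dual_ksign i f x : (ksign i f : dual_type) x = ksign i (f x : B).
Proof. by rewrite /ksign; case: odd. Qed.

Lemma dual_d_fun_hom n f (hf : hom_deg n f) x :
  dual_d_fun (mkdual hf) x = dga_d (f x : B) - ksign n (f (dgm_d x) : B).
Proof.
rewrite /dual_d_fun (twist_homog 1 (dual_homog_hom hf)) dual_ksign mulr1.
by [].
Qed.

Lemma dual_d_hom_deg n f (hf : hom_deg n f) :
  hom_deg (n + 1) (dual_d_fun (mkdual hf)).
Proof.
have [fD fg fl] := hf; split=> [x y|i x hx|i b x hb].
- by rewrite !dual_d_fun_hom fD dga_dD dgm_dD fD ksignD opprD addrACA.
- rewrite dual_d_fun_hom addrA; apply: homogD; first exact: dga_ddeg (fg _ _ hx).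
  apply: homogN; apply: homog_ksign; rewrite addrAC.
  exact: fg _ _ (dgm_ddeg hx).
rewrite !dual_d_fun_hom (fl _ _ _ hb) (dgm_leibniz _ hb) fD.
rewrite (ksign_morph i _ fD) (fl _ _ _ hb) (fl _ _ _ (dga_ddeg hb)).
rewrite dga_d_ksign (dga_leibniz _ hb) !ksignD mulrBr ksignMr !ksign_comp.
rewrite ksignD (morphDN (ksignD ((n + 1) * i))) !ksign_comp opprD addrACA.
have e1 : ksign (n + n * (i + 1)) (dga_d b * f x) = ksign (n * i) (dga_d b * f x).
  by apply: eq_ksign; rewrite !oddzE; case: (odd (absz n)) (odd (absz i)) => [] [].
rewrite e1 subrr add0r; congr (_ - _); apply: eq_ksign; rewrite !oddzE;
by case: (odd (absz n)) (odd (absz i)) => [] [].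
Qed.

Lemma dual_d_pred f : (dual_d_fun f : FB) \in hom_pred.
Proof.
move: f; apply: dual_ind2 => [|f g hf hg|n f hf].
- rewrite (_ : dual_d_fun 0 = 0 :> FB); first exact: hom_pred0.
  apply/funext => x; rewrite /dual_d_fun (morphD0 (twistD dual_gr 1)).
  by rewrite [X in X - _](morphD0 (@dga_dD k B)) subrr.
- rewrite (_ : dual_d_fun (f + g) = (dual_d_fun f : FB) + dual_d_fun g :> FB).
    exact: hom_predD.
  by apply/funext => x; exact: dual_d_funD.
- exact: hom_predP (dual_d_hom_deg hf).
Qed.

(* d f = d o f - (-1)^|f| f o d *)
Definition dual_d f : dual_type := Dual (dual_d_pred f).

Lemma dual_dD : {morph dual_d : f g / f + g}.
Proof. by move=> f g; apply: dual_eq => x; exact: dual_d_funD. Qed.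

Lemma dual_d_mk n f (hf : hom_deg n f) :
  dual_d (mkdual hf) = mkdual (dual_d_hom_deg hf).
Proof. exact: val_inj. Qed.

Lemma dual_ddeg n f : homogeneous dual_gr n f -> homogeneous dual_gr (n + 1) (dual_d f).
Proof.
move: f; apply: dual_homog_ind => [|f g hf hg|f hf].
- by rewrite (morphD0 dual_dD); exact: homog0.
- by rewrite dual_dD; exact: homogD.
- by rewrite dual_d_mk; exact: dual_homog_hom.
Qed.

Lemma dual_dd f : dual_d (dual_d f) = 0.
Proof.
move: f; apply: dual_ind2 => [|f g hf hg|n f hf].
- by rewrite !(morphD0 dual_dD).
- by rewrite !dual_dD hf hg addr0.
apply: dual_eq => x; rewrite !dual_d_mk.
rewrite [LHS](_ : _ = dual_d_fun (mkdual (dual_d_hom_deg hf)) x)//.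
rewrite dual_d_fun_hom !dual_d_fun_hom dgm_dd.
have [fD _ _] := hf; rewrite (morphD0 fD) ksign0 subr0.
rewrite dga_dD dga_dd add0r (morphDN (@dga_dD k B)) dga_d_ksign.
rewrite [RHS](_ : _ = 0 :> B)//.
by rewrite /ksign !oddzE /=; case: odd => /=; rewrite ?opprK ?subrr // addNr.
Qed.

Lemma dual_leibniz i (b : opB) f : homogeneous (dga_gr opB) i b ->
  dual_d (b *: f) = (dga_d b : opB) *: f + ksign i (b *: dual_d f).
Proof.
move=> hb; move: f; apply: dual_ind2 => [|f g hf hg|n f hf].
- by rewrite !(scaler0, morphD0 dual_dD) ksign0 addr0.
- by rewrite !(scalerDr, dual_dD) hf hg ksignD addrACA.
have -> : b *: mkdual hf = mkdual (hom_degZ hb hf) by exact: val_inj.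
apply: dual_eq => x.
rewrite [LHS](_ : _ = dual_d_fun (mkdual (hom_degZ hb hf)) x)//.
rewrite [RHS](_ : _ = opmul B (dga_d b) (f x) +
  (ksign i (b *: dual_d (mkdual hf)) : dual_type) x)//.
rewrite dual_ksign [(b *: dual_d _) x](_ : _ =
  opmul B b (dual_d_fun (mkdual hf) x))//.
rewrite !dual_d_fun_hom !hom_actE.
rewrite (op_leibniz B _ hb) opmulDr (morphDN (@opmulDr k B b)) opmul_ksignr.
by rewrite ksignD (morphDN (ksignD i)) ksign_comp addrA.
Qed.

(* The right DG module Hom_B(F, B), with (f b)(x) = (-1)^(|b| |x|) f(x) b, seen
   as a left module over the opposite of B: (b f)(x) is the product of b and
   f(x) in the opposite of B. *)
Definition dualMod : dgModule opB := @DGModule k opB dual_type dual_gr dual_d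
  dual_act dual_dD dual_ddeg dual_dd dual_leibniz.

End Dual.

From mathcomp Require Import mpoly.

(* dim_k H(M) = n: the classes of the z_i form a basis of H(M). *)
Definition cohom_dim (k : fieldType) (A : dgAlgebra k) (M : dgModule A)
    (n : nat) : Prop :=
  exists z : 'I_n -> M,
    [/\ forall i, dgm_d (z i) = 0,
        forall x : M, dgm_d x = 0 -> exists (c : 'I_n -> k) (w : M),
          x = \sum_(i < n) (c i)%:A *: z i + dgm_d w &
        forall (c : 'I_n -> k) (w : M),
          \sum_(i < n) (c i)%:A *: z i = dgm_d w -> forall i, c i = 0].

(* The evaluation at y of polynomials over k, followed by the passage to
   classes, is a bijection onto H(A). *)
Definition polynomial_cohomology (k : fieldType) (A : dgAlgebra k) (m : nat)
    (y : 'I_m -> A) : Prop :=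
  (forall z : A, dga_d z = 0 -> exists (p : {mpoly k[m]}) (w : A),
     z = mmap (in_alg A) y p + dga_d w) /\
  (forall (p : {mpoly k[m]}) (w : A),
     mmap (in_alg A) y p = dga_d w -> p = 0).

Section Properties.
Variables (k : fieldType) (A : dgAlgebra k) (cA : connected A).

Definition koszul : Prop :=
  exists (F : dgModule A) (f : dgHom F (trivMod cA)) (E : set F),
    [/\ semi_basis E, forall e, E e -> homogeneous (dgm_gr F) 0 e,
        quasi_iso f & minimal F].

Definition homologically_smooth : Prop := dcompact (trivMod cA).

(* RHom_A(k, A) is Hom_A(F, A) for a semi-free resolution F of k; up to
   isomorphism in the derived category it does not depend on F. *)
Definition gorenstein : Prop :=
  exists (F : dgModule A) (f : dgHom F (trivMod cA)),
    semi_free_resolution f /\ cohom_dim (dualMod F) 1.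

(* Likewise RHom_(A^e)(A, A^e) is Hom_(A^e)(F, A^e) for a semi-free resolution
   F of the left DG A^e-module A. Right DG A^e-modules are left DG modules over
   the opposite of A^e. *)
Definition calabi_yau (d : int) : Prop :=
  homologically_smooth /\
  exists (F : dgModule (envDGA A)) (f : dgHom F (diagL A)),
    semi_free_resolution f /\ diso (dualMod F) (suspMod (- d) (diagR A)).

End Properties.

(* Main.v *)
(* With y_i of degree 1, the Koszul complex A (x) Lambda(e_1, ..., e_m), with
   basis in degree 0 and d e_i = y_i, is a finite semi-free resolution of k: by
   filtration it may be compared with the Koszul complex of a polynomial ring,
   which the Euler homotopy contracts in characteristic 0.  Its dual is again a
   Koszul complex, over the opposite algebra, whence the Gorenstein property.

   Over A^e, put x_i = y_i (x) 1 and z_i = 1 (x) y_i.  Since x_i z_j = - z_j x_i,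
   the differential with d e_J = sum +- (x_i + (-1)^|J| z_i) e_(J - i) squares to
   zero and gives a semi-free resolution of A.  Dualizing replaces J by its
   complement; in the cohomology of the dual, the class of degree 0 is therefore
   annihilated by x_i - z_i if m is odd, like 1 in A, and by x_i + z_i if m is
   even.  In the latter case, if A were Calabi-Yau, x_i - z_i and hence 2 x_i
   would also annihilate a class corresponding to 1, whereas y_i is not a
   coboundary. *)
Require Import Defs.
From HB Require Import structures.
From mathcomp Require Import all_boot all_order all_algebra.
From mathcomp Require Import zify.
From mathcomp Require Import boolp classical_sets.
From mathcomp Require Import mpoly.
Import Defs.

Set Implicit Arguments.
Unset Strict Implicit.
Unset Printing Implicit Defensive.

Import Order.TTheory GRing.Theory Num.Theory.
Local Open Scope ring_scope.

(** * Morphisms, homotopies and quasi-isomorphisms *)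

(** Elements of degree 1 that commute without signs are not graded commutative, and this shapes the
    proof. Evaluation of polynomials does not respect the Koszul differentials as it stands: the
    Leibniz rule produces [(-1)^|x| x y_i], so over [A] monomials are rescaled by signs, while over
    the opposite algebra the product absorbs the sign. All the complexes are instances of one
    construction, with coefficients [w b i] depending on the parity [b] of the index set; the square
    of the differential vanishes as soon as [w b i * w (~~ b) j] is symmetric in [i] and [j]. Over
    [A^e] the cohomology is not a commutative polynomial ring, and the comparison is not repeated.
    The complex is read as a one-sided Koszul complex tensored over [k] with the other factor, with
    a perturbed differential. The one-sided complex has a contraction onto its basis element of
    index the empty set; it is only [k]-linear, which is enough to push every cocycle into the line
    of that element tensored with the other factor. This treats both the resolution of [A] and, for
    [m] odd, its dual. *)

Section ModuleFacts.
Variables (k : fieldType) (A : dgAlgebra k) (M : dgModule A).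
Implicit Types x : M.

Lemma dgm_d0 : dgm_d (0 : M) = 0.
Proof. exact: morphD0 (@dgm_dD k A M). Qed.

Lemma dgm_dN x : dgm_d (- x) = - dgm_d x.
Proof. exact: morphDN (@dgm_dD k A M) x. Qed.

Lemma dgm_dB x y : dgm_d (x - y) = dgm_d x - dgm_d y.
Proof. by rewrite dgm_dD dgm_dN. Qed.

Lemma comp_d i x : dgm_gr M (i + 1) (dgm_d x) = dgm_d (dgm_gr M i x).
Proof.
move: x; apply: (grext (G := dgm_gr M)) => [x y|x y|j x hx].
- by rewrite dgm_dD compD.
- by rewrite compD dgm_dD.
rewrite (compE _ (dgm_ddeg hx)) (compE _ hx) (inj_eq (addIr _)).
by case: eqP => // _; rewrite dgm_d0.
Qed.

Lemma dgm_d_homog i x w : homogeneous (dgm_gr M) i x -> x = dgm_d w ->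
  exists2 w', homogeneous (dgm_gr M) (i - 1) w' & x = dgm_d w'.
Proof.
move=> hx xE; exists (dgm_gr M (i - 1) w); first exact: homog_comp.
by rewrite -comp_d subrK -xE hx.
Qed.

Lemma twist0 (a : A) : twist (dga_gr A) 0 a = a.
Proof.
move: a; apply: (grext (G := dga_gr A)) => [a b|a b|i a ha]; rewrite ?twistD//.
by rewrite (twist_homog _ ha) mulr0.
Qed.

End ModuleFacts.

Section HomFacts.
Variables (k : fieldType) (A : dgAlgebra k).
Implicit Types M N P X Y : dgModule A.

Lemma dgh_homog M N (f : dgHom M N) i x :
  homogeneous (dgm_gr M) i x -> homogeneous (dgm_gr N) i (f x).
Proof. by move=> hx; rewrite /homogeneous -dgh_gr hx. Qed.

Lemma homotopic_refl M N (f : dgHom M N) : homotopic f f.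
Proof.
exists (fun=> 0); split=> [x y|i x _|i a x _|x]; rewrite ?addr0 ?scaler0 ?ksign0//.
  exact: homog0.
by rewrite subrr dgm_d0.
Qed.

Lemma homotopic_sym M N (f g : dgHom M N) : homotopic f g -> homotopic g f.
Proof.
move=> [h [hD hg hl he]]; exists (fun x => - h x); split.
- by move=> x y; rewrite hD opprD.
- by move=> i x /hg; exact: homogN.
- by move=> i a x ha; rewrite (hl _ _ _ ha) scalerN (morphDN (ksignD i)).
- by move=> x; rewrite -opprB he dgm_dN opprD.
Qed.

Lemma homotopic_trans M N (f g l : dgHom M N) :
  homotopic f g -> homotopic g l -> homotopic f l.
Proof.
move=> [h [hD hg hl he]] [h' [hD' hg' hl' he']]; exists (fun x => h x + h' x); split.
- by move=> x y; rewrite hD hD' addrACA.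
- by move=> i x hx; apply: homogD; [exact: hg|exact: hg'].
- by move=> i a x ha; rewrite (hl _ _ _ ha) (hl' _ _ _ ha) scalerDr ksignD.
- by move=> x; rewrite dgm_dD addrACA -he -he' addrA subrK.
Qed.

Lemma homotopic_compl M N P (f g : dgHom M N) (p : dgHom N P) :
  homotopic f g -> homotopic (dgcomp p f) (dgcomp p g).
Proof.
move=> [h [hD hg hl he]]; exists (fun x => p (h x)); split.
- by move=> x y; rewrite hD linearD.
- by move=> i x /hg hx; exact: dgh_homog.
- by move=> i a x ha; rewrite (hl _ _ _ ha) (ksign_morph _ _ (linearD p)) linearZ.
- by move=> x; rewrite /= -linearB he linearD dgh_d.
Qed.

Lemma homotopic_compr M N P (f g : dgHom N P) (p : dgHom M N) :
  homotopic f g -> homotopic (dgcomp f p) (dgcomp g p).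
Proof.
move=> [h [hD hg hl he]]; exists (fun x => h (p x)); split.
- by move=> x y; rewrite linearD hD.
- by move=> i x hx; apply: hg; exact: dgh_homog.
- by move=> i a x ha; rewrite linearZ (hl _ _ _ ha).
- by move=> x; rewrite /= he dgh_d.
Qed.

Lemma homotopic_eq M N (f g : dgHom M N) : f =1 g -> homotopic f g.
Proof.
move=> fg; exists (fun=> 0); split=> [x y|i x _|i a x _|x];
  rewrite ?addr0 ?scaler0 ?ksign0//.
  exact: homog0.
by rewrite fg subrr dgm_d0.
Qed.

Lemma homotopic_cocycle M N (f g : dgHom M N) x :
  homotopic f g -> dgm_d x = 0 -> exists w, f x = g x + dgm_d w.
Proof.
move=> [h [hD _ _ he]] dx; exists (h x).
by rewrite -[LHS](subrK (g x)) he dx (morphD0 hD) addr0 addrC.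
Qed.

Lemma quasi_iso_comp M N P (f : dgHom M N) (g : dgHom N P) :
  quasi_iso f -> quasi_iso g -> quasi_iso (dgcomp g f).
Proof.
move=> [fs fi] [gs gi]; split=> [p dp|m dm [w /= wE]].
  have [n [dn [w ->]]] := gs _ dp; have [m [dm [v ->]]] := fs _ dn.
  exists m; split=> //; exists (g v + w).
  by rewrite linearD dgh_d dgm_dD addrA.
have [||v vE] := gi (f m); first by rewrite -dgh_d dm linear0.
  by exists w.
by apply: fi => //; exists v.
Qed.

Lemma quasi_iso_homotopic M N (f g : dgHom M N) :
  homotopic f g -> quasi_iso f -> quasi_iso g.
Proof.
move=> fg [fs fi]; split=> [n dn|m dm [w wE]].
  have [m [dm [w ->]]] := fs _ dn; exists m; split=> //.
  have [v ->] := homotopic_cocycle fg dm.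
  by exists (v + w); rewrite dgm_dD addrA.
apply: fi => //; have [v ->] := homotopic_cocycle fg dm.
by exists (w + v); rewrite wE dgm_dD.
Qed.

Lemma quasi_iso_cancel M N P (f : dgHom M N) (g : dgHom N P) :
  quasi_iso g -> quasi_iso (dgcomp g f) -> quasi_iso f.
Proof.
move=> [gs gi] [fs fi]; split=> [n dn|m dm [w wE]].
  have [|m [dm [w /= wE]]] := fs (g n); first by rewrite -dgh_d dn linear0.
  have [||v vE] := gi (n - f m); first by rewrite dgm_dB dn -dgh_d dm linear0 subrr.
    by exists w; rewrite linearB wE addrAC subrr add0r.
  by exists m; split=> //; exists v; rewrite -vE addrC subrK.
by apply: fi => //; exists (g w); rewrite /= wE dgh_d.
Qed.

End HomFacts.

(* Maps h with h (a x) = (-1)^(j |a|) a h(x): j = 0 covers linear maps and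
   j = 1 homotopies. *)
Definition semilin (k : fieldType) (A : dgAlgebra k) (M N : lmodType A) (j : int)
    (h : M -> N) : Prop :=
  {morph h : x y / x + y} /\ forall a x, h (a *: x) = twist (dga_gr A) j a *: h x.

(** * Extension and lifting of maps out of a semi-free module *)

Section SemiBasis.
Variables (k : fieldType) (A : dgAlgebra k) (F : dgModule A) (E : set F).
Hypothesis sbE : semi_basis E.

Lemma semi_basis_repr (x : F) : exists (s : seq F) (c : F -> A),
  [/\ uniq s, forall e, e \in s -> E e & x = \sum_(e <- s) c e *: e].
Proof.
have [_ gen _ _] := sbE; have [s [c [sE ->]]] := gen x.
(* A spanning list may repeat elements. Multiplicities go into the coefficients, so that freeness,
   which concerns duplicate-free lists, becomes applicable. *)
exists (undup s), (fun e => (count_mem e s)%:R * c e); split.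
- exact: undup_uniq.
- by move=> e; rewrite mem_undup; exact: sE.
rewrite -big_undup_iterop_count; apply: eq_bigr => e _.
by rewrite -scalerA scaler_nat.
Qed.

Lemma semi_basis_extend (N : lmodType A) (j : int) (G : F -> N) :
  exists h : F -> N, semilin j h /\ forall e, E e -> h e = G e.
Proof.
have [_ _ free _] := sbE.
have ex x : exists p : seq F * (F -> A), [/\ uniq p.1, forall e, e \in p.1 -> E e &
   x = \sum_(e <- p.1) p.2 e *: e].
  by have [s [c sc]] := semi_basis_repr x; exists (s, c).
pose sup x := (projT1 (cid (ex x))).1; pose co x := (projT1 (cid (ex x))).2.
have supP x : [/\ uniq (sup x), forall e, e \in sup x -> E e &
   x = \sum_(e <- sup x) co x e *: e] by rewrite /sup /co; case: cid.
pose h x := \sum_(e <- sup x) twist (dga_gr A) j (co x e) *: G e.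
have tw0 : twist (dga_gr A) j 0 = 0 by exact: morphD0 (twistD _ _).
have widen (V : lmodType A) (s r : seq F) (c : F -> A) (H : F -> V) :
    uniq s -> uniq r -> {subset s <= r} ->
    \sum_(e <- s) c e *: H e = \sum_(e <- r) (if e \in s then c e else 0) *: H e.
  move=> us ur sr.
  rewrite [RHS](eq_bigr (fun e => if e \in s then c e *: H e else 0)); last first.
    by move=> e _; case: ifP => _; rewrite ?scale0r.
  rewrite -big_mkcond.
  rewrite -[RHS]big_filter; apply: perm_big; apply: uniq_perm => //.
    by rewrite filter_uniq.
  by move=> e; rewrite mem_filter; case: (boolP (e \in s)) => //= /sr ->.
(* The value of [h] does not depend on the chosen expansion: two expansions, extended by zero to a
   common list, have equal coefficients by freeness. *)
have hE x s c : uniq s -> (forall e, e \in s -> E e) -> x = \sum_(e <- s) c e *: e ->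
    h x = \sum_(e <- s) twist (dga_gr A) j (c e) *: G e.
  move=> us sE xE; have [ut tE xE'] := supP x.
  pose r := undup (sup x ++ s); have ur : uniq r := undup_uniq _.
  have tr : {subset sup x <= r} by move=> e et; rewrite mem_undup mem_cat et.
  have sr : {subset s <= r} by move=> e es; rewrite mem_undup mem_cat es orbT.
  have rE e : e \in r -> E e by rewrite mem_undup mem_cat => /orP[/tE|/sE].
  rewrite /h (widen _ _ r)// [RHS](widen _ _ r)//.
  apply: eq_big_seq => e er; congr (_ *: _).
  suff : (if e \in sup x then co x e else 0) - (if e \in s then c e else 0) = 0.
    by move/eqP; rewrite subr_eq0; do 2!case: ifP => _; move=> /eqP ce;
      rewrite ?ce // -?ce ?tw0.
  pose c' e := (if e \in sup x then co x e else 0) - (if e \in s then c e else 0).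
  apply: (free r c') => //; rewrite (eq_bigr _ (fun e _ => scalerBl _ _ _)).
  by rewrite sumrB -!widen// -xE -xE' subrr.
exists h; split; last first.
  move=> e Ee; rewrite (hE e [:: e] (fun=> 1)) ?big_seq1 ?twist1 ?scale1r//.
  by move=> e'; rewrite inE => /eqP ->.
split=> [x y|a x].
  have [us sE xE] := supP x; have [ut tE yE] := supP y.
  pose r := undup (sup x ++ sup y); have ur : uniq r := undup_uniq _.
  have sr : {subset sup x <= r} by move=> e es; rewrite mem_undup mem_cat es.
  have tr : {subset sup y <= r} by move=> e et; rewrite mem_undup mem_cat et orbT.
  have rE e : e \in r -> E e by rewrite mem_undup mem_cat => /orP[/sE|/tE].
  move: xE; rewrite (widen _ _ r)// => xE; move: yE; rewrite (widen _ _ r)// => yE.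
  rewrite (hE _ _ _ ur rE xE) (hE _ _ _ ur rE yE) -big_split /=.
  rewrite (hE (x + y) r (fun e => (if e \in sup x then co x e else 0) +
    (if e \in sup y then co y e else 0)))//.
    by apply: eq_bigr => e _; rewrite twistD scalerDl.
  by rewrite {1}xE {1}yE -big_split; apply: eq_bigr => e _; rewrite scalerDl.
have [us sE xE] := supP x.
rewrite (hE (a *: x) (sup x) (fun e => a * co x e))//.
  rewrite /h scaler_sumr; apply: eq_bigr => e _.
  by rewrite twistM scalerA.
by rewrite {1}xE scaler_sumr; apply: eq_bigr => e _; rewrite scalerA.
Qed.

End SemiBasis.

Lemma mk_dgHom (k : fieldType) (A : dgAlgebra k) (M N : dgModule A) (h : M -> N) :
  {morph h : x y / x + y} -> (forall a x, h (a *: x) = a *: h x) ->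
  (forall i x, homogeneous (dgm_gr M) i x -> homogeneous (dgm_gr N) i (h x)) ->
  (forall x, h (dgm_d x) = dgm_d (h x)) ->
  exists f : dgHom M N, f =1 h.
Proof.
move=> hD hZ hg hd.
have hl : linear h by move=> a x y; rewrite hD hZ.
pose hm := GRing.isLinear.Build A M N _ h hl.
pose H : {linear M -> N} := HB.pack h hm.
have gr i x : H (dgm_gr M i x) = dgm_gr N i (H x).
  change (h (dgm_gr M i x) = dgm_gr N i (h x)).
  move: x; apply: (grext (G := dgm_gr M)) => [x y|x y|j x hx].
  - by rewrite compD hD.
  - by rewrite hD compD.
  rewrite (Defs.compE _ hx) (Defs.compE _ (hg _ _ hx)).
  by case: eqP => // _; rewrite (morphD0 hD).
by exists (@DGHom k A M N H gr hd).
Qed.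

Lemma comp_scale (k : fieldType) (A : dgAlgebra k) (M : dgModule A) i j (a : A) (x : M) :
  homogeneous (dga_gr A) i a -> dgm_gr M j (a *: x) = a *: dgm_gr M (j - i) x.
Proof.
move=> ha; move: x; apply: (grext (G := dgm_gr M)) => [x y|x y|l x hx].
- by rewrite scalerDr compD.
- by rewrite compD scalerDr.
rewrite (Defs.compE _ (dgm_act ha hx)) (Defs.compE _ hx) subr_eq [l + i]addrC.
by case: eqP; rewrite ?scaler0.
Qed.

Section Lifting.
Variables (k : fieldType) (A : dgAlgebra k) (F X Y : dgModule A).
Variables (g : dgHom X Y) (al : dgHom F Y).

(* At x, the pair (b, t) is a morphism with a homotopy from al to g b. *)
Definition lift_at (b : F -> X) (t : F -> Y) (x : F) : Prop :=
  [/\ forall i, b (dgm_gr F i x) = dgm_gr X i (b x),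
      forall i, t (dgm_gr F i x) = dgm_gr Y (i - 1) (t x),
      dgm_d (b x) = b (dgm_d x) &
      al x - g (b x) = dgm_d (t x) + t (dgm_d x)].

Section Span.
Variables (b : F -> X) (t : F -> Y).
Hypotheses (sb : semilin 0 b) (st : semilin 1 t).

Lemma lift_at0 : lift_at b t 0.
Proof.
have [[bD _] [tD _]] := (sb, st).
split=> [i|i||]; rewrite ?(dgm_d0, comp0, morphD0 bD, morphD0 tD)//.
by rewrite !linear0.
Qed.

Lemma lift_atD x y : lift_at b t x -> lift_at b t y -> lift_at b t (x + y).
Proof.
have [[bD _] [tD _]] := (sb, st).
move=> [x1 x2 x3 x4] [y1 y2 y3 y4]; split=> [i|i||].
- by rewrite compD !bD compD x1 y1.
- by rewrite compD !tD compD x2 y2.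
- by rewrite bD !dgm_dD bD x3 y3.
- by rewrite bD tD !dgm_dD tD !linearD /= [LHS]addrACA [RHS]addrACA x4 y4.
Qed.

Lemma lift_atZ a x : lift_at b t x -> lift_at b t (a *: x).
Proof.
have [[bD bZ] [tD tZ]] := (sb, st).
move=> [x1 x2 x3 x4]; move: a; apply: (grind (G := dga_gr A)) => [|a a' Ha Ha'|i a ha].
- by rewrite scale0r; exact: lift_at0.
- by rewrite scalerDl; exact: lift_atD.
have {}bZ := bZ; have E0 c z : b (c *: z) = c *: b z by rewrite bZ twist0.
have E1 z : t (a *: z) = ksign i (a *: t z).
  by rewrite tZ (twist_homog _ ha) mulr1 ksignZl.
have E2 z : t (dga_d a *: z) = ksign (i + 1) (dga_d a *: t z).
  by rewrite tZ (twist_homog _ (dga_ddeg ha)) mulr1 ksignZl.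
split=> [j|j||].
- by rewrite !(comp_scale _ _ ha) !E0 (comp_scale _ _ ha) x1.
- rewrite !(comp_scale _ _ ha) !E1 (ksign_morph _ _ (compD _ _)) (comp_scale _ _ ha) x2.
  by rewrite addrAC.
- by rewrite E0 !(dgm_leibniz _ ha) bD (ksign_morph _ _ bD) !E0 x3.
have gZ z : g (a *: z) = a *: g z by exact: linearZ.
have alZ z : al (a *: z) = a *: al z by exact: linearZ.
rewrite E0 E1 gZ alZ -scalerBr x4 (dgm_leibniz _ ha) tD (ksign_morph _ _ tD).
rewrite E1 E2 dgm_d_ksign (dgm_leibniz _ ha) ksignD !ksign_comp scalerDr.
rewrite /ksign !oddzE /=; case: (odd (absz i)) => /=.
  by rewrite addrACA addNr add0r.
by rewrite addrACA subrr add0r.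
Qed.

Lemma lift_at_sum s (c : F -> A) :
  (forall e, e \in s -> lift_at b t e) -> lift_at b t (\sum_(e <- s) c e *: e).
Proof.
move=> se; rewrite big_seq; elim/big_ind: _ => [|x y|e /se].
- exact: lift_at0.
- exact: lift_atD.
- exact: lift_atZ.
Qed.

End Span.

(* Basis elements are lifted in the order of their levels. *)
Lemma semi_free_lift : quasi_iso g -> semi_free F ->
  exists be : dgHom F X, homotopic al (dgcomp g be).
Proof.
move=> [gs gi] [E sbE]; have [hE gen _ [lvl lvlE]] := sbE.
pose ext (N : lmodType A) (j : int) (G : F -> N) := projT1 (cid (semi_basis_extend sbE j G)).
have extP (N : lmodType A) (j : int) (G : F -> N) :
    semilin j (ext N j G) /\ forall e, E e -> ext N j G e = G e.
  by rewrite /ext; case: cid.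
pose B (G : F -> X * Y) := ext X 0 (fst \o G); pose T (G : F -> X * Y) := ext Y 1 (snd \o G).
have Bl G : semilin 0 (B G) := (extP X 0 (fst \o G)).1.
have Tl G : semilin 1 (T G) := (extP Y 1 (snd \o G)).1.
(* Since [d e] is a combination of basis elements of lower level, the values at those levels
   determine the extension at [d e]. *)
have ext_eq (N : lmodType A) j (G G' : F -> N) e :
    (forall e', E e' -> (lvl e' < lvl e)%N -> G e' = G' e') -> E e ->
    ext N j G (dgm_d e) = ext N j G' (dgm_d e).
  move=> GG' Ee; have [s [c [sE ->]]] := lvlE e Ee.
  have [[GD GZ] GE] := extP N j G; have [[GD' GZ'] GE'] := extP N j G'.
  rewrite (morphDsum GD) (morphDsum GD') !big_seq; apply: eq_bigr => e' /sE[Ee' lte].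
  by rewrite GZ GZ' GE// GE'// GG'.
pose Q G e (p : X * Y) := [/\ exists i, [/\ homogeneous (dgm_gr F) i e,
      homogeneous (dgm_gr X) i p.1 & homogeneous (dgm_gr Y) (i - 1) p.2],
      dgm_d p.1 = B G (dgm_d e) &
      al e - g p.1 = dgm_d p.2 + T G (dgm_d e)].
have Q_eq G G' e p : E e -> (forall e', E e' -> (lvl e' < lvl e)%N -> G e' = G' e') ->
    Q G e p -> Q G' e p.
  move=> Ee GG' [h1 h2 h3]; split=> //.
    by rewrite h2; apply: ext_eq => // e' Ee' /(GG' _ Ee') /= ->.
  by rewrite h3; congr (_ + _); apply: ext_eq => // e' Ee' /(GG' _ Ee') /= ->.
have Q_lift G e : E e -> Q G e (G e) -> lift_at (B G) (T G) e.
  move=> Ee [[i [hi h1 h2]] h3 h4].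
  have [[bD _] bE] := extP X 0 (fst \o G); have [[tD _] tE] := extP Y 1 (snd \o G).
  have := bE e Ee; have := tE e Ee; rewrite -/(B G) -/(T G) /= => tEe bEe.
  rewrite /lift_at tEe bEe; split=> // j; rewrite (Defs.compE _ hi).
    by rewrite (Defs.compE _ h1); case: (j == i); [exact: bEe|exact: morphD0 bD].
  rewrite (Defs.compE _ h2) (inj_eq (addIr _)).
  by case: (j == i); [exact: tEe|exact: morphD0 tD].
have Q_ex G e : E e -> (forall e', E e' -> (lvl e' < lvl e)%N -> Q G e' (G e')) ->
    exists p, Q G e p.
  move=> Ee QG; have [i hi] := hE _ Ee.
  have : lift_at (B G) (T G) (dgm_d e).
    have [s [c [sE ->]]] := lvlE e Ee.
    by apply: lift_at_sum => // e' /sE[Ee' /(QG _ Ee')]; exact: Q_lift.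
  have hde := dgm_ddeg hi.
  move=> [/(_ (i + 1)) + /(_ (i + 1))]; rewrite hde addrK => hx hy.
  rewrite dgm_dd (morphD0 (Bl G).1) (morphD0 (Tl G).1) addr0 => dx ag.
  (* The image of the cocycle [z] bounds, [g z = d (al e - w)], hence [z = d v]. The defect
     [al e - w - g v] is then a cocycle of [Y], of the form [g m0 + d u0], and [m0] corrects [v].
     Taking components keeps everything homogeneous. *)
  rewrite /Q; set z := B G (dgm_d e) in hx dx ag *; set w := T G (dgm_d e) in hy ag *.
  have [|v0 zv0] := gi z dx.
    by exists (al e - w); rewrite dgm_dB -ag -dgh_d opprB addrC subrK.
  have [v hv zv] := dgm_d_homog (esym hx) zv0; rewrite addrK in hv.
  have dq : dgm_d (al e - w - g v) = 0.
    by rewrite !dgm_dB -ag -!dgh_d -zv opprB addrCA subrr addr0 subrr.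
  have [m0 [dm0 [u0 uE0]]] := gs _ dq.
  have hq : homogeneous (dgm_gr Y) i (al e - w - g v).
    apply: homogD; last by apply: homogN; exact: dgh_homog.
    by apply: homogD; [exact: dgh_homog|apply: homogN].
  exists (v + dgm_gr X i m0, dgm_gr Y (i - 1) u0); split=> /=.
  - exists i; split=> //; last exact: homog_comp.
    by apply: homogD => //; exact: homog_comp.
  - by rewrite dgm_dD -zv -comp_d dm0 comp0 addr0.
  rewrite linearD /= dgh_gr -comp_d subrK.
  have := hq; rewrite /homogeneous {1}uE0 compD => eq.
  have -> : al e = al e - w - g v + (g v + w) by rewrite addrA !subrK.
  rewrite -eq; apply/eqP; rewrite subr_eq -!addrA [X in X == _]addrCA; apply/eqP.
  by congr (_ + _); rewrite addrCA [RHS]addrCA; congr (_ + _); rewrite addrC.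
pose pick G e := if pselect (exists p, Q G e p) is left h then projT1 (cid h) else (0, 0).
(* [G n] is final at the levels below [n] and keeps the default [(0, 0)] at the others. *)
pose G := fix G n : F -> X * Y := if n is n'.+1 then
   fun e => if lvl e == n' then pick (G n') e else G n' e else fun=> (0, 0).
have G_stable n e : (lvl e < n)%N -> G n e = G (lvl e).+1 e.
  elim: n => // n IH; rewrite ltnS leq_eqVlt => /orP[/eqP <-//|len].
  by rewrite /= ltn_eqF// IH //= eqxx.
have GQ n e : E e -> (lvl e < n)%N -> Q (G n) e (G n e).
  elim: n e => // n IH e Ee; rewrite ltnS => en.
  have GG e' : E e' -> (lvl e' < lvl e)%N -> G n e' = G n.+1 e'.
    by move=> _ lt; rewrite (G_stable n.+1) ?(leq_trans lt) 1?ltnW// G_stable// (leq_trans lt).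
  apply: (Q_eq (G n)) => //; move: en; rewrite leq_eqVlt => /orP[/eqP en|en].
    rewrite /= en eqxx /pick; case: pselect => [h|[]]; first by case: cid.
    by apply: Q_ex => // e' Ee'; rewrite en => /IH; exact.
  by rewrite /= ltn_eqF//; exact: IH.
pose G' e := G (lvl e).+1 e.
have QG e : E e -> Q G' e (G' e).
  move=> Ee; apply: (Q_eq (G (lvl e).+1)) => //; last exact: GQ.
  by move=> e' _ lt; rewrite G_stable// ltnW.
have lift x : lift_at (B G') (T G') x.
  have [s [c [sE ->]]] := gen x; apply: lift_at_sum => // e /sE Ee.
  by apply: Q_lift => //; exact: QG.
have [||||be beE] := @mk_dgHom _ _ F X (B G').
- exact: (Bl G').1.
- by move=> a x; rewrite (Bl G').2 twist0.
- by move=> i x hx; have [/(_ i)] := lift x; rewrite /homogeneous hx.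
- by move=> x; have [_ _ ->] := lift x.
exists be, (T G'); split.
- exact: (Tl G').1.
- by move=> i x hx; have [_ /(_ i)] := lift x; rewrite /homogeneous hx.
- by move=> i a x ha; rewrite (Tl G').2 (twist_homog _ ha) mulr1 ksignZl.
- by move=> x; rewrite /= beE; have [_ _ _ ->] := lift x.
Qed.
End Lifting.

(** * Direct sums and the derived category *)

Section DirectSum.
Variables (k : fieldType) (A : dgAlgebra k) (I : choiceType).
Variables (N : I -> dgModule A) (S : dgModule A) (inj : forall i, dgHom (N i) S).
Hypothesis dsum : is_dsum inj.

Let rep (x : S) (z : forall i, N i) := exists s : seq I,
  [/\ uniq s, forall i, i \notin s -> z i = 0 & x = \sum_(i <- s) inj i (z i)].

Let rep_widen s r (z : forall i, N i) : uniq s -> uniq r -> {subset s <= r} ->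
  (forall i, i \notin s -> z i = 0) ->
  \sum_(i <- s) inj i (z i) = \sum_(i <- r) inj i (z i).
Proof.
move=> us ur sr z0; rewrite [RHS](bigID (mem s)) /= [X in _ + X]big1 ?addr0.
  rewrite -[RHS]big_filter; apply: perm_big; apply: uniq_perm => //.
    by rewrite filter_uniq.
  by move=> i; rewrite mem_filter; case: (boolP (i \in s)) => //= /sr ->.
by move=> i /z0 ->; rewrite linear0.
Qed.

Let rep_common x y z t : rep x z -> rep y t -> exists s : seq I,
  [/\ uniq s, forall i, i \notin s -> z i = 0, forall i, i \notin s -> t i = 0,
      x = \sum_(i <- s) inj i (z i) & y = \sum_(i <- s) inj i (t i)].
Proof.
move=> [s [us zs ->]] [r [ur tr ->]]; exists (undup (s ++ r)).
have uu := undup_uniq (s ++ r).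
split=> // [i|i||].
- by rewrite mem_undup mem_cat negb_or => /andP[/zs].
- by rewrite mem_undup mem_cat negb_or => /andP[_ /tr].
- by apply: rep_widen => // i; rewrite mem_undup mem_cat => ->.
- by apply: rep_widen => // i; rewrite mem_undup mem_cat orbC => ->.
Qed.

Let rep_uniq x z t : rep x z -> rep x t -> forall i, z i = t i.
Proof.
move=> xz xt i; have [s [us zs ts xE xE']] := rep_common xz xt.
have [si|nsi] := boolP (i \in s); last by rewrite zs ?ts.
apply/eqP; rewrite -subr_eq0; apply/eqP.
apply: (dsum.2 s (fun i => z i - t i)) => //.
by rewrite (eq_bigr _ (fun i _ => linearB _ _ _)) sumrB -xE -xE' subrr.
Qed.

Let rep_ex x : exists z, rep x z.
Proof.
have [s [y [us ->]]] := dsum.1 x.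
exists (fun i => if i \in s then y i else 0); exists s; split=> // [i|].
  by move=> /negbTE ->.
by apply: eq_big_seq => i ->.
Qed.

Let pr_fun i x : N i := projT1 (cid (rep_ex x)) i.

Let pr_rep x : rep x (pr_fun^~ x).
Proof. by rewrite /pr_fun; case: cid. Qed.

Let pr_uniq x z i : rep x z -> pr_fun i x = z i.
Proof. by move=> xz; apply: (rep_uniq (pr_rep x)). Qed.

(** Coordinates in a direct sum are unique, so they can be computed from any expansion;
    compatibility with sums, scalars, degrees and differentials follows termwise. *)
Lemma dsum_proj : exists pr : forall i, dgHom S (N i),
  [/\ forall i y, pr i (inj i y) = y,
      forall i j y, i != j -> pr i (inj j y) = 0 &
      forall x, exists s : seq I, uniq s /\ x = \sum_(i <- s) inj i (pr i x)].
Proof.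
have pD i : {morph pr_fun i : x y / x + y}.
  move=> x y; apply: (@pr_uniq _ (fun i => pr_fun i x + pr_fun i y)).
  have [s [us xs ys xE yE]] := rep_common (pr_rep x) (pr_rep y).
  exists s; split=> // [j js|]; first by rewrite xs ?ys ?addr0.
  by rewrite {1}xE {1}yE -big_split; apply: eq_bigr => j _; rewrite linearD.
have pZ i a x : pr_fun i (a *: x) = a *: pr_fun i x.
  apply: (@pr_uniq _ (fun i => a *: pr_fun i x)).
  have [s [us xs xE]] := pr_rep x; exists s; split=> // [j js|].
    by rewrite xs ?scaler0.
  by rewrite {1}xE scaler_sumr; apply: eq_bigr => j _; rewrite linearZ.
have pg i j x : pr_fun i (dgm_gr S j x) = dgm_gr (N i) j (pr_fun i x).
  apply: (@pr_uniq _ (fun i => dgm_gr (N i) j (pr_fun i x))).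
  have [s [us xs xE]] := pr_rep x; exists s; split=> // [l ls|].
    by rewrite xs ?comp0.
  by rewrite {1}xE (morphDsum (compD _ _)); apply: eq_bigr => l _; rewrite dgh_gr.
have pd i x : pr_fun i (dgm_d x) = dgm_d (pr_fun i x).
  apply: (@pr_uniq _ (fun i => dgm_d (pr_fun i x))).
  have [s [us xs xE]] := pr_rep x; exists s; split=> // [l ls|].
    by rewrite xs ?dgm_d0.
  by rewrite {1}xE (morphDsum (@dgm_dD _ _ _)); apply: eq_bigr => l _; rewrite dgh_d.
have ex i : exists f : dgHom S (N i), f =1 pr_fun i.
  by apply: mk_dgHom => // j x hx; rewrite /homogeneous -pg hx.
(* The module [N i] depends on [i], whence a transport along [j = i]; it disappears by [eq_axiomK],
   equality on [I] being decidable. *)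
have pinj i j (y : N j) : pr_fun i (inj j y) =
    if pselect (j = i) is left e then ecast i (N i) e y else 0.
  apply: (@pr_uniq _ (fun i => if pselect (j = i) is left e then ecast i (N i) e y else 0)).
  exists [:: j]; split=> // [l|]; last first.
    by rewrite big_seq1; case: pselect => // e; rewrite (eq_axiomK e).
  by rewrite inE => lj; case: pselect => // e; rewrite e eqxx in lj.
exists (fun i => projT1 (cid (ex i))); split=> [i y|i j y ij|x].
- case: cid => f /= ->; rewrite pinj; case: pselect => // e.
  by rewrite (eq_axiomK e).
- case: cid => f /= ->; rewrite pinj; case: pselect => // e.
  by rewrite e eqxx in ij.
have [s [us xs xE]] := pr_rep x; exists s; split=> //.
rewrite {1}xE; apply: eq_bigr => i _.
by case: cid => f /= ->.
Qed.

End DirectSum.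

Section Derived.
Variables (k : fieldType) (A : dgAlgebra k).
Implicit Types M N F : dgModule A.

Lemma req_refl M N (r : roof M N) : req r r.
Proof.
exists (apex r), (dgid _), (dgid _); split; [exact: dgid_qis|exact: homotopic_refl..].
Qed.

(** Roofs out of [M] become, up to homotopy, morphisms out of [F]; such a morphism is determined by
    the images of finitely many generators, which involve finitely many summands. *)
Lemma dcompact_finite_semi_free M F (f : dgHom F M) (b : seq F) :
  semi_free_resolution f ->
  (forall x : F, exists c : F -> A, x = \sum_(e <- b) c e *: e) ->
  dcompact M.
Proof.
move=> [sfF Q] gen I N S inj dsum; have [pr [prK pr0 prS]] := dsum_proj dsum.
split=> [r|s p us].
  have [j hj] := semi_free_lift f (den_qis r) sfF.
  pose h := dgcomp (num r) j; pose g i := dgcomp (pr i) h.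
  have ex e : exists s : seq I, uniq s /\ h e = \sum_(i <- s) inj i (g i e) by exact: prS.
  pose sup e := projT1 (cid (ex e)).
  pose s := undup (flatten (map sup b)).
  have us : uniq s := undup_uniq _.
  have hE : forall y, h y = \sum_(i <- s) inj i (g i y).
    suff hb e : e \in b -> h e = \sum_(i <- s) inj i (g i e).
      move=> y; have [c ->] := gen y.
      have hsum : h (\sum_(e <- b) c e *: e) = \sum_(e <- b) c e *: h e.
        by rewrite linear_sum; apply: eq_bigr => e _; rewrite linearZ.
      rewrite hsum (eq_big_seq _ (fun e eb => congr1 _ (hb e eb))).
      rewrite (eq_bigr _ (fun e _ => scaler_sumr _ _ _ _)) exchange_big /=.
      apply: eq_bigr => i _; rewrite !linear_sum; apply: eq_bigr => e _.
      by rewrite !linearZ.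
    move=> eb; have : uniq (sup e) /\ h e = \sum_(i <- sup e) inj i (g i e).
      by rewrite /sup; case: cid.
    move=> [ue he].
    have sub : {subset sup e <= s}.
      by move=> i ie; rewrite mem_undup; apply/flatten_mapP; exists e.
    rewrite [LHS]he [RHS](bigID (mem (sup e))) /= [X in _ + X]big1_seq ?addr0.
      rewrite -[RHS]big_filter; apply: perm_big; apply: uniq_perm => //.
        by rewrite filter_uniq.
      by move=> i; rewrite mem_filter; case: (boolP (i \in sup e)) => //= /sub ->.
    move=> i /andP[ie _]; rewrite -[RHS](linear0 (inj i)); congr (inj i _).
    rewrite [LHS](_ : _ = pr i (h e))// he linear_sum big1_seq// => l /= le.
    by rewrite pr0//; apply: contraNneq ie => ->.
  exists s, (fun i => Roof (g i) Q); split=> //.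
  exists F, f, Q, g, h; split=> //; first by move=> i _; exact: req_refl.
  exists F, j, (dgid _); split=> /=; last 2 first.
  - exact: homotopic_trans (homotopic_sym hj) (homotopic_eq _).
  - exact: homotopic_eq.
  - exact: quasi_iso_cancel (den_qis r) (quasi_iso_homotopic hj Q).
move=> [Y [q [qQ [g [h [pg hE [Y' [u [v [/= uQ uv hv]]]]]]]]]] i si.
(* All denominators are resolved on [F]: [c'] lifts [f] to [Y'], where [h] becomes homotopic to
   zero, and [c] lifts further to [Y2], where the numerator of [p i] agrees with [g i], that is with
   [h] followed by [pr i]. *)
have [Y2 [a [b' [aQ /= ab nab]]]] := pg i si.
have [c' fc'] := semi_free_lift f uQ sfF.
have b'Q : quasi_iso b'.
  apply: (quasi_iso_cancel qQ); apply: (quasi_iso_homotopic ab).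
  exact: quasi_iso_comp (den_qis _).
have [c vc] := semi_free_lift (dgcomp v c') b'Q sfF.
have comm : homotopic (dgcomp (den (p i)) (dgcomp a c)) (dgcomp u c').
  apply: (@homotopic_trans _ _ _ _ _ (dgcomp q (dgcomp b' c))).
    exact: (homotopic_compr c ab).
  apply: (@homotopic_trans _ _ _ _ _ (dgcomp q (dgcomp v c'))).
    exact: homotopic_compl (homotopic_sym vc).
  exact: (homotopic_compr c' (homotopic_sym uv)).
have gE y : g i y = pr i (h y).
  rewrite hE linear_sum (bigD1_seq i)//= prK big1 ?addr0// => l li.
  by rewrite pr0// eq_sym.
exists F, (dgcomp a c), (dgcomp u c'); split.
- apply: (quasi_iso_cancel (den_qis (p i))).
  apply: quasi_iso_homotopic (homotopic_sym comm) _.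
  exact: quasi_iso_homotopic fc' Q.
- exact: comm.
apply: (@homotopic_trans _ _ _ _ _ (dgcomp (g i) (dgcomp b' c))).
  exact: (homotopic_compr c nab).
apply: (@homotopic_trans _ _ _ _ _ (dgcomp (g i) (dgcomp v c'))).
  exact: homotopic_compl (homotopic_sym vc).
apply: (@homotopic_trans _ _ _ _ _ (dgcomp (dgcomp (pr i) (dgcomp h v)) c')).
  by apply: homotopic_eq => x /=; rewrite gE.
apply: homotopic_trans (homotopic_compr c' (homotopic_compl (pr i) (homotopic_sym hv))) _.
by apply: homotopic_eq => x /=; rewrite linear0.
Qed.

Lemma quasi_iso_diso M N (g : dgHom M N) : quasi_iso g -> diso M N.
Proof.
move=> gQ; exists (roof_of g), (Roof (dgid M) gQ); split.
  exists M, (dgid M), (dgid M), (dgid_qis M); split.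
  - exact: dgid_qis.
  - exact: homotopic_eq.
  - by exists M, (dgid M), (dgid M); split; [exact: dgid_qis|exact: homotopic_eq..].
exists M, (dgid M), (dgid M), (quasi_iso_comp (dgid_qis M) gQ); split.
- exact: dgid_qis.
- exact: homotopic_eq.
- by exists M, g, (dgid M); split; [|exact: homotopic_eq..].
Qed.

Lemma scale_boundary M j (a : A) (w : M) : homogeneous (dga_gr A) j a ->
  dga_d a = 0 -> exists v : M, a *: dgm_d w = dgm_d v.
Proof.
move=> ha da; exists (ksign j (a *: w)).
by rewrite dgm_d_ksign (dgm_leibniz _ ha) da scale0r add0r ksign_comp /ksign oddzE addbb.
Qed.

Lemma scale_cocycle M j (a : A) (x : M) : homogeneous (dga_gr A) j a ->
  dga_d a = 0 -> dgm_d x = 0 -> dgm_d (a *: x) = 0.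
Proof.
by move=> ha da dx; rewrite (dgm_leibniz _ ha) da dx scale0r scaler0 ksign0 addr0.
Qed.

Lemma homotopic_boundary M N (f g : dgHom M N) x : homotopic f g -> dgm_d x = 0 ->
  (exists w, f x = dgm_d w) -> exists w, g x = dgm_d w.
Proof.
move=> fg dx [w fw]; have [v gv] := homotopic_cocycle (homotopic_sym fg) dx.
by exists (w + v); rewrite gv fw dgm_dD.
Qed.

(* An isomorphism in D(A) transports classes without changing which cocycles of
   A annihilate them. *)
Lemma diso_cocycle M N i (n : N) : diso M N -> dgm_d n = 0 ->
  homogeneous (dgm_gr N) i n -> exists t : M, [/\ dgm_d t = 0,
    homogeneous (dgm_gr M) i t & forall j a, homogeneous (dga_gr A) j a ->
      dga_d a = 0 -> (exists w, a *: n = dgm_d w) <-> (exists w, a *: t = dgm_d w)].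
Proof.
move=> [p [q [_ [Y [u [v [t [_ qp [Y' [u' [v' [[us ui] /= e1 e2]]]]]]]]]]]] dn hn.
(* [Y'] dominates both the identity roof of [N] and the composite [N -> M -> N]. The class of [n]
   comes from a homogeneous cocycle [y] of [Y'], and [t] is the image of [y] in [M]. *)
have [y0 [dy0 [w0 nE]]] := us n dn.
pose y := dgm_gr Y' i y0.
have dy : dgm_d y = 0 by rewrite /y -comp_d dy0 comp0.
have hy : homogeneous (dgm_gr Y') i y by exact: homog_comp.
have {w0} [w {}nE] : exists w, n = u' y + dgm_d w.
  exists (dgm_gr N (i - 1) w0); rewrite -comp_d subrK /y dgh_gr -compD -nE.
  by rewrite hn.
exists (num q (u (v' y))); split.
- by rewrite -!dgh_d dy !linear0.
- by do 3!apply: dgh_homog.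
move=> j a ha da; have day := scale_cocycle ha da dy.
have [w' awE] := scale_boundary w ha da.
have anE : a *: n = u' (a *: y) + dgm_d w' by rewrite nE scalerDr awE linearZ.
split=> [[w1 w1E]|[w1 w1E]].
  have [|x xE] := ui _ day.
    by exists (w1 - w'); rewrite dgm_dB -w1E anE addrK.
  by exists (num q (u (v' x))); rewrite -!linearZ /= xE !dgh_d.
(* For the converse, [qp] turns a boundary in [M] into one under [den p], which reflects boundaries;
   [num p] then brings it to [N], where [e2] compares it with [u']. *)
have dvay : dgm_d (v' (a *: y)) = 0 by rewrite -dgh_d day linear0.
have [|w2 w2E] := homotopic_boundary qp dvay.
  by exists w1; rewrite -w1E /= !linearZ.
have [|w3 w3E] := (den_qis p).2 (v (v' (a *: y))) _ (ex_intro _ w2 w2E).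
  by rewrite -dgh_d dvay linear0.
have [|w4 w4E] := homotopic_boundary (homotopic_sym e2) day.
  by exists (num p w3); rewrite /= w3E dgh_d.
by exists (w4 + w'); rewrite anE w4E dgm_dD.
Qed.

End Derived.

Lemma comp_sum_sub (M : zmodType) (G : grading M) (r : seq int) (x : M) :
  uniq r -> (forall i, i \notin r -> G i x = 0) -> x = \sum_(i <- r) G i x.
Proof.
move=> ur rP; have idD (i : int) : {morph (fun z : M => z) : z t / z + t} by [].
rewrite -(gsumE (G := G) idD ur rP); move: x {rP}.
apply: (grext (G := G)) => [//|x y|i x hx]; first by rewrite (gsumD G idD).
by rewrite (gsum_homog idD hx).
Qed.

Section SignedLeibniz.
Variables (k : fieldType) (B : dgAlgebra k).
Local Notation gr := (dga_gr B).

Lemma twist_d j (x : B) : dga_d (twist gr j x) = ksign j (twist gr j (dga_d x)).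
Proof.
move: x; apply: (grext (G := gr)) => [x y|x y|i x hx].
- by rewrite twistD dga_dD.
- by rewrite dga_dD twistD ksignD.
rewrite (twist_homog _ hx) (twist_homog _ (dga_ddeg hx)) dga_d_ksign ksign_comp.
by apply: eq_ksign; rewrite !oddzE; do 2!case: odd.
Qed.

Lemma dga_leibniz_twist (x y : B) :
  dga_d (x * y) = dga_d x * y + twist gr 1 x * dga_d y.
Proof.
move: x; apply: (grext (G := gr)) => [x z|x z|i x hx].
- by rewrite mulrDl dga_dD.
- by rewrite dga_dD twistD !mulrDl addrACA.
by rewrite (dga_leibniz _ hx) (twist_homog _ hx) mulr1 ksignMl.
Qed.

Lemma dgm_leibniz_twist (M : dgModule B) (a : B) (x : M) :
  dgm_d (a *: x) = dga_d a *: x + twist gr 1 a *: dgm_d x.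
Proof.
move: a; apply: (grext (G := gr)) => [a b|a b|i a ha].
- by rewrite scalerDl dgm_dD.
- by rewrite dga_dD twistD !scalerDl addrACA.
by rewrite (dgm_leibniz _ ha) (twist_homog _ ha) mulr1 ksignZl.
Qed.

End SignedLeibniz.

(** * Finite free modules with basis in degree 0, and their duals *)

Section FreeModule.
Variables (k : fieldType) (B : dgAlgebra k) (T : finType) (D : T -> T -> B).
Hypotheses (D_homog : forall s t, homogeneous (dga_gr B) 1 (D s t))
  (D_cocycle : forall s t, dga_d (D s t) = 0)
  (D_sqr : forall s t, \sum_r D s r * D r t = 0).
Local Notation gr := (dga_gr B).
Local Notation FM := {ffun T -> B^o}.
Implicit Types v : FM.

Definition free_comp (i : int) v : FM := [ffun t => gr i (v t)].

Lemma free_compD i : {morph free_comp i : u v / u + v}.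
Proof. by move=> u v; apply/ffunP => t; rewrite !ffunE compD. Qed.

Lemma free_comp_comp i j v :
  free_comp i (free_comp j v) = if i == j then free_comp j v else 0.
Proof.
apply/ffunP => t; rewrite !ffunE comp_comp; case: (i == j); rewrite ffunE; exact: erefl.
Qed.

Lemma free_comp_sum v : exists2 s : seq int, uniq s & v = \sum_(i <- s) free_comp i v.
Proof.
have ex t : exists s : seq int, uniq s /\ forall i, i \notin s -> gr i (v t) = 0.
  by have [s us sP] := comp_support gr (v t : B); exists s.
pose sup t := projT1 (cid (ex t)).
have supP t i : i \notin sup t -> gr i (v t) = 0
  by rewrite /sup; case: cid => s [_ sP] /=; exact: sP.
exists (undup (flatten (map sup (enum T)))); first exact: undup_uniq.
apply/ffunP => t.
rewrite sum_ffunE.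
under eq_bigr do rewrite ffunE.
apply: comp_sum_sub (undup_uniq _) _ => i.
rewrite mem_undup => it; apply: supP; apply: contra it => it.
by apply/flatten_mapP; exists t; rewrite ?mem_enum.
Qed.

Definition free_gr : grading FM := Grading free_compD free_comp_comp free_comp_sum.

Lemma free_homogP i v : homogeneous free_gr i v <-> forall t, homogeneous gr i (v t).
Proof.
split=> [<- t|hv]; first by rewrite ffunE; exact: homog_comp.
by apply/ffunP => t; rewrite ffunE; exact: hv.
Qed.

(** Row vector convention: with coefficients on the left of basis elements of degree 0, the Leibniz
    rule forces this formula once [d e_s] is the row [D s]. *)
Definition free_d v : FM := [ffun t => dga_d (v t : B) + \sum_s twist gr 1 (v s) * D s t].

Lemma free_act i j (a : B) v : homogeneous gr i a -> homogeneous free_gr j v ->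
  homogeneous free_gr (i + j) (a *: v).
Proof.
by move=> ha /free_homogP hv; apply/free_homogP => t; rewrite ffunE; apply: dga_mul.
Qed.

Lemma free_dD : {morph free_d : u v / u + v}.
Proof.
move=> u v; apply/ffunP => t; rewrite !ffunE dga_dD addrACA -big_split.
by congr (_ + _); apply: eq_bigr => s _; rewrite ffunE twistD mulrDl.
Qed.

Lemma free_ddeg i v : homogeneous free_gr i v -> homogeneous free_gr (i + 1) (free_d v).
Proof.
move=> /free_homogP hv; apply/free_homogP => t; rewrite ffunE.
apply: homogD; first exact: dga_ddeg.
by apply: homog_sum => s; apply: dga_mul => //; exact: homog_twist.
Qed.

(** The two terms in [d v] cancel by the sign of [twist_d]; [D] being closed of degree 1, there
    remains minus [v] times the square of [D]. *)
Lemma free_dd v : free_d (free_d v) = 0.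
Proof.
apply/ffunP => t; rewrite !ffunE dga_dD dga_dd add0r (morphDsum (@dga_dD k B)).
rewrite -big_split /=; transitivity (\sum_s \sum_r v r * - (D r s * D s t)); last first.
  rewrite exchange_big big1//= => r _.
  by rewrite -mulr_sumr sumrN D_sqr oppr0 mulr0.
apply: eq_bigr => s _; rewrite dga_leibniz_twist D_cocycle mulr0 addr0 twist_d ffunE.
rewrite twistD mulrDl ksignMl addrA [X in X + _](_ : _ = 0) ?add0r; last first.
  by rewrite /ksign /= addNr.
rewrite (morphDsum (twistD _ _)) mulr_suml; apply: eq_bigr => r _.
rewrite twistM twist_comp (twist_homog _ (D_homog _ _)) /ksign /= mulrN mulNr mulrN -mulrA.
congr (- (_ * _)); move: (v r : B).
by apply: (grext (G := gr)) => [x y|//|i x hx]; rewrite ?twistD//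
  (twist_homog _ hx) /ksign oddzE andbF.
Qed.

Lemma free_leibniz i (a : B) v : homogeneous gr i a ->
  free_d (a *: v) = dga_d a *: v + ksign i (a *: free_d v).
Proof.
move=> ha; rewrite -[ksign i _]ksignZl; apply/ffunP => t; rewrite !ffunE.
rewrite [LHS](_ : _ = dga_d (a * v t) + \sum_s twist gr 1 (a * v s) * D s t); last first.
  by congr (_ + _); apply: eq_bigr => s _; rewrite ffunE.
rewrite [RHS](_ : _ = dga_d a * v t +
  ksign i a * (dga_d (v t : B) + \sum_s twist gr 1 (v s) * D s t))//.
rewrite (dga_leibniz _ ha) mulrDr ksignMl addrA; congr (_ + _).
rewrite mulr_sumr; apply: eq_bigr => s _.
by rewrite twistM (twist_homog _ ha) mulr1 -mulrA.
Qed.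

Definition freeMod : dgModule B := @DGModule k B FM free_gr free_d free_act free_dD
  free_ddeg free_dd free_leibniz.

Definition free_e (t : T) : freeMod := [ffun s => (s == t)%:R] : FM.

Lemma free_sumE (c : T -> B) t : (\sum_s c s *: free_e s : FM) t = c t.
Proof.
rewrite sum_ffunE (bigD1 t)//= big1 => [|s st]; rewrite !ffunE.
  by rewrite eqxx addr0; exact: mulr1.
by rewrite eq_sym (negbTE st); exact: mulr0.
Qed.

Lemma free_expand (v : freeMod) : v = \sum_s (v : FM) s *: free_e s.
Proof. by apply/ffunP => t; rewrite free_sumE. Qed.

Lemma free_e_homog t : homogeneous (dgm_gr freeMod) 0 (free_e t).
Proof.
apply/free_homogP => s; rewrite ffunE; case: (s == t); [exact: dga_1|exact: homog0].
Qed.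

Lemma free_d_e s : dgm_d (free_e s) = \sum_t D s t *: free_e t.
Proof.
apply/ffunP => t; rewrite free_sumE ffunE (bigD1 s)//= big1 => [|r rs].
  rewrite !ffunE eqxx twist1 mul1r addr0.
  by case: (t == s); rewrite /= ?dga_d1 ?(morphD0 (@dga_dD k B)) add0r.
by rewrite ffunE (negbTE rs) (morphD0 (twistD _ _)) mul0r.
Qed.

Lemma free_e_inj : injective free_e.
Proof.
move=> s t /ffunP /(_ s); rewrite !ffunE eqxx.
by case: eqP => // _ /eqP; rewrite oner_eq0.
Qed.

Definition free_basis : set freeMod := [set x | exists t, x = free_e t]%classic.

(** In a semi-basis, coefficients are functions on the module and not on an index set; injectivity
    of [free_e] makes the passage from [T] possible. *)
Lemma free_coef (c : T -> B) : exists c' : freeMod -> B, forall t, c' (free_e t) = c t.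
Proof.
exists (fun x => if [pick t | x == free_e t] is Some t then c t else 0) => t.
case: pickP => [s /eqP/free_e_inj -> //|/(_ t)].
by rewrite eqxx.
Qed.

Lemma free_gen (v : freeMod) : exists c : freeMod -> B,
  v = \sum_(e <- [seq free_e t | t <- enum T]) c e *: e.
Proof.
have [c cE] := free_coef (v : FM); exists c.
rewrite big_map big_enum [LHS]free_expand; apply: eq_bigr => t _.
by rewrite cE.
Qed.

Lemma free_semi_basis (lvl : T -> nat) :
  (forall s t, ~~ (lvl t < lvl s)%N -> D s t = 0) -> semi_basis free_basis.
Proof.
move=> lvlD; split.
- by move=> _ [t ->]; exists 0; exact: free_e_homog.
- move=> v; have [c ->] := free_gen v; exists [seq free_e t | t <- enum T], c.
  by split=> // e /mapP[t _ ->]; exists t.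
- move=> s c us sE s0 e es; have [t et] := sE e es.
  have /ffunP /(_ t) := s0; rewrite sum_ffunE (bigD1_seq e)//= big1_seq; last first.
    move=> e' /andP[ee' /sE [t' e't']]; rewrite e't' !ffunE.
    rewrite (_ : t == t' = false); first exact: mulr0.
    by apply: contraNF ee' => /eqP tt'; rewrite e't' et tt'.
  by rewrite addr0 et !ffunE eqxx => <-; rewrite [RHS]mulr1.
have [L LE] : exists L : freeMod -> nat, forall t, L (free_e t) = lvl t.
  exists (fun x => if [pick t | x == free_e t] is Some t then lvl t else 0%N) => t.
  case: pickP => [s /eqP/free_e_inj -> //|/(_ t)].
  by rewrite eqxx.
exists L => _ [s ->].
have [c cE] := free_coef (D s).
exists [seq free_e t | t <- enum T & (lvl t < lvl s)%N], c; split.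
  move=> e /mapP[t]; rewrite mem_filter => /andP[ts _] ->.
  by split; [exists t|rewrite !LE].
rewrite free_d_e big_map big_filter big_enum_cond /= [RHS]big_mkcond.
apply: eq_bigr => t _; rewrite cE; case: ifPn => // /lvlD ->.
by rewrite scale0r.
Qed.

Lemma free_hom (M : dgModule B) (n : T -> M) :
  (forall t, homogeneous (dgm_gr M) 0 (n t)) ->
  (forall s, dgm_d (n s) = \sum_t D s t *: n t) ->
  exists f : dgHom freeMod M, forall v, f v = \sum_t (v : FM) t *: n t.
Proof.
move=> hn dn; apply: mk_dgHom.
- by move=> u v; rewrite -big_split; apply: eq_bigr => t _; rewrite ffunE scalerDl.
- by move=> a v; rewrite scaler_sumr; apply: eq_bigr => t _; rewrite ffunE scalerA.
- move=> i v /free_homogP hv; apply: homog_sum => t.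
  by rewrite -[i]addr0; exact: dgm_act.
move=> v; rewrite (morphDsum (@dgm_dD _ _ _)).
rewrite (eq_bigr _ (fun t _ => dgm_leibniz_twist _ _)) big_split /=.
under eq_bigr do rewrite ffunE scalerDl scaler_suml.
rewrite big_split /= exchange_big; congr (_ + _); apply: eq_bigr => s _.
by rewrite dn scaler_sumr; apply: eq_bigr => t _; rewrite scalerA.
Qed.

(** The algebra lives in degrees at least 0, and both its differential and the entries of [D] raise
    the degree by one. *)
Lemma free_d_mideal (v : freeMod) t : connected B -> in_mideal ((dgm_d v : FM) t : B).
Proof.
move=> cB i i0; rewrite ffunE compD.
have gr_neg j x : j < 0 -> gr j x = 0 by move=> /cB.1; apply; exact: homog_comp.
have -> : gr i (dga_d (v t : B)) = 0.
  have : homogeneous gr i (dga_d (gr (i - 1) (v t))).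
    by rewrite -{1}[i](subrK 1); apply: dga_ddeg; exact: homog_comp.
  rewrite gr_neg; last by lia.
  move=> _; move: (v t : B); apply: (grext (G := gr)) => [x y|x y|j x hx].
  - by rewrite dga_dD compD.
  - by rewrite addr0.
  rewrite (Defs.compE _ (dga_ddeg hx)); case: eqP => // ij.
  rewrite (cB.1 j x) ?(morphD0 (@dga_dD k B))//; lia.
rewrite add0r (morphDsum (compD _ _)) big1// => s _.
move: (v s : B); apply: (grext (G := gr)) => [x y|x y|j x hx].
- by rewrite twistD mulrDl compD.
- by rewrite addr0.
rewrite (Defs.compE _ (dga_mul (homog_twist 1 hx) (D_homog s t))); case: eqP => // ij.
by rewrite (cB.1 j x) ?(morphD0 (twistD _ _)) ?mul0r//; lia.
Qed.

Lemma free_not_boundary (c : k) (v : freeMod) t : connected B ->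
  c%:A *: free_e t = dgm_d v -> c = 0.
Proof.
move=> cB /ffunP/(_ t); rewrite ffunE ffunE eqxx => cE.
have := free_d_mideal v t cB (lexx 0); rewrite -cE.
rewrite [c%:A *: _]mulr1 dga_grZ (dga_1 B) => /eqP.
by rewrite scaler_eq0 oner_eq0 orbF => /eqP.
Qed.

Lemma free_minimal : connected B -> minimal freeMod.
Proof.
move=> cB v; exists [seq ((dgm_d v : FM) t, free_e t) | t <- enum T]; split; last first.
  by rewrite big_map big_enum [LHS]free_expand.
by move=> _ /mapP[t _ ->]; exact: free_d_mideal.
Qed.

End FreeModule.

Lemma bij_quasi_iso (k : fieldType) (A : dgAlgebra k) (M N : dgModule A) (f : dgHom M N) :
  injective f -> (forall n, exists m, f m = n) -> quasi_iso f.
Proof.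
move=> fi fs; split=> [n dn|m dm [w fw]].
  have [m mn] := fs n; exists m; split; last by exists 0; rewrite mn dgm_d0 addr0.
  by apply: fi; rewrite dgh_d mn dn linear0.
by have [v vw] := fs w; exists v; apply: fi; rewrite dgh_d vw.
Qed.

Section DualFree.
Variables (k : fieldType) (B : dgAlgebra k) (T : finType) (D : T -> T -> B).
Hypotheses (D_homog : forall s t, homogeneous (dga_gr B) 1 (D s t))
  (D_cocycle : forall s t, dga_d (D s t) = 0)
  (D_sqr : forall s t, \sum_r D s r * D r t = 0).
Variables (sg : T -> T) (D' : T -> T -> opDGA B).
Hypotheses (sgK : involutive sg) (D'E : forall s t, D' s t = - D (sg t) (sg s)).
Hypotheses (D'_homog : forall s t, homogeneous (dga_gr (opDGA B)) 1 (D' s t))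
  (D'_cocycle : forall s t, dga_d (D' s t) = 0)
  (D'_sqr : forall s t, \sum_r D' s r * D' r t = 0).
Local Notation gr := (dga_gr B).
Local Notation F := (freeMod D_homog D_cocycle D_sqr).
Local Notation F' := (freeMod D'_homog D'_cocycle D'_sqr).
Local Notation e := (free_e D_homog D_cocycle D_sqr).

Let opm0 b : opmul B 0 b = 0.
Proof. exact: (morphD0 (f := (opmul B)^~ b) (fun u v => opmulDl u v b)). Qed.

(** The opposite product absorbs the sign in [f (b x) = (-1)^(n |b|) b f(x)], so the formula is
    valid for inhomogeneous [f] as well. *)
Lemma dual_freeE (f : dual_type F) (x : F) :
  f x = \sum_t opmul B (f (e t)) ((x : {ffun T -> B^o}) t) :> B.
Proof.
rewrite {1}[x]free_expand (morphDsum (dual_add f)); apply: eq_bigr => t _.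
move: ((x : {ffun T -> B^o}) t : B) => b; move: f; apply: dual_ind2.
- by rewrite !dual0E opm0.
- by move=> f g hf hg; rewrite !dual_addE hf hg opmulDl.
move=> n f [fD fg fl]; move: b; apply: (grext (G := gr)) => [b c|b c|i b hb].
- by rewrite scalerDl [LHS]fD.
- exact: opmulDr.
rewrite [LHS](fl _ _ _ hb) /=; have h := fg _ _ (free_e_homog D_homog D_cocycle D_sqr t).
by rewrite (opmul_homog h hb) add0r.
Qed.

(** A linear map is given by its values on the basis, and the term [- (-1)^|f| f o d] of the dual
    differential replaces the matrix by minus its transpose. The relabelling [sg] serves to
    recognize that matrix as one of the same kind; it will be complementation of subsets. *)
Lemma dual_free : exists th : dgHom (dualMod F) F',
  [/\ forall f t, (th f : {ffun T -> (opDGA B)^o}) t = (f : dual_type F) (e (sg t)),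
      injective th & forall v, exists f, th f = v].
Proof.
pose h (f : dualMod F) : F' := [ffun t => (f : dual_type F) (e (sg t))] : {ffun T -> (opDGA B)^o}.
have hD : {morph h : f g / f + g}.
  by move=> f g; apply/ffunP => t; rewrite !ffunE; exact: erefl.
have hom_e n f : hom_deg n f -> forall t, homogeneous gr n (f (e t) : B).
  move=> [_ fg _] t; have := fg _ _ (free_e_homog D_homog D_cocycle D_sqr t).
  by rewrite add0r.
have [||||th thE] := @mk_dgHom _ _ (dualMod F) F' h.
- exact: hD.
- by move=> b f; apply/ffunP => t; rewrite !ffunE.
- move=> n f hf; apply/free_homogP => t; rewrite ffunE; move: f hf.
  apply: dual_homog_ind => [|f g hf hg|f hf].
  + by rewrite dual0E; exact: homog0.
  + by rewrite dual_addE; exact: homogD.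
  exact: hom_e hf _.
- apply: dual_ind2 => [|f g hf hg|n f hf].
  + by rewrite !(dgm_d0, morphD0 hD).
  + by rewrite dgm_dD !hD dgm_dD hf hg.
  have [fD _ fl] := hf.
  apply/ffunP => t; rewrite !ffunE.
  rewrite [LHS]dual_d_fun_hom free_d_e (morphDsum fD) (morphDsum (ksignD n)) -sumrN.
  congr (_ + _); rewrite (reindex_inj (inv_inj sgK)) /=; apply: eq_bigr => s _.
  rewrite ffunE (twist_homog 1 (hom_e _ _ hf _ : homogeneous (dga_gr (opDGA B)) n _)) mulr1.
  rewrite [RHS](_ : _ = opmul B (ksign n (f (e (sg s)))) (- D (sg t) (sg s))); last first.
    by rewrite -D'E.
  rewrite opmul_ksignl (morphDN (@opmulDr _ B (f (e (sg s))))).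
  rewrite (opmul_homog (hom_e _ _ hf _) (D_homog _ _)) mulr1 (fl _ _ _ (D_homog _ _)) mulr1.
  by rewrite (morphDN (ksignD n)).
exists th; split=> [f t|f g fg|v].
- by rewrite thE ffunE.
- apply: dual_eq => x; rewrite !dual_freeE; apply: eq_bigr => t _.
  have := congr1 (fun v : F' => (v : {ffun T -> (opDGA B)^o}) (sg t)) fg.
  by rewrite /= !thE !ffunE sgK => ->.
move: v; apply: (grind (G := dgm_gr F')) => [|u v [f <-] [g <-]|n v /free_homogP hv].
- by exists 0; rewrite linear0.
- by exists (f + g); rewrite linearD.
pose f (x : F) : B := \sum_t opmul B (v (sg t)) ((x : {ffun T -> B^o}) t).
have {}hv t : homogeneous gr n (v t : B) := hv t.
have hf : hom_deg n f.
  split=> [x y|i x /free_homogP hx|i b x hb].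
  - by rewrite -big_split; apply: eq_bigr => t _; rewrite ffunE [LHS]opmulDr.
  - apply: homog_sum => t; rewrite (opmul_homog (hv _) (hx _)); apply: homog_ksign.
    exact: dga_mul (hx _) (hv _).
  rewrite mulr_sumr (morphDsum (ksignD _)); apply: eq_bigr => t _.
  rewrite !(opmul_homogl _ (hv _)) ffunE [twist _ _ _](twistM (A := B)).
  by rewrite (twist_homog n hb) ksignMl ksignMl mulrC -mulrA.
exists (mkdual hf); rewrite thE; apply/ffunP => t; rewrite ffunE.
rewrite [LHS](_ : _ = \sum_s opmul B (v (sg s)) ((e (sg t) : {ffun T -> B^o}) s))//.
rewrite (bigD1 (sg t))//= big1 => [|s st]; rewrite !ffunE.
  by rewrite eqxx sgK addr0 [LHS]opmul1r.
by rewrite (negbTE st) (morphD0 (@opmulDr _ B (v (sg s)))).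
Qed.

End DualFree.

(** * Koszul complexes *)

(** The sum is its own opposite; dividing by 2 takes care of the diagonal at the same time. *)
Lemma antisym_sum0 (k : fieldType) (V : lmodType k) (I : finType) (t : I -> I -> V) :
  [pchar k] =i pred0 -> (forall i j, t j i = - t i j) -> \sum_i \sum_j t i j = 0.
Proof.
move=> k0 ta; set S := \sum_i _.
have SN : S = - S.
  rewrite /S -[in RHS]sumrN exchange_big; apply: eq_bigr => i _ /=.
  by rewrite -sumrN; apply: eq_bigr => j _; rewrite ta.
have two0 : (2%:R : k) != 0 by rewrite ((pcharf0P k).1 k0).
have : (2%:R : k) *: S = 0 by rewrite scaler_nat mulr2n {1}SN addNr.
by move/eqP; rewrite scaler_eq0 (negbTE two0) => /eqP.
Qed.

Section SignFunctions.
Variable m : nat.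
Implicit Types (i j : 'I_m) (J : {set 'I_m}).

(* The signs of the terms in the exterior contractions e_J |-> e_(J minus i);
   only the anticommutation of contractions is needed. *)
Definition anticommuting (eps : 'I_m -> {set 'I_m} -> bool) : Prop :=
  forall i j J, i \in J -> j \in J -> i != j ->
    eps i J (+) eps j (J :\ i) = ~~ (eps j J (+) eps i (J :\ j)).

Lemma anticommuting_ex : exists eps, anticommuting eps.
Proof.
(* The usual exterior sign, by the number of elements of [J] before [i]. Deleting [i] lowers this
   number by one for a larger [j], whereas deleting [j] does not change it for [i]. *)
exists (fun i J => odd #|[set j in J | (j < i)%N]|).
have main i j J : i \in J -> (i < j)%N ->
    odd #|[set l in J | (l < j)%N]| = ~~ odd #|[set l in J :\ i | (l < j)%N]| /\
    [set l in J :\ j | (l < i)%N] = [set l in J | (l < i)%N].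
  move=> iJ ij; split.
    rewrite (cardsD1 i) inE iJ ij /=; congr (~~ odd _); apply: eq_card => l.
    by rewrite !inE andbA.
  apply/finset.setP => l; rewrite !inE; case: (eqVneq l j) => [->|//].
  by rewrite /= (ltn_geF (ltnW ij : (i < j.+1)%N)) andbF.
move=> i j J iJ jJ ij; have [lt|lt] := boolP (i < j)%N.
  have [-> ->] := main i j J iJ lt.
  by rewrite addNb negbK addbC.
have {}lt : (j < i)%N by rewrite ltn_neqAle eq_sym ij leqNgt.
have [-> ->] := main j i J jJ lt.
by rewrite addbC addbN addbC.
Qed.

(** The set [i |: ~: J] is the complement of [J :\ i], the source of the transposed arrow; the
    negation is the minus sign of the dual differential. *)
Definition dual_sign (eps : 'I_m -> {set 'I_m} -> bool) i J := ~~ eps i (i |: ~: J).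

Lemma anticommuting_dual eps : anticommuting eps -> anticommuting (dual_sign eps).
Proof.
move=> anti i j J iJ jJ ij; rewrite /dual_sign.
(* [P] is the complement of [J] deprived of [i] and [j]. The claim is the anticommutation rule at
   [P] with the two sides regrouped. *)
pose P := i |: (j |: ~: J).
have Pj : i |: ~: J = P :\ j.
  apply/finset.setP => l; rewrite !inE; case: (eqVneq l j) => [->|] //=.
  by rewrite jJ eq_sym (negbTE ij).
have Pi : j |: ~: J = P :\ i.
  apply/finset.setP => l; rewrite !inE; case: (eqVneq l i) => [->|] //=.
  by rewrite iJ (negbTE ij).
have P1 : j |: ~: (J :\ i) = P.
  apply/finset.setP => l; rewrite !inE negb_and negbK.
  by case: (l == i); case: (l == j).
have P2 : i |: ~: (J :\ j) = P.
  apply/finset.setP => l; rewrite !inE negb_and negbK.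
  by case: (l == i); case: (l == j).
rewrite P1 P2 Pj Pi.
have := anti i j P; rewrite /P !inE !eqxx orbT => /(_ erefl erefl ij).
rewrite -/P; do 4!case: (eps _ _) => //.
Qed.

End SignFunctions.

Section Koszul.
Variables (k : fieldType) (k_char0 : [pchar k] =i pred0) (B : dgAlgebra k) (m : nat).
Variables (eps : 'I_m -> {set 'I_m} -> bool) (eps_anti : anticommuting eps).
Variable (w : bool -> 'I_m -> B).
Hypotheses (w_homog : forall b i, homogeneous (dga_gr B) 1 (w b i))
  (w_cocycle : forall b i, dga_d (w b i) = 0)
  (w_sym : forall b i j, w b i * w (~~ b) j = w b j * w (~~ b) i).
Local Notation gr := (dga_gr B).
Implicit Types (i j : 'I_m) (J K : {set 'I_m}).

(** At most one term occurs. The dependence of [w] on the parity of [J] is what allows coefficients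
    that do not commute: over [A] the family is constant, over [A^e] it alternates. *)
Definition koszul_mx J K : B :=
  \sum_(i | (i \in J) && (K == J :\ i)) (-1) ^+ eps i J * w (odd #|J|) i.

Lemma koszul_mx_homog J K : homogeneous gr 1 (koszul_mx J K).
Proof.
rewrite /koszul_mx big_mkcond; apply: homog_sum => i; case: ifP => _; last exact: homog0.
by case: (eps i J); rewrite ?expr1 ?expr0 ?mul1r ?mulN1r//; apply: homogN.
Qed.

Lemma koszul_mx_cocycle J K : dga_d (koszul_mx J K) = 0.
Proof.
rewrite /koszul_mx big_mkcond (morphDsum (@dga_dD k B)) big1// => i _.
case: ifP => _; last exact: morphD0 (@dga_dD k B).
case: (eps i J); rewrite ?expr1 ?expr0 ?mul1r ?mulN1r ?(morphDN (@dga_dD k B)) w_cocycle//.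
by rewrite oppr0.
Qed.

Lemma koszul_mx_sum J (c : {set 'I_m} -> B) :
  \sum_K koszul_mx J K * c K =
    \sum_(i in J) (-1) ^+ eps i J * w (odd #|J|) i * c (J :\ i).
Proof.
under eq_bigr do rewrite /koszul_mx mulr_suml.
rewrite (exchange_big_dep (mem J)) /=; last by move=> K i _ /andP[].
apply: eq_bigr => i iJ; rewrite (big_pred1 (J :\ i))// => K.
by rewrite iJ.
Qed.

(** The arrows into [K] start from the sets [i |: K], which have one element more: hence the negated
    parity in [w]. *)
Lemma koszul_mx_suml K (c : {set 'I_m} -> B) :
  \sum_J c J * koszul_mx J K =
    \sum_(i | i \notin K) (-1) ^+ eps i (i |: K) * (c (i |: K) * w (~~ odd #|K|) i).
Proof.
under eq_bigr do rewrite /koszul_mx mulr_sumr.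
rewrite (exchange_big_dep xpredT) //= [RHS]big_mkcond; apply: eq_bigr => i _ /=.
case: ifPn => [iK|/negbNE iK]; last first.
  rewrite big_pred0// => J; apply/negbTE/negP => /andP[iJ /eqP KE].
  by move: iK; rewrite KE !inE eqxx.
rewrite (big_pred1 (i |: K)) => [|J /=].
  rewrite cardsU1 iK /= mulrA; case: (eps _ _); rewrite /= ?expr1 ?expr0 ?mulr1 ?mul1r//.
  by rewrite mulrN1 mulN1r mulNr.
apply/andP/eqP => [[iJ /eqP ->]|->]; first by rewrite finset.setD1K.
by rewrite finset.setU11 finset.setU1K.
Qed.

(** Deleting [i] then [j] or [j] then [i] gives the same product by [w_sym] and opposite signs by
    [eps_anti]. The family [t] is extended by zero to all pairs to make it antisymmetric. *)
Lemma koszul_mx_sqr J L : \sum_K koszul_mx J K * koszul_mx K L = 0.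
Proof.
rewrite (koszul_mx_sum J (koszul_mx^~ L)).
pose c i j : bool := [&& i \in J, j \in J, i != j & L == J :\ i :\ j].
pose t i j : B := if c i j then
  (-1) ^+ (eps i J (+) eps j (J :\ i)) * (w (odd #|J|) i * w (~~ odd #|J|) j) else 0.
rewrite -[RHS](@antisym_sum0 _ _ _ t k_char0).
  rewrite big_mkcond; apply: eq_bigr => i _; rewrite /t /c.
  case: (boolP (i \in J)) => iJ /=; last by rewrite big1.
  rewrite /koszul_mx mulr_sumr [LHS]big_mkcond; apply: eq_bigr => j _ /=.
  rewrite !inE [j == i]eq_sym; case: (i != j) => /=; last by rewrite andbF.
  case: (j \in J) => //=; case: (L == _) => //.
  rewrite (_ : odd #|J :\ i| = ~~ odd #|J|); last by rewrite [#|J|](cardsD1 i) iJ /= negbK.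
  rewrite signr_addb; case: (eps i J) (eps j _) => [] [];
    by rewrite /= ?expr0 ?expr1 ?mul1r ?mulr1 ?mulN1r ?mulrN ?mulNr ?opprK ?mul1r.
move=> i j; rewrite /t /c [i == j]eq_sym.
rewrite (_ : J :\ j :\ i = J :\ i :\ j); last by apply/finset.setP => l; rewrite !inE andbCA.
case: (boolP (i \in J)) => iJ; last by rewrite andbF /= oppr0.
case: (boolP (j \in J)) => jJ /=; last by rewrite oppr0.
case: (eqVneq j i) => ij /=; first by rewrite oppr0.
case: (L == _); last by rewrite oppr0.
by rewrite (eps_anti jJ iJ ij) w_sym signrN mulNr.
Qed.

Definition koszulMod : dgModule B :=
  freeMod koszul_mx_homog koszul_mx_cocycle koszul_mx_sqr.

Lemma koszul_dE (v : koszulMod) K : (dgm_d v : {ffun {set 'I_m} -> B^o}) K =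
  dga_d ((v : {ffun {set 'I_m} -> B^o}) K : B) +
  \sum_(i | i \notin K) (-1) ^+ eps i (i |: K) *
    (twist gr 1 ((v : {ffun {set 'I_m} -> B^o}) (i |: K)) * w (~~ odd #|K|) i).
Proof. by rewrite ffunE (koszul_mx_suml _ (fun J => twist gr 1 _)). Qed.

Lemma koszul_semi_basis :
  semi_basis (@free_basis _ _ _ _ koszul_mx_homog koszul_mx_cocycle koszul_mx_sqr).
Proof.
apply: (free_semi_basis _ _ _ (lvl := fun J => #|J|)) => J K lt.
rewrite /koszul_mx big_pred0// => i; apply/negbTE/negP => /andP[iJ /eqP KE].
by rewrite KE [#|J|](cardsD1 i) iJ ltnS leqnn in lt.
Qed.

Local Notation e := (free_e koszul_mx_homog koszul_mx_cocycle koszul_mx_sqr).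

Lemma koszul_mx0P J i : (i \in J) && (finset.set0 == J :\ i) = (J == [set i]%SET).
Proof.
apply/andP/eqP => [[iJ /eqP J0]|->]; last first.
  by rewrite inE eqxx; split=> //; apply/eqP/finset.setP => j; rewrite !inE andNb.
by rewrite -[J](finset.setD1K iJ) -J0; apply/finset.setP => j; rewrite !inE orbF.
Qed.

(** The basis element of the empty set goes to [n] and the others to 0. Only singletons map onto the
    empty set under the differential, and they are odd, hence the condition on [w true]. *)
Lemma koszul_hom (M : dgModule B) (n : M) : homogeneous (dgm_gr M) 0 n -> dgm_d n = 0 ->
  (forall i, w true i *: n = 0) ->
  exists f : dgHom koszulMod M, forall v, f v = (v : {ffun {set 'I_m} -> B^o}) finset.set0 *: n.
Proof.
move=> hn dn wn.
have [||f fE] := free_hom koszul_mx_homog koszul_mx_cocycle koszul_mx_sqr (M := M)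
  (n := fun K => if K == finset.set0 then n else 0).
- by move=> K; case: ifP => // _; exact: homog0.
- move=> J; have -> : dgm_d (if J == finset.set0 then n else 0) = 0.
    by case: ifP => // _; exact: dgm_d0.
  rewrite (bigD1 finset.set0)//= eqxx big1 ?addr0 => [|K /negbTE ->]; last by rewrite scaler0.
  rewrite /koszul_mx scaler_suml big1// => i; rewrite koszul_mx0P => /eqP ->.
  by rewrite cards1 -scalerA wn scaler0.
exists f => v; rewrite fE (bigD1 finset.set0)//= eqxx big1 ?addr0// => K /negbTE ->.
by rewrite scaler0.
Qed.

(** Up to sign this is the differential of the basis element of [[set i]]. It exhibits cocycles that
    annihilate the class of degree 0, the invariant that distinguishes the parities of [m]. *)
Lemma koszul_coef_boundary i : exists u : koszulMod, w true i *: e finset.set0 = dgm_d u.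
Proof.
have eE : dgm_d (e [set i]%SET) = ((-1) ^+ eps i [set i]%SET * w true i) *: e finset.set0.
  rewrite free_d_e (bigD1 finset.set0)//= big1 ?addr0 => [|K K0].
    rewrite /koszul_mx (big_pred1 i) ?cards1// => j; rewrite koszul_mx0P.
    by rewrite (inj_eq finset.set1_inj) eq_sym.
  rewrite /koszul_mx big_pred0 ?scale0r// => j; apply/negbTE/negP.
  rewrite inE => /andP[/eqP -> /eqP KE]; move: K0; rewrite KE => /eqP[].
  by apply/finset.setP => l; rewrite !inE andNb.
exists (ksign (eps i [set i]%SET : nat) (e [set i]%SET)).
rewrite dgm_d_ksign eE -ksignZl; congr (_ *: _).
by case: (eps _ _); rewrite /ksign /= ?expr1 ?mulN1r ?opprK ?mul1r.
Qed.

End Koszul.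

Section KoszulDual.
Variables (k : fieldType) (k_char0 : [pchar k] =i pred0) (B : dgAlgebra k) (m : nat).
Variables (eps : 'I_m -> {set 'I_m} -> bool) (eps_anti : anticommuting eps).
Variable (w : bool -> 'I_m -> B).
Hypotheses (w_homog : forall b i, homogeneous (dga_gr B) 1 (w b i))
  (w_cocycle : forall b i, dga_d (w b i) = 0)
  (w_sym : forall b i j, w b i * w (~~ b) j = w b j * w (~~ b) i).

(* Dual basis elements are indexed by complements of subsets: this is where the
   parity of m enters. *)
Definition dual_coef (b : bool) (i : 'I_m) : opDGA B := w (b (+) ~~ odd m) i.

Lemma dual_coef_homog b i : homogeneous (dga_gr (opDGA B)) 1 (dual_coef b i).
Proof. exact: w_homog. Qed.

Lemma dual_coef_cocycle b i : dga_d (dual_coef b i) = 0.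
Proof. exact: w_cocycle. Qed.

Lemma dual_coef_sym b i j :
  dual_coef b i * dual_coef (~~ b) j = dual_coef b j * dual_coef (~~ b) i.
Proof.
rewrite /dual_coef [LHS](opmul_homog (w_homog _ _) (w_homog _ _)).
rewrite [RHS](opmul_homog (w_homog _ _) (w_homog _ _)) addNb.
by congr ksign; have := w_sym (~~ (b (+) ~~ odd m)) j i; rewrite negbK.
Qed.

Definition koszul_dual : dgModule (opDGA B) :=
  koszulMod k_char0 (anticommuting_dual eps_anti) dual_coef_homog dual_coef_cocycle
    dual_coef_sym.

Lemma koszul_dual_iso :
  exists th : dgHom (dualMod (koszulMod k_char0 eps_anti w_homog w_cocycle w_sym)) koszul_dual,
    injective th /\ forall v, exists f, th f = v.
Proof.
have [||th [_ ? ?]] := @dual_free _ _ _ _ (koszul_mx_homog eps w_homog)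
  (koszul_mx_cocycle eps w_cocycle) (koszul_mx_sqr k_char0 eps_anti w_sym)
  (@finset.setC _) _ _ _ (koszul_mx_homog (dual_sign eps) dual_coef_homog)
  (koszul_mx_cocycle (dual_sign eps) dual_coef_cocycle)
  (koszul_mx_sqr k_char0 (anticommuting_dual eps_anti) dual_coef_sym); last by exists th.
  exact: finset.setCK.
move=> J K; rewrite /koszul_mx -sumrN; apply: eq_big => [i|i /andP[iJ /eqP KE]].
  rewrite finset.in_setC; apply/andP/andP => [[iJ /eqP ->]|[iK /eqP JE]].
    rewrite !inE eqxx; split=> //; apply/eqP/finset.setP => l; rewrite !inE negb_and negbK.
    by case: (eqVneq l i) => [->|]; rewrite ?iJ.
  have JE' : J = i |: K.
    apply/finset.setP => l; have /finset.setP/(_ l) := JE; rewrite !inE.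
    by case: (l == i); case: (l \in J); case: (l \in K).
  by rewrite JE' finset.setU11 finset.setU1K.
rewrite /dual_sign /dual_coef; have <- : ~: K = i |: ~: J.
  apply/finset.setP => l; rewrite KE !inE negb_and negbK.
  by case: (eqVneq l i) => [->|].
(* The complement of [K] has [m - #|J| + 1] elements, since [K] is [J] without [i]. *)
have -> : odd #|~: K| = odd #|J| (+) ~~ odd m.
  have := cardsC K; rewrite card_ord => /(congr1 odd); rewrite oddD.
  have -> : #|J| = #|K|.+1 by rewrite KE [LHS](cardsD1 i) iJ.
  move=> <- /=; by case: (odd #|K|); case: (odd _).
case: (eps _ _); rewrite /= ?expr1 ?expr0 ?mul1r ?mulN1r ?opprK//.
Qed.

End KoszulDual.

(** * Cohomology of the Koszul complex *)

Section FilteredComparison.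
Variables (U V : zmodType) (T : finType) (lvl : T -> nat).
Variables (dV : V -> V) (phi : U -> V).
Variables (DU : {ffun T -> U} -> {ffun T -> U}) (DV : {ffun T -> V} -> {ffun T -> V}).
Hypotheses (dVD : {morph dV : x y / x + y}) (phiD : {morph phi : x y / x + y}).
Hypotheses (DUD : {morph DU : x y / x + y}) (DVD : {morph DV : x y / x + y}).
Hypotheses
    (phi_surj : forall z, dV z = 0 -> exists p w, z = phi p + dV w)
  (phi_inj : forall p w, phi p = dV w -> p = 0).
Let Phi (u : {ffun T -> U}) : {ffun T -> V} := [ffun t => phi (u t)].
Hypotheses (DUU : forall u, DU (DU u) = 0) (DVV : forall v, DV (DV v) = 0)
  (PhiDU : forall u, Phi (DU u) = DV (Phi u)).
(** An increasing filtration. By [DU_below] and [DV_top], its graded pieces carry the zero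
    differential on the side of [U] and [dV] on that of [V]; [phi_surj] and [phi_inj] give the
    comparison there. *)
Let below (M : zmodType) n (v : {ffun T -> M}) := forall t, (n <= lvl t)%N -> v t = 0.
Hypotheses (DU_below : forall n u, below n.+1 u -> below n (DU u))
  (DV_top : forall n v t, below n.+1 v -> (n <= lvl t)%N -> DV v t = dV (v t)).

Let PhiD : {morph Phi : x y / x + y}.
Proof. by move=> u v; apply/ffunP => t; rewrite !ffunE phiD. Qed.

Let belowD (M : zmodType) n (u v : {ffun T -> M}) : below n u -> below n v -> below n (u + v).
Proof. by move=> hu hv t nt; rewrite ffunE hu ?hv ?addr0. Qed.

Let belowN (M : zmodType) n (u : {ffun T -> M}) : below n u -> below n (- u).
Proof. by move=> hu t nt; rewrite ffunE hu ?oppr0. Qed.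

Let belowS (M : zmodType) n (u : {ffun T -> M}) : below n u -> below n.+1 u.
Proof. by move=> hu t /ltnW; exact: hu. Qed.

Let belowPhi n u : below n u -> below n (Phi u).
Proof. by move=> hu t nt; rewrite ffunE hu ?(morphD0 phiD). Qed.

(* Both halves of the statement that Phi is a quasi-isomorphism, proved
   together by induction on the filtration, as in the five lemma. *)
Lemma filtered_comparison n :
  (forall z, below n z -> DV z = 0 ->
     exists u w, [/\ below n u, below n w, DU u = 0 & z = Phi u + DV w]) /\
  (forall u w, below n u -> below n w -> DU u = 0 -> Phi u = DV w ->
     exists2 u', below n u' & u = DU u').
Proof.
have T0 : below 0 (0 : {ffun T -> U}) by move=> t _; rewrite ffunE.
elim: n => [|n [IHs IHi]].
  split=> [z hz _|u w hu _ _ _].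
    exists 0, 0; split=> //; try by move=> t _; rewrite ffunE.
      exact: morphD0 DUD.
    apply/ffunP => t; rewrite hz// ffunE (morphD0 DVD) !ffunE (morphD0 phiD).
    by rewrite addr0.
  by exists 0 => //; apply/ffunP => t; rewrite hu// (morphD0 DUD) ffunE.
(* subtracting a lift of the top components *)
have top (z : {ffun T -> V}) : below n.+1 z -> (forall t, (n <= lvl t)%N -> dV (z t) = 0) ->
    exists p w, [/\ below n.+1 p, below n.+1 w & below n (z - Phi p - DV w)].
  move=> hz dz.
  have ex t : exists pw : U * V, (n == lvl t -> z t = phi pw.1 + dV pw.2) /\
      (n != lvl t -> pw = (0, 0)).
    case: (eqVneq n (lvl t)) => nt; last by exists (0, 0).
    have [|p [w zE]] := phi_surj (z := z t); first by apply: dz; rewrite nt.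
    by exists (p, w).
  pose f t := projT1 (cid (ex t)).
  have fE t : n == lvl t -> z t = phi (f t).1 + dV (f t).2.
    by rewrite /f; case: cid => x [].
  have f0 t : n != lvl t -> f t = (0, 0) by rewrite /f; case: cid => x [].
  exists [ffun t => (f t).1], [ffun t => (f t).2].
  have h1 : below n.+1 [ffun t => (f t).1].
    by move=> t nt; rewrite ffunE f0// neq_ltn nt.
  have h2 : below n.+1 [ffun t => (f t).2].
    by move=> t nt; rewrite ffunE f0// neq_ltn nt.
  split=> // t nt; rewrite !ffunE (DV_top h2)// ffunE.
  case: (eqVneq n (lvl t)) => e; first by rewrite (fE t) ?e// addrAC addrK subrr.
  rewrite f0//= (morphD0 phiD) (morphD0 dVD) !subr0 hz//.
  by rewrite ltn_neqAle e nt.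
split=> [z hz dz|u w hu hw du uw].
  have [t nt|p [w [hp hw hz']]] := top z hz.
    by rewrite -(DV_top hz nt) dz ffunE.
  set z' := z - _ - _ in hz'.
  (* The lift [p] of the top components need not be a cocycle. Its differential has lower level and
     its image bounds [z'], so the inductive injectivity provides a correction [v]. *)
  have dz' : DV z' = Phi (DU (- p)).
    rewrite /z' !DVD !(morphDN DVD) DVV dz PhiDU !(morphDN PhiD) (morphDN DVD).
    by rewrite oppr0 addr0 add0r.
  have [||||v hv vE] := IHi (DU (- p)) z' => //.
    by apply: DU_below; exact: belowN.
  have [||u [w' [hu' hw' du' zE]]] := IHs (z' + Phi (- v)).
  - apply: belowD => //; apply: belowPhi; exact: belowN.
  - by rewrite DVD -PhiDU (morphDN DUD) -vE dz' -PhiD subrr (morphD0 PhiD).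
  exists (p + v + u), (w + w'); split.
  - by do 2?apply: belowD => //; exact: belowS.
  - by apply: belowD => //; exact: belowS.
  - by rewrite !DUD -vE -DUD subrr (morphD0 DUD) add0r.
  have -> : z = z' + DV w + Phi p by rewrite /z' !subrK.
  have -> : z' = Phi u + DV w' + Phi v by rewrite -zE (morphDN PhiD) subrK.
  by rewrite !PhiD DVD [LHS](ACl (5*3*1*(4*2))%AC).
(* At the top level [phi (u t)] is a coboundary, so [u] is already one level lower; it remains to
   lower [w]. *)
have u0 t : (n <= lvl t)%N -> u t = 0.
  move=> nt; apply: (phi_inj (w := w t)).
  by rewrite -(DV_top hw nt) -uw ffunE.
have [t nt|p [v [hp hv hw']]] := top w hw.
  by rewrite -(DV_top hw nt) -uw ffunE u0// (morphD0 phiD).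
set w' := w - _ - _ in hw'.
have [||||u' hu' u'E] := IHi (u - DU p) w' => //.
- by apply: belowD => //; apply: belowN; exact: DU_below.
- by rewrite DUD (morphDN DUD) DUU du subr0.
- by rewrite /w' !DVD !(morphDN DVD) DVV subr0 -uw PhiD (morphDN PhiD) PhiDU.
exists (p + u'); first by apply: belowD => //; exact: belowS.
by rewrite DUD -u'E addrC subrK.
Qed.

End FilteredComparison.

Section PolynomialKoszul.
Variables (k : fieldType) (k_char0 : [pchar k] =i pred0) (m : nat).
Local Notation R := {mpoly k[m]}.
Implicit Types (p : R) (a : 'X_{1..m}).

(** The diagonal operator on monomials with eigenvalues [f]: it serves for Euler operators, for
    division by the weight and for signs depending on the degree. *)
Definition scale_coef (f : 'X_{1..m} -> k) p : R :=
  \sum_(a <- msupp p) (f a * p@_a) *: 'X_[a].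

Lemma scale_coefE f p a : (scale_coef f p)@_a = f a * p@_a.
Proof.
rewrite /scale_coef raddf_sum /=.
under eq_bigr do rewrite mcoeffZ mcoeffX.
have [ap|ap] := boolP (a \in msupp p).
  rewrite (bigD1_seq a) ?msupp_uniq//= eqxx mulr1 big1 ?addr0// => b ba.
  by rewrite (negbTE ba) mulr0.
rewrite big1_seq; first by move: ap; rewrite mcoeff_msupp negbK => /eqP ->; rewrite mulr0.
move=> b /= bp; rewrite (_ : b == a = false) ?mulr0//.
by apply: contraNF ap => /eqP <-.
Qed.

Lemma scale_coefD f : {morph scale_coef f : p q / p + q}.
Proof. by move=> p q; apply/mpolyP => a; rewrite mcoeffD !scale_coefE mcoeffD mulrDr. Qed.

Lemma scale_coefX f a : scale_coef f 'X_[a] = f a *: 'X_[a].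
Proof.
apply/mpolyP => b; rewrite scale_coefE mcoeffZ mcoeffX.
by case: eqP => [->|]; rewrite ?mulr0.
Qed.

Lemma scale_coefZ f c p : scale_coef f (c *: p) = c *: scale_coef f p.
Proof. by apply/mpolyP => a; rewrite mcoeffZ !scale_coefE mcoeffZ mulrCA. Qed.

Lemma mpoly_ext (V : zmodType) (f g : R -> V) : {morph f : p q / p + q} ->
  {morph g : p q / p + q} -> (forall c a, f (c *: 'X_[a]) = g (c *: 'X_[a])) -> f =1 g.
Proof.
move=> fD gD fg; elim/mpolyind => [|c a p _ _ IH]; first by rewrite !morphD0.
by rewrite fD gD fg IH.
Qed.

Lemma scale_coef_mulX (f g : 'X_{1..m} -> k) i p :
  (forall a, f a = g (a + U_(i))%MM) -> scale_coef f p * 'X_i = scale_coef g (p * 'X_i).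
Proof.
move=> fg; move: p; apply: mpoly_ext => [p q|p q|c a].
- by rewrite scale_coefD mulrDl.
- by rewrite mulrDl scale_coefD.
by rewrite -scalerAl -mpolyXD !scale_coefZ !scale_coefX -fg -!scalerAl -mpolyXD.
Qed.

Lemma mulX_deriv i p : p^`M(i) * 'X_i = scale_coef (fun a => (a i)%:R) p.
Proof.
move: p; apply: mpoly_ext => [p q|p q|c a].
- by rewrite mderivD mulrDl.
- exact: scale_coefD.
rewrite mderivZ scale_coefZ scale_coefX mderivX -!scalerAl -mpolyXD.
case: (posnP (a i)) => [->|a0]; first by rewrite !scale0r.
congr (_ *: (_ *: _)); congr 'X_[_]; apply/mnmP => j; rewrite mnmDE mnmBE mnm1E.
by case: (eqVneq i j) => [<-|_]; [rewrite subnK|rewrite subn0 addn0].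
Qed.

Lemma deriv_mulX i j p : (p * 'X_j)^`M(i) = p^`M(i) * 'X_j + p *+ (i == j).
Proof.
rewrite mderivM mderivX mnm1E [j == i]eq_sym; case: (eqVneq i j) => [->|_].
  rewrite scale1r (_ : (_ - _)%MM = 0%MM) ?mpolyX0 ?mulr1//.
  by apply/mnmP => l; rewrite mnmBE subnn mnm0E.
by rewrite scale0r mulr0.
Qed.

Variables (eps : 'I_m -> {set 'I_m} -> bool) (eps_anti : anticommuting eps).
Local Notation W := {ffun {set 'I_m} -> R}.
Implicit Types (v : W) (i j : 'I_m) (K : {set 'I_m}).

Definition poly_koszul_d v : W :=
  [ffun K : {set 'I_m} => \sum_(i | i \notin K) (-1) ^+ eps i (i |: K) * (v (i |: K) * 'X_i)].

(** With basis elements read as differential forms, this is the exterior derivative and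
    [poly_koszul_d] the contraction by the Euler field; their anticommutator is a Lie derivative. *)
Definition poly_koszul_h v : W :=
  [ffun K : {set 'I_m} => \sum_(i in K) (-1) ^+ eps i K * (v (K :\ i))^`M(i)].

(* The Euler homotopy: d h + h d multiplies a term of weight n by n. *)
Lemma poly_koszul_homotopy v K a :
  ((poly_koszul_d (poly_koszul_h v)) K + (poly_koszul_h (poly_koszul_d v)) K)@_a =
    (mdeg a + #|K|)%:R * (v K)@_a.
Proof.
have signK (b : bool) (p : R) : (-1) ^+ b * ((-1) ^+ b * p) = p.
  by rewrite mulrA -expr2 sqrr_sign mul1r.
(* [X] gathers the mixed terms, with [i] outside and [j] inside [K]. They occur in both composites,
   with opposite signs by anticommutation. *)
pose X := \sum_(i | i \notin K) \sum_(j in K)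
  (-1) ^+ (eps i (i |: K) (+) eps j (i |: K)) * ((v ((i |: K) :\ j))^`M(j) * 'X_i).
have E1 : poly_koszul_d (poly_koszul_h v) K =
    \sum_(i | i \notin K) (v K)^`M(i) * 'X_i + X.
  rewrite ffunE -big_split; apply: eq_bigr => i iK /=.
  rewrite ffunE big_setU1//= mulrDl mulrDr finset.setU1K// -mulrA signK; congr (_ + _).
  rewrite mulr_suml mulr_sumr; apply: eq_bigr => j jK.
  by rewrite signr_addb !mulrA.
have E2 : poly_koszul_h (poly_koszul_d v) K =
    \sum_(i in K) (v K)^`M(i) * 'X_i + v K *+ #|K| - X.
  rewrite ffunE -sumr_const /X exchange_big -sumrN -!big_split; apply: eq_bigr => j jK /=.
  rewrite ffunE (bigD1 j) ?inE ?eqxx//= mderivD mulrDr finset.setD1K//.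
  have ds (b : bool) (p : R) : ((-1) ^+ b * p)^`M(j) = (-1) ^+ b * p^`M(j).
    by case: b; rewrite ?expr1 ?expr0 ?mul1r ?mulN1r// mderivN.
  rewrite ds signK deriv_mulX eqxx; congr (_ + _).
  rewrite raddf_sum mulr_sumr -sumrN /=; apply: eq_big => [i|i].
    by rewrite !inE negb_and negbK; case: (eqVneq i j) => [->|]; rewrite /= ?jK ?andbF ?andbT.
  rewrite !inE => /andP[iK ij]; move: iK; rewrite ij /= => iK.
  have iK' : i |: K :\ j = (i |: K) :\ j.
    by apply/finset.setP => l; rewrite !inE; case: (eqVneq l i) => [->|]; rewrite /= ?ij.
  rewrite ds deriv_mulX eq_sym (negbTE ij) addr0 iK' mulrA -signr_addb.
  have := eps_anti (setU11 i K) (setU1r i jK) ij; rewrite finset.setU1K//.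
  rewrite -mulNr -signrN => an; congr ((-1) ^+ _ * _); move: an.
  by do 4!case: (eps _ _).
rewrite E1 E2 addrACA subrr addr0 addrA [X in (X + _)@_a](_ : _ = \sum_i (v K)^`M(i) * 'X_i).
  rewrite mcoeffD mcoeffMn natrD mulrDl !mulr_natl; congr (_ + _).
  rewrite raddf_sum mdegE -sumrMnr; apply: eq_bigr => i _ /=.
  by rewrite mulX_deriv scale_coefE mulr_natl.
by rewrite [RHS](bigID (mem K)) /= addrC.
Qed.

Lemma poly_koszul_exact v : poly_koszul_d v = 0 -> exists (c : k) (u : W),
  v = [ffun K => if K == finset.set0 then c%:MP else 0] + poly_koszul_d u.
Proof.
(* The homotopy is divided by the weight. Weight 0 occurs only for the constant term at the empty
   set; there [invr0] gives 0, and that constant is what remains. *)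
move=> dv; pose wt (n : nat) (a : 'X_{1..m}) : k := (mdeg a + n)%:R^-1.
pose u : W := [ffun K : {set 'I_m} => scale_coef (wt #|K|) (poly_koszul_h v K)].
exists (v finset.set0)@_0%MM, u; apply/ffunP => K; rewrite !ffunE; apply/mpolyP => a.
(* Division by the weight commutes with the differential, which trades an element of the set for a
   factor [X_i]. *)
have -> : \sum_(i | i \notin K) (-1) ^+ eps i (i |: K) * (u (i |: K) * 'X_i) =
    scale_coef (wt #|K|) (poly_koszul_d (poly_koszul_h v) K).
  rewrite ffunE (big_morph _ (scale_coefD (wt #|K|)) (id1 := 0)); last first.
    exact: morphD0 (scale_coefD _).
  apply: eq_bigr => i iK; rewrite ffunE cardsU1 iK.
  rewrite (scale_coef_mulX (g := wt #|K|)).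
    case: (eps i _); rewrite ?expr1 ?expr0 ?mul1r ?mulN1r//.
    by rewrite (morphDN (scale_coefD _)).
  by move=> b; rewrite /wt mdegD mdeg1 addnA.
rewrite mcoeffD scale_coefE.
have := poly_koszul_homotopy v K a; rewrite dv.
have -> : poly_koszul_h 0 K = 0.
  by rewrite ffunE big1// => i _; rewrite ffunE mderiv0 mulr0.
rewrite addr0 => ->; rewrite mulrA /wt.
have [n0|n0] := eqVneq (mdeg a + #|K|)%N 0%N.
  move: n0 => /eqP; rewrite addn_eq0 mdeg_eq0 cards_eq0 => /andP[/eqP -> /eqP ->].
  by rewrite eqxx mcoeffC eqxx mulr1 mdeg0 cards0 invr0 !mul0r addr0.
rewrite mulVf ?mul1r; last by rewrite ((pcharf0P k).1 k_char0).
case: eqP => [K0|_]; last by rewrite mcoeff0 add0r.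
rewrite mcoeffC; case: eqP => [a0|_]; last by rewrite mulr0 add0r.
by rewrite K0 a0 mdeg0 cards0 in n0.
Qed.

End PolynomialKoszul.

Section PolynomialCohomology.
Variables (k : fieldType) (B : dgAlgebra k) (m : nat) (y : 'I_m -> B).
Hypotheses (y_homog : forall i, homogeneous (dga_gr B) 1 (y i))
  (y_cocycle : forall i, dga_d (y i) = 0)
  (y_central : forall i x, y i * x = x * y i).
Local Notation gr := (dga_gr B).
Local Notation R := {mpoly k[m]}.
Local Notation ev := (mmap (in_alg B) y).

Lemma homog_prod (I : Type) (s : seq I) (f : I -> B) (n : I -> nat) :
  (forall i, homogeneous gr (n i)%:Z (f i)) ->
  homogeneous gr (\sum_(i <- s) n i)%N%:Z (\prod_(i <- s) f i).
Proof.
move=> fn; elim: s => [|i s IH]; first by rewrite !big_nil; exact: dga_1.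
by rewrite !big_cons PoszD; exact: dga_mul.
Qed.

Lemma homog_exp (x : B) i n : homogeneous gr i%:Z x -> homogeneous gr (n * i)%N%:Z (x ^+ n).
Proof.
move=> hx; elim: n => [|n IH]; first by rewrite expr0; exact: dga_1.
by rewrite exprS mulSn PoszD; exact: dga_mul.
Qed.

Lemma mmap1_homog a : homogeneous gr (mdeg a)%:Z (mmap1 y a).
Proof.
rewrite mdegE; apply: homog_prod => i.
by have := homog_exp (i := 1%N) (a i) (y_homog i); rewrite muln1.
Qed.

Lemma mmap1_mulX a i : mmap1 y (a + U_(i))%MM = mmap1 y a * y i.
Proof. by rewrite commr_mmap1_M ?mmap1U// => j x; exact: esym (y_central j x). Qed.

Lemma ev_coef c a : ev (c *: 'X_[a]) = c *: mmap1 y a.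
Proof. by rewrite mmapZ mmapX /= -scalerAl mul1r. Qed.

Lemma dga_d_mmap1 a : dga_d (mmap1 y a) = 0.
Proof.
have dM (u v : B) : dga_d u = 0 -> dga_d v = 0 -> dga_d (u * v) = 0.
  by move=> du dv; rewrite dga_leibniz_twist du dv mul0r mulr0 addr0.
rewrite /mmap1; elim/big_ind: _ => [|u v|i _]; [exact: dga_d1|exact: dM|].
by elim: (a i) => [|n IH]; rewrite ?expr0 ?dga_d1// exprS dM.
Qed.

(** As ['C(n.+1, 2) = 'C(n, 2) + n], passing from degree [n] to [n + 1] multiplies the sign by
    [(-1)^n]. *)
Definition degree_sign (a : 'X_{1..m}) : k := (-1) ^+ 'C(mdeg a, 2).

(* The signs turn multiplication by X_i into x |-> (-1)^|x| x y_i. *)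
Definition signed_ev (p : R) : B := ev (scale_coef degree_sign p).

Lemma signed_evD : {morph signed_ev : p q / p + q}.
Proof. by move=> p q; rewrite /signed_ev scale_coefD mmapD. Qed.

Lemma degree_signK p : scale_coef degree_sign (scale_coef degree_sign p) = p.
Proof.
by apply/mpolyP => a; rewrite !scale_coefE mulrA -expr2 sqrr_sign mul1r.
Qed.

Lemma signed_evX c a : signed_ev (c *: 'X_[a]) = (c * degree_sign a) *: mmap1 y a.
Proof. by rewrite /signed_ev scale_coefZ scale_coefX scalerA ev_coef. Qed.

Lemma signed_evC c : signed_ev c%:MP = c%:A.
Proof.
rewrite -alg_mpolyC -mpolyX0 signed_evX /degree_sign mdeg0 mmap11.
by rewrite bin0n expr0 mulr1.
Qed.

Lemma dga_d_signed_ev p : dga_d (signed_ev p) = 0.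
Proof.
move: p; apply: (@mpoly_ext _ _ B (fun p => dga_d (signed_ev p)) (fun=> 0)) => [p q|p q|c a].
- by rewrite signed_evD dga_dD.
- by rewrite addr0.
by rewrite signed_evX dga_dZ dga_d_mmap1 scaler0.
Qed.

Lemma signed_ev_mulX p i : signed_ev (p * 'X_i) = twist gr 1 (signed_ev p) * y i.
Proof.
move: p; apply: mpoly_ext => [p q|p q|c a].
- by rewrite mulrDl signed_evD.
- by rewrite signed_evD twistD mulrDl.
rewrite -scalerAl -mpolyXD !signed_evX twistZ (twist_homog _ (mmap1_homog a)) mmap1_mulX.
rewrite -scalerAl ksignMl -[LHS]scalerA -[RHS]scalerA; congr (_ *: _).
rewrite /degree_sign mdegD mdeg1 addn1 binS bin1 exprD mulr1 -[LHS]scalerA; congr (_ *: _).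
by rewrite /ksign /= -signr_odd; case: odd; rewrite ?expr1 ?expr0 ?scaleN1r ?scale1r.
Qed.

Hypothesis Hpoly : polynomial_cohomology y.

Lemma signed_ev_surj z : dga_d z = 0 -> exists p w, z = signed_ev p + dga_d w.
Proof.
move=> /Hpoly.1[p [w ->]]; exists (scale_coef degree_sign p), w.
by rewrite /signed_ev degree_signK.
Qed.

Lemma signed_ev_inj p w : signed_ev p = dga_d w -> p = 0.
Proof.
move=> /Hpoly.2 p0; rewrite -[p]degree_signK p0.
by apply/mpolyP => a; rewrite scale_coefE mcoeff0 mulr0.
Qed.

End PolynomialCohomology.

Section KoszulCocycles.
Variables (k : fieldType) (k_char0 : [pchar k] =i pred0) (B : dgAlgebra k) (m : nat).
Variables (eps : 'I_m -> {set 'I_m} -> bool) (eps_anti : anticommuting eps).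
Variable (w : bool -> 'I_m -> B).
Hypotheses (w_homog : forall b i, homogeneous (dga_gr B) 1 (w b i))
  (w_cocycle : forall b i, dga_d (w b i) = 0)
  (w_sym : forall b i j, w b i * w (~~ b) j = w b j * w (~~ b) i).
Local Notation R := {mpoly k[m]}.
Variable phi : R -> B.
Hypotheses (phiD : {morph phi : p q / p + q}) (phiC : forall c, phi c%:MP = c%:A)
  (dphi : forall p, dga_d (phi p) = 0)
  (phi_mulX : forall b p i, phi (p * 'X_i) = twist (dga_gr B) 1 (phi p) * w b i)
  (phi_surj : forall z, dga_d z = 0 -> exists p u, z = phi p + dga_d u)
  (phi_inj : forall p u, phi p = dga_d u -> p = 0).
Local Notation KM := (koszulMod k_char0 eps_anti w_homog w_cocycle w_sym).
Local Notation e0 := (free_e (koszul_mx_homog eps w_homog) (koszul_mx_cocycle eps w_cocycle)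
  (koszul_mx_sqr k_char0 eps_anti w_sym) finset.set0).

(** The map [phi] need not be multiplicative: additivity and [phi_mulX], which matches
    multiplication by [X_i] with the signed right multiplication of the differential, suffice to
    intertwine the two complexes. *)
Lemma koszul_cocycle (v : KM) : dgm_d v = 0 -> exists (c : k) (u : KM),
  v = c%:A *: e0 + dgm_d u.
Proof.
move=> dv; pose DU := @poly_koszul_d k m eps.
pose DV (v : {ffun {set 'I_m} -> B}) : {ffun {set 'I_m} -> B} := dgm_d (v : KM).
pose Phi (u : {ffun {set 'I_m} -> R}) : {ffun {set 'I_m} -> B} := [ffun K => phi (u K)].
have phi0 : phi 0 = 0 := morphD0 phiD.
have phiN p : phi (- p) = - phi p := morphDN phiD p.
have DUD : {morph DU : u v / u + v}.
  move=> u1 u2; apply/ffunP => K; rewrite !ffunE -big_split; apply: eq_bigr => i _.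
  by rewrite ffunE mulrDl mulrDr.
have DVD : {morph DV : u v / u + v} by exact: (@dgm_dD _ _ KM).
have PhiDU u : Phi (DU u) = DV (Phi u).
  apply/ffunP => K; rewrite [RHS](koszul_dE (Phi u : KM)) !ffunE dphi add0r.
  rewrite (big_morph phi phiD phi0); apply: eq_bigr => i _.
  rewrite ffunE -phi_mulX; case: (eps i _); rewrite ?expr1 ?expr0 ?mul1r ?mulN1r//.
have DVV v1 : DV (DV v1) = 0 by exact: (@dgm_dd _ _ KM).
(* Inherited from the Koszul module through the injectivity of [phi]. *)
have DUU u : DU (DU u) = 0.
  apply/ffunP => K; rewrite [RHS]ffunE; apply: (phi_inj (u := 0)).
  have /ffunP/(_ K) : Phi (DU (DU u)) = 0 by rewrite !PhiDU.
  by rewrite !ffunE (morphD0 (@dga_dD k B)).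
have [||z _] := @filtered_comparison _ _ _ (fun K : {set 'I_m} => #|K|) (@dga_d k B) phi
  DU DV (@dga_dD k B) phiD DUD DVD phi_surj phi_inj DUU DVV PhiDU _ _ m.+1.
- move=> n u hu K nK; rewrite ffunE big1// => i iK.
  by rewrite hu ?mul0r ?mulr0// cardsU1 iK.
- move=> n v1 K hv nK; rewrite [LHS](koszul_dE (v1 : KM)) big1 ?addr0// => i iK.
  by rewrite hv ?(morphD0 (twistD _ _)) ?mul0r ?mulr0// cardsU1 iK.
have [|u [u1 [_ _ du vE]]] := z v _ dv.
  by move=> K; rewrite ltnNge (leq_trans (max_card _)) ?card_ord.
have [c [u2 uE]] := poly_koszul_exact k_char0 eps_anti du.
exists c, (Phi u2 + u1 : {ffun {set 'I_m} -> B}).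
rewrite dgm_dD addrA [LHS]vE; congr (_ + _).
rewrite -[dgm_d _]/(DV (Phi u2)) -PhiDU -/DU uE.
apply/ffunP => K; rewrite !ffunE phiD; congr (_ + _).
case: (K == _); [rewrite phiC; exact: esym (mulr1 (c%:A : B))|
  rewrite phi0; exact: esym (mulr0 (c%:A : B))].
Qed.

End KoszulCocycles.

(** * Contracting homotopies over a field *)

Lemma kernel_complement (k : fieldType) (W : lmodType k) (D : W -> W) : linear D ->
  exists P : W -> W, [/\ linear P, forall x, D (P x) = D x & forall x, D x = 0 -> P x = 0].
Proof.
move=> Dl; have DD := linD Dl; have DZ := linZ Dl; have D0 := morphD0 DD.
(* [P] will be the projection along the kernel of [D] onto a subspace maximal among those that meet
   this kernel trivially. *)
pose sub (S : set W) := forall c x y, S x -> S y -> S (c *: x + y).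
pose Q (S : set W) := sub S /\ forall x, S x -> D x = 0 -> x = 0.
have [C CQ Ctot|S [[Ssub S1] Smax]] := @Zorn_bigcup W Q.
  split=> [c x y [X CX Xx] [Y CY Yy]|x [X CX Xx]]; last exact: (CQ _ CX).2.
  have [XY|YX] := Ctot _ _ CX CY.
    by exists Y => //=; apply: (CQ _ CY).1 => //; exact: XY.
  by exists X => //=; apply: (CQ _ CX).1 => //; exact: YX.
(* The empty set satisfies [Q], so that [S] contains 0 has to be drawn from maximality. *)
have S0 : S 0.
  apply: contrapT => nS0; apply: (Smax (S `|` [set 0])%classic).
    split; first by move=> x Sx; left.
    by move=> /(_ 0 (or_intror erefl)).
  split=> [c x y|x [/S1//|/= ->//]].
  move=> [Sx|/= ->] [Sy|/= ->].
  - by left; exact: Ssub.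
  - exfalso; apply: nS0.
    by have := Ssub (-1) _ _ Sx Sx; rewrite scaleN1r addNr.
  - by left; rewrite scaler0 add0r.
  - by right; rewrite /= scaler0 addr0.
have SZ c x : S x -> S (c *: x) by move=> Sx; rewrite -[_ *: _]addr0; exact: Ssub.
have ex x : exists s, S s /\ D s = D x.
  apply: contrapT => nex.
  pose S' : set W := [set z | exists2 s, S s & exists a : k, z = s + a *: x]%classic.
  apply: (Smax S').
    split; first by move=> s Ss; exists s => //; exists 0; rewrite scale0r addr0.
    move=> /(_ x) h; apply: nex; exists x; split=> //; apply: h.
    by exists 0 => //; exists 1; rewrite scale1r add0r.
  split=> [c _ _ [s Ss [a ->]] [t St [a' ->]]|_ [s Ss [a ->]]].
    exists (c *: s + t); first exact: Ssub.
    by exists (c * a + a'); rewrite scalerDr scalerDl scalerA addrACA.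
  have [->|a0] := eqVneq a 0; first by rewrite scale0r addr0; exact: S1.
  rewrite DD DZ => /eqP; rewrite addr_eq0 => /eqP Ds; exfalso; apply: nex.
  exists ((- a^-1) *: s); split; first exact: SZ.
  by rewrite DZ Ds scalerN scaleNr opprK scalerA mulVf// scale1r.
pose P x := projT1 (cid (ex x)).
have SP x : S (P x) by rewrite /P; case: cid => s [].
have DP x : D (P x) = D x by rewrite /P; case: cid => s [].
have uni s t : S s -> S t -> D s = D t -> s = t.
  move=> Ss St st; apply/eqP; rewrite -subr_eq0 -scaleN1r addrC; apply/eqP.
  by apply: S1; [exact: Ssub|rewrite DD DZ st scaleN1r addNr].
exists P; split=> // [c x y|x Dx].
  by apply: uni; [exact: SP|exact: Ssub|rewrite !(DD, DZ) !DP DD DZ].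
by apply: S1; rewrite ?DP.
Qed.

Section Contraction.
Variables (k : fieldType) (W : lmodType k) (G : grading W) (D : W -> W) (e : W).
Hypotheses (GZ : forall i, scalable (G i)) (Dl : linear D) (DD : forall x, D (D x) = 0)
  (D_homog : forall i x, homogeneous G i x -> homogeneous G (i + 1) (D x))
  (e_homog : homogeneous G 0 e)
  (e_not_boundary : forall c x, c *: e = D x -> c = 0)
  (D_exact : forall x, D x = 0 -> exists c y, x = c *: e + D y).

(** The cocycle [x - P x] is of the form [c e + D y], with [c] unique as no nonzero multiple of [e]
    bounds. Then [H x = P y] does not depend on [y], since [P y] depends only on [D y]; it satisfies
    [D H x = x - P x - c e] and [H D x = P x]. *)
Lemma contraction : exists H : W -> W, [/\ linear H,
  forall i x, homogeneous G i x -> homogeneous G (i - 1) (H x) &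
  forall i x, homogeneous G i x -> exists c, D (H x) + H (D x) = x - c *: e].
Proof.
have Dadd := linD Dl; have D0 := morphD0 Dadd; have DB x y : D (x - y) = D x - D y.
  by rewrite Dadd (morphDN Dadd).
have [P [Pl DP P0]] := kernel_complement Dl.
have Padd := linD Pl.
have PE x y : D x = D y -> P x = P y.
  move=> xy; apply/eqP; rewrite -subr_eq0 -(morphDN Padd) -Padd P0 ?DB ?xy ?subrr//.
have ex x : exists cy : k * W, x - P x = cy.1 *: e + D cy.2.
  have [|c [y xE]] := D_exact (x := x - P x); first by rewrite DB DP subrr.
  by exists (c, y).
pose f x := projT1 (cid (ex x)).
have fE x : x - P x = (f x).1 *: e + D (f x).2 by rewrite /f; case: cid.
pose H0 x := P (f x).2.
have H0E x c y : x - P x = c *: e + D y -> H0 x = P y.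
  rewrite fE => xE; apply: PE.
  have cE : (f x).1 - c = 0.
    apply: (e_not_boundary (x := y - (f x).2)).
    rewrite scalerBl DB; apply/eqP; rewrite subr_eq addrAC eq_sym subr_eq eq_sym.
    by rewrite xE addrC.
  by move: xE; rewrite -[(f x).1](subrK c) cE add0r => /addrI.
have H0l : linear H0.
  move=> c x y; rewrite (H0E (c *: x + y) (c * (f x).1 + (f y).1) (c *: (f x).2 + (f y).2)) ?Pl//.
  by rewrite Dl opprD addrACA -scalerBr !fE scalerDl scalerDr scalerA addrACA.
have H0add := linD H0l.
have H0D x : H0 (D x) = P x by apply: (H0E _ 0); rewrite scale0r add0r P0// subr0.
have DH0 x : D (H0 x) = x - P x - (f x).1 *: e by rewrite DP fE addrC addKr.
(* [P] ignores the grading. Keeping only the component of degree -1 of [H0] preserves the homotopy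
   identity, [D] being homogeneous. *)
pose g i z := G (i - 1) (H0 z).
have gD i : {morph g i : x y / x + y} by move=> x y; rewrite /g H0add compD.
have HE i x : homogeneous G i x -> gsum G g x = G (i - 1) (H0 x).
  by move=> hx; rewrite (gsum_homog gD hx).
have GD i x : G (i + 1) (D x) = D (G i x).
  move: x; apply: (grext (G := G)) => [x y|x y|j x hx].
  - by rewrite Dadd compD.
  - by rewrite compD Dadd.
  rewrite (Defs.compE _ (D_homog hx)) (Defs.compE _ hx) (inj_eq (addIr _)).
  by case: (i == j).
exists (gsum G g); split=> [c x y|i x hx|i x hx].
- rewrite (gsumD G gD); congr (_ + _).
  move: x; apply: (grextZ (G := G)) => [x z|x z|i x hx].
  + by rewrite scalerDr (gsumD G gD).
  + exact: (gsumD G gD).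
  by rewrite (HE i) ?(HE i x hx) ?(linZ H0l) ?GZ// /homogeneous GZ hx.
- by rewrite (HE _ _ hx); exact: homog_comp.
rewrite (HE _ _ hx) (HE _ _ (D_homog hx)) -GD subrK addrK -compD DH0 H0D.
rewrite addrAC subrK (compD G) (morphDN (compD G i)) hx GZ (Defs.compE _ e_homog).
by case: (i == 0); [exists (f x).1|exists 0; rewrite scaler0 scale0r].
Qed.

End Contraction.

(** * Twisted tensor products *)

Section BoxProduct.
Variables (k : fieldType) (U V : lmodType k) (T : finType).
Local Notation W := {ffun T -> U}.
Local Notation X := {ffun T -> tens U V}.

(** The pure tensors of [W (x) V], which is encoded as functions into [U (x) V] since [T] is
    finite. *)
Definition box (u : W) (b : V) : X := [ffun t => tpure (u t) b].

Lemma boxDl b : {morph box^~ b : u v / u + v}.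
Proof. by move=> u v; apply/ffunP => t; rewrite !ffunE (bilinDl (tpure_bilin _ _)). Qed.

Lemma boxDr u : {morph box u : b c / b + c}.
Proof. by move=> b c; apply/ffunP => t; rewrite !ffunE (bilinDr (tpure_bilin _ _)). Qed.

Lemma boxZ c u b : box (c *: u) b = box u (c *: b).
Proof.
apply/ffunP => t; rewrite !ffunE (bilinZr (tpure_bilin _ _)).
exact: (bilinZl (tpure_bilin _ _)).
Qed.

Lemma box_ind (P : X -> Prop) : P 0 -> (forall x y, P x -> P y -> P (x + y)) ->
  (forall u b, P (box u b)) -> forall x, P x.
Proof.
move=> P0 PD Pb x.
pose one t (a : tens U V) : X := [ffun s => if s == t then a else 0].
have -> : x = \sum_t one t (x t).
  apply/ffunP => s; rewrite sum_ffunE (bigD1 s)//= big1 => [|t ts]; rewrite !ffunE.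
    by rewrite eqxx addr0.
  by rewrite eq_sym (negbTE ts).
elim/big_ind: _ => // t _; have [s ->] := tens_sum (x t).
have oneD : {morph one t : a b / a + b}.
  by move=> a b; apply/ffunP => r; rewrite !ffunE; case: (r == t); rewrite ?addr0.
rewrite (morphDsum oneD); elim/big_ind: _ => // -[a b] _ /=.
rewrite [one _ _](_ : _ = box [ffun s => if s == t then a else 0] b)//.
apply/ffunP => r; rewrite !ffunE; case: (r == t) => //.
by rewrite (bilin0l (tpure_bilin _ _)).
Qed.

(** This is [H (x) 1]. It is assembled from the matrix entries of [H], because the universal
    property applies to one coordinate at a time. *)
Lemma box_map (H : W -> W) : linear H ->
  exists Hx : X -> X, {morph Hx : x y / x + y} /\ forall u b, Hx (box u b) = box (H u) b.
Proof.
move=> Hl; have HD := linD Hl; have HZ := linZ Hl.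
pose one s a : W := [ffun r => if r == s then a else 0].
have oneD s : {morph one s : a b / a + b}.
  by move=> a b; apply/ffunP => r; rewrite !ffunE; case: (r == s); rewrite ?addr0.
have oneZ s c a : one s (c *: a) = c *: one s a.
  by apply/ffunP => r; rewrite !ffunE; case: (r == s); rewrite ?scaler0.
pose bl s t a (b : V) := tpure (H (one s a) t) b.
have bb s t : bilin (bl s t).
  apply: bilinP => [b x y|a x y|c a b|c a b]; rewrite /bl.
  - by rewrite oneD HD ffunE (bilinDl (tpure_bilin _ _)).
  - exact: bilinDr (tpure_bilin _ _) _ _ _.
  - by rewrite oneZ HZ ffunE; exact: (bilinZl (tpure_bilin _ _)).
  - exact: (bilinZr (tpure_bilin _ _)).
exists (fun x => [ffun t => \sum_s tlift (bl s t) (x s)]); split=> [x y|u b].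
  apply/ffunP => t; rewrite !ffunE -big_split; apply: eq_bigr => s _.
  by rewrite ffunE (tliftD (bb s t)).
apply/ffunP => t; rewrite !ffunE.
under eq_bigr do rewrite ffunE (tlift_pure _ _ (bb _ _)).
rewrite /bl -(bilin_suml (tpure_bilin _ _)); congr tpure.
suff -> : H u = \sum_s H (one s (u s)) by rewrite sum_ffunE.
rewrite -(morphDsum HD); congr H.
apply/ffunP => s; rewrite sum_ffunE (bigD1 s)//= big1 => [|t' ts]; rewrite !ffunE.
  by rewrite eqxx addr0.
by rewrite eq_sym (negbTE ts).
Qed.

End BoxProduct.

Section TwistedTensor.
Variables (k : fieldType) (U V : lmodType k) (T : finType) (J : finType).
Local Notation W := {ffun T -> U}.
Local Notation X := {ffun T -> tens U V}.
Variables (G : grading W) (D H : W -> W) (e : W).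
Variables (dV : V -> V) (iota : J -> W -> W) (r : J -> V -> V) (DX : X -> X).
Hypotheses (G_ge0 : forall i u, i < 0 -> homogeneous G i u -> u = 0)
  (e_homog : homogeneous G 0 e)
  (Hl : linear H) (H_homog : forall i u, homogeneous G i u -> homogeneous G (i - 1) (H u))
  (DH : forall i u, homogeneous G i u -> exists c, D (H u) + H (D u) = u - c *: e)
  (iota_homog : forall j i u, homogeneous G i u -> homogeneous G i (iota j u))
  (DXD : {morph DX : x y / x + y}) (DXX : forall x, DX (DX x) = 0)
  (DX_box : forall i u b, homogeneous G i u -> DX (box u b) =
     box (D u) b + ksign i (box u (dV b) + \sum_j box (iota j u) (r j b))).

(** The filtration by the degree of the first factor; its step 0 vanishes by [G_ge0]. *)
Let low (n : nat) (x : X) := exists s : seq (W * V),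
  (forall p, p \in s -> exists2 i : int, i < n%:Z & homogeneous G i p.1) /\
  x = \sum_(p <- s) box p.1 p.2.

Let low0 n : low n 0.
Proof. by exists [::]; rewrite big_nil. Qed.

Let lowD n x y : low n x -> low n y -> low n (x + y).
Proof.
move=> [s [sP ->]] [t [tP ->]]; exists (s ++ t); rewrite big_cat; split=> // p.
by rewrite mem_cat => /orP[/sP|/tP].
Qed.

Let low_box n i u b : i < n%:Z -> homogeneous G i u -> low n (box u b).
Proof.
move=> ilt hu; exists [:: (u, b)]; rewrite big_seq1; split=> // p.
by rewrite inE => /eqP ->; exists i.
Qed.

Let low_ksign n i x : low n x -> low n (ksign i x).
Proof.
move=> [s [sP ->]]; exists [seq (p.1, ksign i p.2) | p <- s]; split.
  by move=> _ /mapP[p /sP h ->].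
rewrite big_map (morphDsum (ksignD i)); apply: eq_bigr => p _.
by rewrite (ksign_morph i _ (boxDr p.1)).
Qed.

Let low_mono n n' x : (n <= n')%N -> low n x -> low n' x.
Proof.
move=> nn [s [sP ->]]; exists s; split=> // p /sP[i ilt hi]; exists i => //.
by apply: lt_le_trans ilt _; rewrite lez_nat.
Qed.

Let low_ex x : exists n, low n x.
Proof.
move: x; apply: box_ind => [|x y [n xn] [n' yn]|u b].
- by exists 0%N.
- exists (maxn n n'); apply: lowD.
    exact: low_mono (leq_maxl _ _) xn.
  exact: low_mono (leq_maxr _ _) yn.
have [s _ ->] := comp_sum G u; rewrite (morphDsum (boxDl b)).
elim/big_ind: _ => [|x y [n xn] [n' yn]|i _]; first by exists 0%N.
- exists (maxn n n'); apply: lowD.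
    exact: low_mono (leq_maxl _ _) xn.
  exact: low_mono (leq_maxr _ _) yn.
exists `|i|.+1%N; apply: low_box (homog_comp G i u); lia.
Qed.

(* The homotopy H (x) 1 contracts X onto e (x) V up to terms of lower degree in
   the first factor, so cocycles can be pushed down degree by degree. *)
Lemma twisted_tensor_cocycle x : DX x = 0 -> exists b y, x = box e b + DX y.
Proof.
have [Hx [HxD HxE]] := box_map V Hl.
have main n z : low n.+1 z -> exists b, low n (DX (Hx z) + Hx (DX z) - z + box e b).
  move=> [s [sP ->]]; elim: s sP => [|[u b] s IH] sP.
    exists 0; rewrite big_nil (morphD0 HxD) (morphD0 DXD) (morphD0 HxD) (morphD0 (boxDr e)).
    by rewrite subr0 !addr0; exact: low0.
  have [|b1 IH1] := IH; first by move=> p ps; apply: sP; rewrite inE ps orbT.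
  have [/= i ilt hu] := sP (u, b) (mem_head _ _).
  have [c cE] := DH hu.
  exists (c *: b + b1); rewrite big_cons /= !(DXD, HxD).
  set S := \sum_(p <- s) _ in IH1 *.
  rewrite [X in low n X](_ : _ =
     (DX (Hx (box u b)) + Hx (DX (box u b)) - box u b + box e (c *: b)) +
     (DX (Hx S) + Hx (DX S) - S + box e b1)); last first.
    by rewrite boxDr opprD !addrA [LHS](ACl (1*3*5*7*2*4*6*8)%AC).
  apply: lowD => //; rewrite HxE (DX_box _ (H_homog hu)) (DX_box _ hu) HxD HxE.
  rewrite (ksign_morph i _ HxD) HxD HxE (morphDsum HxD).
  have -> : ksign (i - 1) (box (H u) (dV b) + \sum_j box (iota j (H u)) (r j b)) =
     - ksign i (box (H u) (dV b) + \sum_j box (iota j (H u)) (r j b)).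
    by rewrite /ksign oddzD /=; case: (odd _); rewrite /= ?opprK.
  rewrite addrACA -boxDl cE boxDl (morphDN (boxDl b)) boxZ.
  set A := box (H u) (dV b).
  (* The terms in [dV] cancel. Those in [iota] survive, but [iota] keeps the degree and [H] lowers
     it by one. *)
  rewrite [X in low n X](_ : _ = ksign i (\sum_j box (H (iota j u)) (r j b)) +
      ksign (i + 1) (\sum_j box (iota j (H u)) (r j b))); last first.
    rewrite (eq_bigr _ (fun j _ => HxE (iota j u) (r j b))).
    have -> : forall y : X, ksign (i + 1) y = - ksign i y.
      by move=> y; rewrite /ksign oddzD /=; case: (odd _); rewrite ?opprK.
    rewrite !ksignD opprD !addrA [LHS](ACl ((1*7)*(2*8)*(3*5)*6*4)%AC) /=.
    by rewrite subrr addNr addNr !add0r.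
  have low_sum (F : J -> W) : (forall j, homogeneous G (i - 1) (F j)) ->
      low n (\sum_j box (F j) (r j b)).
    move=> hF; elim/big_ind: _ => [|z1 z2|j _]; [exact: low0|exact: lowD|].
    by apply: (low_box _ _ (hF j)); lia.
  apply: lowD; apply: low_ksign; apply: low_sum => j; first exact: H_homog (iota_homog _ hu).
  exact: iota_homog (H_homog hu).
have [n xn] := low_ex x; elim: n x xn => [|n IH] x xn dx.
  exists 0, 0; rewrite (morphD0 (boxDr e)) (morphD0 DXD) addr0.
  have [s [sP ->]] := xn; rewrite big_seq big1// => p /sP[i ilt hi].
  by rewrite (G_ge0 ilt hi) (morphD0 (boxDl _)).
have [b hb] := main n x xn.
have x1E : low n (DX (Hx x) - x + box e b).
  by move: hb; rewrite dx (morphD0 HxD) addr0.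
(* Induction is applied to [DX (Hx x) - x], a cocycle, rather than with [box e b] added, which may
   not be one. As [e] has degree 0, this stays in filtration [n.+1] but not in filtration 0: the
   last step is separate. *)
case: n => [|n] in IH xn hb x1E *.
  exists b, (Hx x); have [s [sP sE]] := x1E.
  have : DX (Hx x) - x + box e b = 0.
    rewrite sE big_seq big1// => p /sP[i ilt hi].
    by rewrite (G_ge0 ilt hi) (morphD0 (boxDl _)).
  by move/eqP; rewrite addrAC subr_eq0 addrC => /eqP.
have low_e : low n.+1 (box e (- b)) by apply: low_box e_homog.
have [||b1 [y yE]] := IH (DX (Hx x) - x).
- by have := lowD x1E low_e; rewrite -addrA -boxDr subrr (morphD0 (boxDr e)) addr0.
- by rewrite DXD (morphDN DXD) DXX dx subr0.
exists (- b1), (Hx x - y).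
rewrite DXD (morphDN DXD) (morphDN (boxDr e)).
have xE : x = DX (Hx x) - (DX (Hx x) - x) by rewrite opprB addrC subrK.
by rewrite [LHS]xE yE opprD addrCA.
Qed.

End TwistedTensor.

(** The sign of the differential cancels that of the opposite product. Over the opposite algebra,
    plain evaluation of polynomials is thus compatible with the Koszul differential. *)
Lemma opmul_twist1 (k : fieldType) (B : dgAlgebra k) (v w : B) :
  homogeneous (dga_gr B) 1 w -> opmul B (twist (dga_gr B) 1 v) w = w * v.
Proof.
move=> hw; move: v; apply: (grext (G := dga_gr B)) => [u v|u v|i v hv].
- by rewrite twistD opmulDl.
- exact: mulrDr.
rewrite (twist_homog _ hv) (opmul_homog (homog_ksign _ hv) hw) ksignMr ksign_comp.
by rewrite /ksign oddzD addbb.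
Qed.

Lemma opDGA_connected (k : fieldType) (A : dgAlgebra k) : connected A -> connected (opDGA A).
Proof. by move=> [A0 A1]; split=> [i a|a]; [exact: A0|exact: A1]. Qed.

Section Evaluation.
Variables (k : fieldType) (B : dgAlgebra k) (m : nat) (y : 'I_m -> B).
Hypotheses (y_homog : forall i, homogeneous (dga_gr B) 1 (y i))
  (y_central : forall i x, y i * x = x * y i).

Lemma mmap_mulX p i : mmap (in_alg B) y (p * 'X_i) = y i * mmap (in_alg B) y p.
Proof.
move: p; apply: mpoly_ext => [p q|p q|c a].
- by rewrite mulrDl mmapD.
- by rewrite mmapD mulrDr.
by rewrite -scalerAl -mpolyXD !ev_coef mmap1_mulX// -scalerAr y_central.
Qed.

Lemma mmap_cocycle p : (forall i, dga_d (y i) = 0) -> dga_d (mmap (in_alg B) y p) = 0.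
Proof.
move=> dy; move: p.
have ext := @mpoly_ext _ _ B (fun p => dga_d (mmap (in_alg B) y p)) (fun=> 0).
apply: ext => [p q|p q|c a].
- by rewrite mmapD dga_dD.
- by rewrite addr0.
by rewrite ev_coef dga_dZ dga_d_mmap1 ?scaler0.
Qed.

End Evaluation.

Section KoszulContraction.
Variables (k : fieldType) (k_char0 : [pchar k] =i pred0) (B : dgAlgebra k) (m : nat).
Variables (eps : 'I_m -> {set 'I_m} -> bool) (eps_anti : anticommuting eps).
Variable (w : bool -> 'I_m -> B).
Hypotheses (w_homog : forall b i, homogeneous (dga_gr B) 1 (w b i))
  (w_cocycle : forall b i, dga_d (w b i) = 0)
  (w_sym : forall b i j, w b i * w (~~ b) j = w b j * w (~~ b) i).
Local Notation KM := (koszulMod k_char0 eps_anti w_homog w_cocycle w_sym).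
Local Notation e0 := (free_e (koszul_mx_homog eps w_homog) (koszul_mx_cocycle eps w_cocycle)
  (koszul_mx_sqr k_char0 eps_anti w_sym) finset.set0).

Lemma koszul_e0_cocycle : dgm_d e0 = 0.
Proof.
rewrite free_d_e big1// => K _; rewrite /koszul_mx big_pred0 ?scale0r// => i.
by rewrite inE.
Qed.

Hypothesis exact : forall v : KM, dgm_d v = 0 -> exists (c : k) (u : KM),
  v = c%:A *: e0 + dgm_d u.

Lemma koszul_d_linear : linear (fun v : {ffun {set 'I_m} -> B} =>
  dgm_d (v : KM) : {ffun {set 'I_m} -> B}).
Proof.
move=> c u v; rewrite [LHS](@dgm_dD _ _ KM); congr (_ + _).
have sE (z : {ffun {set 'I_m} -> B}) : c *: z = (c%:A : B) *: (z : KM).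
  by apply/ffunP => K; rewrite !ffunE; exact: esym (mulr_algl c (z K : B)).
rewrite !sE; have hc : homogeneous (dga_gr B) 0 c%:A by exact: homogZ (dga_1 B).
by rewrite (dgm_leibniz _ hc) dga_dZ dga_d1 scaler0 scale0r add0r.
Qed.

Lemma koszul_contraction : connected B ->
  exists H : {ffun {set 'I_m} -> B} -> {ffun {set 'I_m} -> B},
  [/\ linear H,
    forall i x, homogeneous (dgm_gr KM) i x -> homogeneous (dgm_gr KM) (i - 1) (H x : KM) &
    forall i x, homogeneous (dgm_gr KM) i x -> exists c : k,
      (dgm_d (H x : KM) : {ffun {set 'I_m} -> B}) + H (dgm_d x) =
      (x : {ffun {set 'I_m} -> B}) - c *: (e0 : {ffun {set 'I_m} -> B})].
Proof.
move=> cB; pose G : grading {ffun {set 'I_m} -> B} := dgm_gr KM.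
have cE c : c *: (e0 : {ffun {set 'I_m} -> B}) = (c%:A : B) *: e0.
  by apply/ffunP => K; rewrite !ffunE; exact: esym (mulr_algl c _).
apply: (contraction (G := G) _ koszul_d_linear) => [i c v|v|i v||c v|v dv].
- by apply/ffunP => K; rewrite !ffunE dga_grZ.
- exact: (@dgm_dd _ _ KM).
- exact: (@dgm_ddeg _ _ KM).
- exact: free_e_homog.

- rewrite cE; exact: free_not_boundary.
by have [c [u vE]] := exact dv; exists c, u; rewrite cE.
Qed.

End KoszulContraction.

Section BimoduleKoszul.
Variables (k : fieldType) (A : dgAlgebra k) (m : nat).
Variables (eps : 'I_m -> {set 'I_m} -> bool) (l r : 'I_m -> A -> A).
Local Notation gr := (dga_gr A).
Local Notation T := {set 'I_m}.
Local Notation W := {ffun T -> A}.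
Local Notation X := {ffun T -> tens A (opDGA A)}.
Local Notation tp := (@tpure k A (opDGA A)).
Local Notation bx := (@box k A (opDGA A) T).
Variables (G : grading W) (L H : W -> W) (DX : X -> X).
Let e : W := [ffun K => (K == finset.set0)%:R].
Hypotheses (A_ge0 : forall i (a : A), i < 0 -> homogeneous gr i a -> a = 0)
  (GP : forall i u, homogeneous G i u <-> forall K, homogeneous gr i (u K))
  (LE : forall u K, L u K = dga_d (u K) +
     \sum_(i | i \notin K) (-1) ^+ eps i (i |: K) *: l i (u (i |: K)))
  (Le : L e = 0)
  (Hl : linear H) (H_homog : forall i u, homogeneous G i u -> homogeneous G (i - 1) (H u))
  (LH : forall i u, homogeneous G i u -> exists c, L (H u) + H (L u) = u - c *: e)
  (DXD : {morph DX : x y / x + y}) (DXX : forall x, DX (DX x) = 0)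
  (DXE : forall p u b K, homogeneous G p u -> DX (bx u b) K =
     @td k A (opDGA A) (tp (u K) b) + \sum_(i | i \notin K) (-1) ^+ eps i (i |: K) *:
       (tp (l i (u (i |: K))) b +
        ksign p ((-1) ^+ (~~ odd #|K|) *: tp (u (i |: K)) (r i b)))).

(** The contraction by [i] that accompanies multiplication by [y_i] in the second factor, including
    the sign alternating with the parity of the set. It keeps the degree, as basis elements have
    degree 0. *)
Let iota (i : 'I_m) (u : W) : W := [ffun K : T => if i \in K then 0 else
  (-1) ^+ (eps i (i |: K) (+) ~~ odd #|K|) *: u (i |: K)].

Let DX_box p u b : homogeneous G p u -> DX (bx u b) =
  bx (L u) b + ksign p (bx u (dga_d b) + \sum_i bx (iota i u) (r i b)).
Proof.
move=> hu; apply/ffunP => K; rewrite (DXE _ _ hu) ksignD ffunE ffunE LE.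
have ksE (z : X) : (ksign p z : X) K = ksign p (z K) by rewrite /ksign; case: ifP; rewrite ?ffunE.
rewrite ffunE !ksE ffunE (td_pure _ ((GP p u).1 hu K)) (bilinDl (tpure_bilin _ _)).
rewrite -!addrA; congr (_ + _); rewrite [RHS]addrCA; congr (_ + _).
rewrite big_mkcond [X in tp X b]big_mkcond (bilin_suml (tpure_bilin _ _)) sum_ffunE.
rewrite (morphDsum (ksignD p)) -big_split; apply: eq_bigr => i _ /=.
rewrite !ffunE; case: ifP => [/negbTE ->|/negbT]; last first.
  rewrite negbK => ->.
  by rewrite !(bilin0l (tpure_bilin _ _)) ksign0 addr0.
rewrite !(bilinZl (tpure_bilin _ _)) scalerDr; congr (_ + _).
by rewrite ksignZ scalerA -signr_addb.
Qed.

Lemma bimodule_d_e b : DX (bx e b) = bx e (dga_d b).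
Proof.
have he : homogeneous G 0 e.
  by apply/GP => K; rewrite ffunE; case: (K == _); [exact: dga_1|exact: homog0].
rewrite (DX_box _ he) Le (morphD0 (boxDl b)) add0r /ksign /= big1 ?addr0// => i _.
rewrite (_ : iota i e = 0) ?(morphD0 (boxDl _))//; apply/ffunP => K; rewrite !ffunE.
case: ifPn => // iK; rewrite (_ : _ == _ = false) ?scaler0//.
by apply/negbTE/finset.set0Pn; exists i; rewrite !inE eqxx.
Qed.

Lemma bimodule_cocycle x : DX x = 0 -> exists b z, x = bx e b + DX z.
Proof.
apply: (twisted_tensor_cocycle (G := G) _ _ Hl H_homog LH _ DXD DXX DX_box) => //.
- by move=> i u i0 /GP hu; apply/ffunP => K; rewrite ffunE; exact: A_ge0 (hu K).
- by apply/GP => K; rewrite ffunE; case: (K == _); [exact: dga_1|exact: homog0].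
move=> i p u /GP hu; apply/GP => K; rewrite ffunE; case: ifP => _; first exact: homog0.
exact: homogZ.
Qed.

(** Every class of [X] is represented by some [e (x) b], on which [g] reads off [b]; a primitive of
    [b] gives one of the representative. *)
Lemma bimodule_quasi_iso (g : X -> A) : {morph g : x z / x + z} ->
  (forall x, g (DX x) = dga_d (g x)) -> (forall b, g (bx e b) = b) ->
  (forall a, dga_d a = 0 -> exists2 x, DX x = 0 & g x = a) /\
  (forall x, DX x = 0 -> (exists a, g x = dga_d a) -> exists z, x = DX z).
Proof.
move=> gD gd ge; split=> [a da|x dx [a ga]].
  by exists (bx e a); rewrite ?ge// bimodule_d_e da (morphD0 (boxDr _)).
have [b [z xE]] := bimodule_cocycle dx.
have bE : b = dga_d (a - g z).
  by rewrite dga_dD (morphDN (@dga_dD k A)) -ga -gd xE gD ge addrK.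
by exists (bx e (a - g z) + z); rewrite DXD bimodule_d_e -bE.
Qed.

End BimoduleKoszul.

(** * The enveloping algebra *)

Section Enveloping.
Variables (k : fieldType) (A : dgAlgebra k) (m : nat) (y : 'I_m -> A).
Hypotheses (y_central : forall (i : 'I_m) (a : A), y i * a = a * y i)
  (y_cocycle : forall i : 'I_m, dga_d (y i) = 0)
  (y_homog : forall i : 'I_m, homogeneous (dga_gr A) 1 (y i)).
Local Notation gr := (dga_gr A).
Local Notation E := (envDGA A).
Local Notation tp := (@tpure k A (opDGA A)).

Lemma env_mul i j (a b a' b' : A) : homogeneous gr j b -> homogeneous gr i a' ->
  (tp a b : E) * tp a' b' = ksign (j * i) (tp (a * a') (opmul A b b')).
Proof. by move=> hb ha; exact: (@tmul_pure k A (opDGA A) i j a b a' b' hb ha). Qed.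

(* y_i (x) 1 and 1 (x) y_j anticommute, so the alternating sign is forced by
   d^2 = 0. *)
Definition env_coef (c : bool) (i : 'I_m) : E := (tp (y i) 1 : E) + (-1) ^+ c *: (tp 1 (y i) : E).

Lemma homog_left i : homogeneous (dga_gr E) 1 (tp (y i) 1).
Proof. by rewrite -[1]addr0; apply: homog_tpure; [exact: y_homog|exact: dga_1]. Qed.

Lemma homog_right i : homogeneous (dga_gr E) 1 (tp 1 (y i)).
Proof. by rewrite -[1 : int]add0r; apply: homog_tpure; [exact: dga_1|exact: y_homog]. Qed.

Lemma cocycle_left i : dga_d (tp (y i) 1 : E) = 0.
Proof.
rewrite [LHS](td_pure _ (y_homog i)) y_cocycle [dga_d _](dga_d1 A).
by rewrite (bilin0l (tpure_bilin _ _)) (bilin0r (tpure_bilin _ _)) ksign0 addr0.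
Qed.

Lemma cocycle_right i : dga_d (tp 1 (y i) : E) = 0.
Proof.
rewrite [LHS](td_pure _ (dga_1 A)) dga_d1 [dga_d _](y_cocycle i).
by rewrite (bilin0l (tpure_bilin _ _)) (bilin0r (tpure_bilin _ _)) ksign0 addr0.
Qed.

Lemma env_coef_homog c i : homogeneous (dga_gr E) 1 (env_coef c i).
Proof. by apply: homogD; [exact: homog_left|apply: homogZ; exact: homog_right]. Qed.

Lemma env_coef_cocycle c i : dga_d (env_coef c i) = 0.
Proof. by rewrite dga_dD dga_dZ cocycle_left cocycle_right scaler0 addr0. Qed.

(** The mixed terms [y_i (x) y_j] and [y_j (x) y_i] get the coefficients [(-1)^(~~ c)] and
    [- (-1)^c], which are equal; the other terms are symmetric by centrality. *)
Lemma env_coef_sym c i j :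
  env_coef c i * env_coef (~~ c) j = env_coef c j * env_coef (~~ c) i.
Proof.
have h1 := dga_1 A; have hy := y_homog.
have M u v c1 c2 : env_coef c1 u * env_coef c2 v = (tp (y u * y v) 1 : E)
   + (-1) ^+ c2 *: (tp (y u) (y v) : E) - (-1) ^+ c1 *: (tp (y v) (y u) : E)
   - (-1) ^+ (c1 (+) c2) *: (tp 1 (y v * y u) : E).
  rewrite mulrDl !mulrDr -!scalerAl -!scalerAr.
  rewrite (env_mul _ _ h1 (hy v)) (env_mul _ _ h1 h1) (env_mul _ _ (hy u) (hy v)).
  rewrite (env_mul _ _ (hy u) h1) (opmul_homog (hy u) (hy v)) !opmul1l opmul1r.
  rewrite (bilin_ksignr (tpure_bilin _ _)) /ksign /= !mulr1 !mul1r !scalerN scalerA.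
  by rewrite -signr_addb !addrA.
rewrite !M (y_central j (y i)) signrN !scaleNr.
by congr (_ - _); rewrite addrAC.
Qed.

(** The sign [(-1)^|b|] of the twist cancels the one from moving [y_i] past [b]; only the degree of
    [a] remains, as a differential twisted over the first factor requires. *)
Lemma env_mulr c p i (a b : A) : homogeneous gr p a ->
  twist (dga_gr E) 1 (tp a b : E) * env_coef c i =
    (tp (twist gr 1 a * y i) b : E) + ksign p ((-1) ^+ c *: (tp a (y i * b) : E)).
Proof.
move=> ha; rewrite (twist_homog _ ha) mulr1.
pose f b := twist (dga_gr E) 1 (tp a b : E) * env_coef c i.
pose g b : E := (tp (ksign p a * y i) b : E) + ksign p ((-1) ^+ c *: (tp a (y i * b) : E)).
rewrite -/(f b) -/(g b); have tDr u : {morph (tp u : A -> E) : x z / x + z}.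
  exact: bilinDr (tpure_bilin _ _) u.
move: b; apply: (grext (G := gr)) => [x z|x z|q b hb].
- by rewrite /f tDr twistD mulrDl.
- by rewrite /g mulrDr !tDr scalerDr ksignD addrACA.
have hab : homogeneous (dga_gr E) (p + q) (tp a b) by exact: homog_tpure.
rewrite /f /g (twist_homog _ hab) mulr1 ksignMl mulrDr ksignD; congr (_ + _).
  rewrite (env_mul _ _ hb (y_homog i)) opmul1r ksign_comp ksignMl.
  rewrite (bilin_ksignl (tpure_bilin _ _)); apply: eq_ksign.
  by rewrite !oddzE; do 2!case: (odd _).
rewrite -scalerAr (env_mul _ _ hb (dga_1 A)) mulr1 (opmul_homog hb (y_homog i)).
rewrite (bilin_ksignr (tpure_bilin _ _)) !ksignZ !ksign_comp.
by apply: eq_ksign; rewrite !oddzE; do 2!case: (odd _).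
Qed.

Lemma env_mull c p i (a b : A) : homogeneous gr p a ->
  env_coef c i * (tp a b : E) =
    (tp (y i * a) b : E) + ksign p ((-1) ^+ c *: (tp a (opmul A (y i) b) : E)).
Proof.
move=> ha; rewrite mulrDl -scalerAl (env_mul _ _ (dga_1 A) ha) opmul1l mul0r.
by rewrite (env_mul _ _ (y_homog i) ha) !mul1r -ksignZ.
Qed.

End Enveloping.

(** * Functoriality of the dual *)

Section DualFunctor.
Variables (k : fieldType) (B : dgAlgebra k).
Implicit Types F : dgModule B.

Lemma dual_homog F n (s : dual_type F) : homogeneous (dual_gr F) n s -> hom_deg n s.
Proof.
move: s; apply: dual_homog_ind => [|s t [sD sg sl] [tD tg tl]|//].
- split=> [x y|i x _|i b x _]; first by rewrite [RHS](addr0 (0 : B)).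
    exact: homog0.
  by rewrite !dual0E mulr0 ksign0.
- split=> [x y|i x hx|i b x hb].
  + by rewrite !dual_addE sD tD addrACA.
  + by rewrite dual_addE; apply: homogD (sg _ _ hx) (tg _ _ hx).
  + by rewrite !dual_addE (sl _ _ _ hb) (tl _ _ _ hb) mulrDr ksignD.
Qed.

Lemma dual_pullback F F' (phi : dgHom F F') :
  exists ps : dgHom (dualMod F') (dualMod F), forall (s : dualMod F') x,
    (ps s : dual_type F) x = (s : dual_type F') (phi x) :> B.
Proof.
have homphi n (s : F' -> B) : hom_deg n s -> hom_deg n (fun x => s (phi x)).
  move=> [sD sg sl]; split=> [x y|i x hx|i b x hb].
  - by rewrite linearD sD.
  - by apply: sg; exact: dgh_homog.
  - by rewrite linearZ (sl _ _ _ hb).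
have ex (s : dualMod F') : exists t : dualMod F, forall x,
    (t : dual_type F) x = (s : dual_type F') (phi x) :> B.
  move: s; apply: dual_ind2 => [|s s' [t tE] [t' tE']|n s hs].
  - by exists 0.
  - by exists (t + t') => x; rewrite !dual_addE tE tE'.
  - by exists (mkdual (homphi _ _ hs)).
pose f s := projT1 (cid (ex s)).
have fE s x : (f s : dual_type F) x = (s : dual_type F') (phi x) :> B by rewrite /f; case: cid.
have fD : {morph f : s t / s + t}.
  by move=> s t; apply: dual_eq => x; rewrite [RHS]dual_addE !fE dual_addE.
have fh n (s : F' -> B) (hs : hom_deg n s) : f (mkdual hs : dual_type F') = mkdual (homphi n s hs).
  by apply: dual_eq => x; rewrite fE.
have [||||ps psE] := @mk_dgHom _ _ (dualMod F') (dualMod F) f; last first.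
- by exists ps => s x; rewrite psE fE.
- apply: dual_ind2 => [|s t hs ht|n s hs].
  + by rewrite !(dgm_d0, morphD0 fD).
  + by rewrite dgm_dD !fD dgm_dD hs ht.
  rewrite fh; apply: dual_eq => x; rewrite fE.
  rewrite [LHS]dual_d_fun_hom [RHS]dual_d_fun_hom dgh_d.
  by [].
- move=> n; apply: dual_homog_ind => [|s t hs ht|s hs].
  + by rewrite (morphD0 fD); exact: homog0.
  + by rewrite fD; exact: homogD.
  by rewrite fh; exact: dual_homog_hom.
- move=> b s; apply: dual_eq => x; rewrite fE.
  by rewrite [RHS]/(opmul B b ((f s : dual_type F) x)) fE.
- exact: fD.
Qed.

(** The primitive is [s o h] up to the sign [(-1)^n]: a cocycle [s] commutes with differentials up
    to sign and can be applied to the homotopy identity. *)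
Lemma dual_homotopy F (phi : dgHom F F) n (s t : dualMod F) :
  homotopic (dgid F) phi -> homogeneous (dgm_gr (dualMod F)) n s -> dgm_d s = 0 ->
  (forall x, (t : dual_type F) x = (s : dual_type F) (phi x) :> B) ->
  exists u, s = t + dgm_d u.
Proof.
move=> [h [hD hg hl he]] hs ds tE; have hsn := dual_homog hs; have [sD sg sl] := hsn.
have dsE x : dga_d ((s : dual_type F) x : B) = ksign n ((s : dual_type F) (dgm_d x) : B).
  have sE : s = mkdual hsn by apply: dual_eq => z.
  have : dual_d_fun (mkdual hsn) x = 0.
    by rewrite -[LHS]/((dual_d (mkdual hsn) : dual_type F) x : B) -sE [dual_d s]ds.
  by rewrite dual_d_fun_hom => /eqP; rewrite subr_eq0 => /eqP.
have hsh : hom_deg (n - 1) (fun x => (s : dual_type F) (h x) : B).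
  split=> [x y|i x hx|i b x hb].
  - by rewrite hD sD.
  - by rewrite addrCA addrC; apply: sg; exact: hg.
  - rewrite (hl _ _ _ hb) (ksign_morph _ _ sD) (sl _ _ _ hb) ksign_comp.
    by apply: eq_ksign; rewrite !oddzE; do 2!case: (odd _).
exists (ksign n (mkdual hsh)); apply: dual_eq => x.
rewrite [RHS]dual_addE tE dgm_d_ksign [X in _ + X]dual_ksign.
rewrite [X in ksign n X]dual_d_fun_hom dsE !ksignD ksign_comp.
have -> : ksign n (- ksign (n - 1) ((s : dual_type F) (h (dgm_d x)) : B)) =
    (s : dual_type F) (h (dgm_d x)) :> B.
  by rewrite /ksign !oddzE /=; case: (odd _); rewrite /= ?opprK.
have -> : ksign (n + n) ((s : dual_type F) (dgm_d (h x)) : B) =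
    (s : dual_type F) (dgm_d (h x)) :> B by rewrite /ksign oddzE addbb.
by rewrite -!sD -he /= addrC subrK.
Qed.

End DualFunctor.

Lemma sign_scale (k : fieldType) (R : algType k) (b : bool) (x : R) :
  (-1) ^+ b * x = (-1) ^+ b *: x.
Proof. by case: b; rewrite ?expr1 ?expr0 ?mul1r ?scale1r ?mulN1r ?scaleN1r. Qed.

Lemma scale_alg_swap (k : fieldType) (R : algType k) (M : lmodType R) (c : k) (a : R) (x : M) :
  a *: (c%:A *: x) = c%:A *: (a *: x).
Proof. by rewrite !scalerA mulr_algl mulr_algr. Qed.

Lemma env_degree0 (k : fieldType) (A : dgAlgebra k) (x : envDGA A) : connected A ->
  homogeneous (dga_gr (envDGA A)) 0 x -> exists c : k, x = c%:A.
Proof.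
move=> cA; move: x; apply: thomog_ind => [|x z [c ->] [d ->]|i j a b ij ha hb].
- by exists 0; rewrite scale0r.
- by exists (c + d); rewrite scalerDl.
have hb0 : homogeneous (dga_gr A) j b := hb.
have [i0|i0|i0] := ltgtP i 0.
- by exists 0; rewrite (cA.1 _ _ i0 ha) (bilin0l (tpure_bilin _ _)) scale0r.
- have j0 : j < 0 by lia.
  by exists 0; rewrite (cA.1 _ _ j0 hb0) (bilin0r (tpure_bilin _ _)) scale0r.
subst i; have j0 : j = 0 by lia.
subst j; have [c ->] := cA.2 _ ha; have [d ->] := cA.2 _ hb0.
exists (c * d); rewrite (bilinZl (tpure_bilin _ _)) -scalerA; congr (_ *: _).
exact: (bilinZr (tpure_bilin _ _)).
Qed.

Lemma diagR_susp (k : fieldType) (A : dgAlgebra k) :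
  exists f : dgHom (diagR A) (suspMod (- 0) (diagR A)), forall x, f x = x.
Proof.
have [||||f fE] := @mk_dgHom _ _ (diagR A) (suspMod (- 0) (diagR A)) (fun x => x); last by exists f.
- by [].
- move=> a x; rewrite -[RHS]/(twist (dga_gr (opDGA (envDGA A))) (- 0) a *: (x : diagR A)).
  by rewrite oppr0 twist0.
- by move=> i x hx; apply/susp_homog; rewrite subr0.
- by move=> x; rewrite [RHS](_ : _ = ksign (- 0) (dgm_d (x : diagR A))).
Qed.

(** * The resolutions of [k] and [A], and the Calabi-Yau property *)

Section Resolution.
Variables (k : fieldType) (k_char0 : [pchar k] =i pred0) (A : dgAlgebra k) (cA : connected A)
  (m : nat) (y : 'I_m -> A).
Hypotheses (y_central : forall (i : 'I_m) (a : A), y i * a = a * y i)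
  (y_cocycle : forall i : 'I_m, dga_d (y i) = 0)
  (y_homog : forall i : 'I_m, homogeneous (dga_gr A) 1 (y i))
  (HA : polynomial_cohomology y).
Variables (eps : 'I_m -> {set 'I_m} -> bool) (eps_anti : anticommuting eps).

Let w (b : bool) (i : 'I_m) : A := y i.
Let w_homog b i : homogeneous (dga_gr A) 1 (w b i) := y_homog i.
Let w_cocycle b i : dga_d (w b i) = 0 := y_cocycle i.
Let w_sym b i j : w b i * w (~~ b) j = w b j * w (~~ b) i := y_central i (y j).

Local Notation koszulA := (koszulMod k_char0 eps_anti w_homog w_cocycle w_sym).
Local Notation dualA := (koszulMod k_char0 (anticommuting_dual eps_anti)
  (dual_coef_homog w_homog) (dual_coef_cocycle w_cocycle) (dual_coef_sym w_homog w_sym)).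

Local Notation gr := (dga_gr A).
Local Notation T := {set 'I_m}.
Local Notation E := (envDGA A).
Local Notation tp := (@tpure k A (opDGA A)).
Local Notation bx := (@box k A (opDGA A) T).
Local Notation eA := (free_e (koszul_mx_homog eps w_homog) (koszul_mx_cocycle eps w_cocycle)
  (koszul_mx_sqr k_char0 eps_anti w_sym)).
Local Notation eD := (free_e (koszul_mx_homog (dual_sign eps) (dual_coef_homog w_homog))
  (koszul_mx_cocycle (dual_sign eps) (dual_coef_cocycle w_cocycle))
  (koszul_mx_sqr k_char0 (anticommuting_dual eps_anti) (dual_coef_sym w_homog w_sym))).

Local Notation W_homog := (env_coef_homog y_homog).
Local Notation W_cocycle := (env_coef_cocycle y_cocycle y_homog).
Local Notation W_sym := (env_coef_sym y_central y_homog).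
Local Notation koszulE := (koszulMod k_char0 eps_anti W_homog W_cocycle W_sym).
Local Notation dualE := (koszulMod k_char0 (anticommuting_dual eps_anti)
  (dual_coef_homog W_homog) (dual_coef_cocycle W_cocycle) (dual_coef_sym W_homog W_sym)).

Let e : {ffun T -> A} := [ffun K => (K == finset.set0)%:R].
Local Notation eE := (free_e (koszul_mx_homog (dual_sign eps) (dual_coef_homog W_homog))
  (koszul_mx_cocycle (dual_sign eps) (dual_coef_cocycle W_cocycle))
  (koszul_mx_sqr k_char0 (anticommuting_dual eps_anti) (dual_coef_sym W_homog W_sym))).

Lemma koszulA_cocycle (v : koszulA) : dgm_d v = 0 ->
  exists (c : k) (u : koszulA), v = c%:A *: eA finset.set0 + dgm_d u.
Proof.
move=> dv; refine (@koszul_cocycle _ k_char0 _ _ _ eps_anti _ w_homog w_cocycle w_sym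
  (signed_ev y) _ _ _ _ _ _ v dv).
- exact: signed_evD.
- exact: signed_evC.
- exact: dga_d_signed_ev.
- by move=> b p i; rewrite signed_ev_mulX.
- exact: signed_ev_surj.
- exact: signed_ev_inj.
Qed.

Lemma dualA_cocycle (v : dualA) : dgm_d v = 0 ->
  exists (c : k) (u : dualA), v = c%:A *: eD finset.set0 + dgm_d u.
Proof.
have evD : {morph (mmap (in_alg A) y : _ -> A) : p q / p + q} by move=> p q; exact: mmapD.
have evC c : mmap (in_alg A) y c%:MP = c%:A by exact: mmapC.
move=> dv; refine (@koszul_cocycle _ k_char0 _ _ _ (anticommuting_dual eps_anti) _
  (dual_coef_homog w_homog) (dual_coef_cocycle w_cocycle) (dual_coef_sym w_homog w_sym)
  (mmap (in_alg A) y) _ _ _ _ _ _ v dv).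
- exact: evD.
- exact: evC.
- by move=> p; exact: (@mmap_cocycle _ A _ y p y_cocycle).
- move=> b p i; rewrite mmap_mulX//.
  exact: esym (@opmul_twist1 _ A (mmap (in_alg A) y p) (y i) (y_homog i)).
- exact: HA.1.
- exact: HA.2.
Qed.

Lemma koszulA_resolution : exists f : dgHom koszulA (trivMod cA), quasi_iso f.
Proof.
have [||i|f fE] := @koszul_hom _ k_char0 _ _ _ eps_anti _ w_homog w_cocycle w_sym
  (trivMod cA) (1 : k).
- by [].
- by [].
- by rewrite [LHS](_ : _ = aug cA (w true i) * 1 :> k)// mulr1 (aug_neq0 cA (w_homog _ _)).
have fe v : f v = aug cA ((v : {ffun {set 'I_m} -> A^o}) finset.set0) :> k.
  by rewrite fE [LHS](_ : _ = aug cA ((v : {ffun {set 'I_m} -> A^o}) finset.set0) * 1 :> k)// mulr1.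
have augc (c : k) : aug cA (c%:A) = c by apply: aug_uniq; rewrite dga_grZ (dga_1 A).
have fc (c : k) : f (c%:A *: eA finset.set0) = c :> k.
  by rewrite fe !ffunE eqxx [c%:A *: _]mulr1 augc.
exists f; split=> [c _|v dv [x fx]].
  exists ((c : k)%:A *: eA finset.set0); split; last by exists 0; rewrite addr0 fc.
  rewrite dgm_leibniz_twist koszul_e0_cocycle scaler0 addr0 dga_dZ dga_d1 scaler0.
  exact: scale0r.
have [c [u vE]] := koszulA_cocycle dv.
exists u; rewrite vE in fx *; rewrite (_ : c = 0) ?scale0r ?add0r//.
have := fx; rewrite linearD dgh_d fc => cE.
by rewrite -[RHS]cE; exact: esym (addr0 (c : k)).
Qed.

Lemma koszulA_smooth_resolution : koszul cA /\ homologically_smooth cA.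
Proof.
have [f fQ] := koszulA_resolution.
have sb := koszul_semi_basis k_char0 eps_anti w_homog w_cocycle w_sym.
split; last first.
  apply: (dcompact_finite_semi_free (f := f)); first by split=> //; eexists; exact: sb.
  exact: free_gen.
exists koszulA, f, (@free_basis _ _ _ _ (koszul_mx_homog eps w_homog)
  (koszul_mx_cocycle eps w_cocycle) (koszul_mx_sqr k_char0 eps_anti w_sym)).
split=> //; first by move=> _ [t ->]; exact: free_e_homog.
exact: free_minimal.
Qed.

(** The cohomology of the dual is spanned by the class of its basis element of the empty set, which
    is not a boundary because the opposite algebra is connected too. *)
Lemma koszulA_gorenstein : gorenstein cA.
Proof.
have [f fQ] := koszulA_resolution.
have sb := koszul_semi_basis k_char0 eps_anti w_homog w_cocycle w_sym.
exists koszulA, f; split; first by split=> //; eexists; exact: sb.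
have [th [th_inj th_surj]] := koszul_dual_iso k_char0 eps_anti w_homog w_cocycle w_sym.
have [z zE] := th_surj (eD finset.set0).
exists (fun=> z); split=> [_|x dx|c x].
- by apply: th_inj; rewrite dgh_d zE koszul_e0_cocycle linear0.
- have [|c [u xE]] := @dualA_cocycle (th x); first by rewrite -dgh_d dx linear0.
  have [u' u'E] := th_surj u; exists (fun=> c), u'; rewrite big_ord1.
  by apply: th_inj; rewrite linearD linearZ /= zE dgh_d u'E.
rewrite big_ord1 => xE i; rewrite ord1.
have : (c ord0)%:A *: eD finset.set0 = dgm_d (th x) by rewrite -dgh_d -xE linearZ /= zE.
exact: free_not_boundary (opDGA_connected cA).
Qed.

Lemma koszulE_quasi_iso (f : dgHom koszulE (diagL A)) :
  (forall b, f (bx e b) = b) -> quasi_iso f.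
Proof.
move=> fe; have [H [Hl H_homog LH]] := koszul_contraction
  koszulA_cocycle cA.
have fD : {morph (f : {ffun T -> tens A (opDGA A)} -> A) : x z / x + z}.
  by move=> x z; exact: (linearD (dgh_fun f) x z).
have fd x : f (dgm_d (x : koszulE)) = dga_d (f x : A) by exact: dgh_d.
have [] := @bimodule_quasi_iso k A m eps (fun i a => twist gr 1 a * y i) (fun i b => y i * b)
  (dgm_gr koszulA) (fun u => dgm_d (u : koszulA)) H (fun x => dgm_d (x : koszulE))
  cA.1 _ _ _ Hl H_homog LH _ _ _ (f : {ffun T -> tens A (opDGA A)} -> A) fD fd fe.
- by move=> i u; exact: free_homogP.
- move=> u K; rewrite [LHS]koszul_dE; congr (_ + _); apply: eq_bigr => i _.
  by rewrite sign_scale.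
- exact: koszul_e0_cocycle.
- exact: (@dgm_dD _ _ koszulE).
- exact: (@dgm_dd _ _ koszulE).
- move=> p u b K /free_homogP hu; rewrite [LHS]koszul_dE.
  rewrite [X in dga_d X](ffunE _ K); congr (_ + _); apply: eq_bigr => i _.
  by rewrite sign_scale ffunE (env_mulr y_homog _ _ _ (hu _)).
move=> s i; split=> [a da|x dx [a fa]].
  by have [x dx xa] := s a da; exists x; split=> //; exists 0; rewrite dgm_d0 addr0.
by apply: i => //; exists a.
Qed.

(** For [m] odd, [dual_coef] is the original alternating family. The first factor is then the Koszul
    complex over the opposite of [A], whose contraction comes from [dualA_cocycle]. *)
Lemma dualE_quasi_iso (f : dgHom dualE (diagR A)) : odd m ->
  (forall b, f (bx e b) = b) -> quasi_iso f.
Proof.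
move=> m_odd fe; have [H [Hl H_homog LH]] := koszul_contraction
  dualA_cocycle (opDGA_connected cA).
have fD : {morph (f : {ffun T -> tens A (opDGA A)} -> A) : x z / x + z}.
  by move=> x z; exact: (linearD (dgh_fun f) x z).
have fd x : f (dgm_d (x : dualE)) = dga_d (f x : A) by exact: dgh_d.
have [] := @bimodule_quasi_iso k A m (dual_sign eps) (fun i a => y i * a)
  (fun i b => opmul A (y i) b)
  (dgm_gr dualA) (fun u => dgm_d (u : dualA)) H (fun x => dgm_d (x : dualE))
  cA.1 _ _ _ Hl H_homog LH _ _ _ (f : {ffun T -> tens A (opDGA A)} -> A) fD fd fe.
- by move=> i u; exact: free_homogP.
- move=> u K; rewrite [LHS]koszul_dE; congr (_ + _); apply: eq_bigr => i _.
  rewrite sign_scale; congr (_ *: _); exact: (@opmul_twist1 _ A _ _ (y_homog i)).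
- exact: (koszul_e0_cocycle k_char0 (anticommuting_dual eps_anti) (dual_coef_homog w_homog)
    (dual_coef_cocycle w_cocycle) (dual_coef_sym w_homog w_sym)).
- exact: (@dgm_dD _ _ dualE).
- exact: (@dgm_dd _ _ dualE).
- move=> p u b K /free_homogP hu; rewrite [LHS]koszul_dE.
  rewrite [X in dga_d X](ffunE _ K); congr (_ + _); apply: eq_bigr => i _.
  rewrite sign_scale; congr (_ *: _); rewrite ffunE.
  rewrite [LHS](@opmul_twist1 _ E _ _ (W_homog _ _)) /dual_coef m_odd addbF.
  exact: (env_mull y_homog _ _ _ (hu _)).
move=> s i; split=> [a da|x dx [a fa]].
  by have [x dx xa] := s a da; exists x; split=> //; exists 0; rewrite dgm_d0 addr0.
by apply: i => //; exists a.
Qed.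

Lemma env_coef_diagL c i (x : A) : homogeneous gr 0 x ->
  env_coef y c i *: (x : diagL A) = y i * x + (-1) ^+ c *: (x * y i) :> A.
Proof.
move=> hx; rewrite /env_coef scalerDl.
have sE (a : k) (u : E) (z : diagL A) : (a *: u) *: z = a *: ((u *: z : diagL A) : A) :> A.
  exact: (linZ (tlift_linear (@dl2_bilin k A z)) a u).
rewrite sE; congr (_ + _ *: _); first by rewrite [LHS]dl_pure opmul1l.
by rewrite [LHS]dl_pure mul1r (opmul_homog (y_homog i) hx) mulr0.
Qed.

Lemma env_coef_diagR c i (x : A) : homogeneous gr 0 x ->
  (env_coef y c i : opDGA E) *: (x : diagR A) = x * y i + (-1) ^+ c *: (y i * x) :> A.
Proof.
move=> hx; rewrite /env_coef scalerDl.
have sE (a : k) (u : opDGA E) (z : diagR A) : (a *: u) *: z = a *: ((u *: z : diagR A) : A) :> A.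
  exact: (linZ (tlift_linear (@dr2_bilin k A z)) a u).
rewrite sE; congr (_ + _ *: _); last by rewrite [LHS]dr_pure opmul1l.
by rewrite [LHS]dr_pure mul1r (opmul_homog (y_homog i) hx) mulr0.
Qed.

Lemma koszulE_resolution : exists f : dgHom koszulE (diagL A), semi_free_resolution f.
Proof.
have [||i|f fE] := @koszul_hom _ k_char0 _ _ _ eps_anti _ W_homog W_cocycle W_sym
  (diagL A) (1 : A).
- exact: dga_1.
- exact: dga_d1.
- rewrite [LHS](env_coef_diagL _ _ (dga_1 A)) mulr1 mul1r expr1 scaleN1r subrr.
  by [].
exists f; split.
  by eexists; exact: (koszul_semi_basis k_char0 eps_anti W_homog W_cocycle W_sym).
apply: koszulE_quasi_iso => b; rewrite fE ffunE ffunE eqxx [LHS]dl_pure mul1r.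
exact: opmul1r.
Qed.

Lemma dualE_diso : odd m -> diso (dualMod koszulE) (suspMod (- 0) (diagR A)).
Proof.
move=> m_odd.
have [||i|g gE] := @koszul_hom _ k_char0 _ _ _ (anticommuting_dual eps_anti) _
  (dual_coef_homog W_homog) (dual_coef_cocycle W_cocycle) (dual_coef_sym W_homog W_sym)
  (diagR A) (1 : A).
- exact: dga_1.
- exact: dga_d1.
- rewrite /dual_coef m_odd [LHS](env_coef_diagR _ _ (dga_1 A)) mulr1 mul1r expr1 scaleN1r subrr.
  by [].
have gQ : quasi_iso g.
  apply: (dualE_quasi_iso m_odd) => b; rewrite gE ffunE ffunE eqxx [LHS]dr_pure.
  by rewrite mulr1 opmul1l.
have [th [th_inj th_surj]] := koszul_dual_iso k_char0 eps_anti W_homog W_cocycle W_sym.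
have [h hE] := diagR_susp A.
apply: (@quasi_iso_diso _ _ _ _ (dgcomp h (dgcomp g th))).
apply: quasi_iso_comp; first by apply: quasi_iso_comp gQ; exact: bij_quasi_iso.
by apply: bij_quasi_iso => [x z|x]; [rewrite !hE|exists x; rewrite hE].
Qed.

(** In degree 0 the coefficients are scalars. The cocycle condition is then a linear relation among
    the [env_coef y b j], which are independent because the classes of the [y_j] are. *)
Lemma dualE_degree0 (v : dualE) : homogeneous (dgm_gr dualE) 0 v -> dgm_d v = 0 ->
  exists c : k, v = c%:A *: eE finset.set0.
Proof.
move=> /free_homogP hv dv.
have ex K : exists c : k, (v : {ffun T -> (opDGA E)^o}) K = c%:A :> E by exact: env_degree0 (hv K).
pose c K := projT1 (cid (ex K)).
have cE K : (v : {ffun T -> (opDGA E)^o}) K = (c K)%:A :> E by rewrite /c; case: cid.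
have augZ (a : k) (b : A) : aug cA (a *: b) = a * aug cA b.
  by apply: aug_uniq; rewrite dga_grZ augE scalerA.
(* [chi] is the identity tensored with the augmentation: it keeps [y_j] from the left factor and
   kills the one on the right. *)
pose chi2 (a : A) (b : opDGA A) : A := aug cA (b : A) *: a.
have chib : bilin chi2.
  apply: bilinP => [b a a'|a b b'|x a b|x a b]; rewrite /chi2.
  - exact: scalerDr.
  - by rewrite augD scalerDl.
  - by rewrite !scalerA mulrC.
  - by rewrite augZ scalerA.
pose chi (u : E) : A := tlift chi2 u.
have chiD : {morph chi : u u' / u + u'} by exact: tliftD chib.
have chiZ (a : k) u : chi (a *: u) = a *: chi u by exact: (linZ (tlift_linear chib)).
have chiW b i : chi (env_coef y b i) = y i.
  rewrite /env_coef chiD chiZ /chi !(tlift_pure _ _ chib) /chi2 aug1 scale1r.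
  by rewrite (aug_neq0 cA (y_homog i)) ?scale0r ?scaler0 ?addr0.
have c0 i (K : {set 'I_m}) : i \notin K -> c (i |: K) = 0.
  move=> iK; have := koszul_dE v K; rewrite dv ffunE cE.
  rewrite [dga_d _](_ : _ = 0 :> E); last by rewrite [LHS](@dga_dZ _ E) dga_d1 scaler0.
  rewrite add0r => /(congr1 chi); rewrite (morphD0 chiD).
  pose p : {mpoly k[m]} := \sum_(j | j \notin K)
    ((-1) ^+ dual_sign eps j (j |: K) * c (j |: K)) *: 'X_j.
  rewrite (big_morph chi chiD (morphD0 chiD)).
  rewrite (eq_bigr (fun j => ((-1) ^+ dual_sign eps j (j |: K) * c (j |: K)) *: y j)); last first.
    move=> j jK; rewrite sign_scale chiZ -scalerA; congr (_ *: _).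
    rewrite [X in chi X](@opmul_twist1 _ E _ _ (W_homog _ _)) cE.
    by rewrite -scalerAr mulr1 chiZ chiW.
  move=> sum0; have p0 : p = 0.
    apply: (HA.2 p 0); rewrite (morphD0 (@dga_dD k A)) sum0 /p raddf_sum.
    by apply: eq_bigr => j _; rewrite /= mmapZ mmapX mmap1U /= -scalerAl mul1r.
  have := congr1 (mcoeff U_(i)%MM) p0; rewrite mcoeff0 /p raddf_sum (bigD1 i)//= big1.
    rewrite addr0 mcoeffZ mcoeffXU eqxx mulr1 => /eqP.
    by rewrite mulf_eq0 signr_eq0 => /eqP.
  by move=> j /andP[_ ji]; rewrite mcoeffZ mcoeffXU (negbTE ji) mulr0.
exists (c finset.set0); apply/ffunP => K; rewrite ffunE ffunE [LHS]cE.
case: (eqVneq K finset.set0) => [->|/finset.set0Pn[i iK]]; first exact: esym (mulr1 _).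
rewrite -(finset.setD1K iK) c0 ?inE ?eqxx// scale0r; exact: esym (mulr0 _).
Qed.

(** For [m = 0] the implication fails: [A] is then quasi-isomorphic to [k], which is
    0-Calabi-Yau. *)
Lemma odd_of_calabi_yau : (0 < m)%N -> calabi_yau cA 0 -> odd m.
Proof.
move=> m_gt0 [_ [F [f [[sfF fQ] Fdiso]]]]; apply: contrapT => /negP m_even.
pose i := Ordinal m_gt0; pose one : suspMod (- 0) (diagR A) := (1 : A).
have [h hE] := diagR_susp A.
have [||t [dt ht tE]] := diso_cocycle (n := one) (i := 0) Fdiso.
- by rewrite -[one]hE -dgh_d [dgm_d _](dga_d1 A) linear0.
- by rewrite -[one]hE; apply: dgh_homog; exact: dga_1.
pose oneR : diagR A := (1 : A).
have act (a : opDGA E) : a *: one = h (a *: oneR).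
  by rewrite linearZ hE.
pose a1 : opDGA E := env_coef y true i; pose a3 : opDGA E := env_coef y false i.
pose a2 : opDGA E := tp (y i) 1.
have [a1h a2h] : homogeneous (dga_gr (opDGA E)) 1 a1 /\ homogeneous (dga_gr (opDGA E)) 1 a2.
  by split; [exact: W_homog|exact: homog_left].
have [da1 da2] : dga_d a1 = 0 /\ dga_d a2 = 0.
  by split; [exact: W_cocycle|exact: cocycle_left].
have [u1 u1E] : exists u, a1 *: t = dgm_d u.
  apply/(tE _ _ a1h da1); exists 0; rewrite act dgm_d0 -[RHS](linear0 (dgh_fun h)); congr (h _).
  rewrite [LHS](env_coef_diagR _ _ (dga_1 A)) mulr1 mul1r expr1 scaleN1r subrr.
  by [].
have a2t : ~ exists u, a2 *: t = dgm_d u.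
  move=> /(tE _ _ a2h da2)[u]; rewrite act hE [LHS]dr_pure mulr1 opmul1r.
  move=> yu; have : 'X_i = 0 :> {mpoly k[m]}.
    apply: (HA.2 _ (u : A)); rewrite mmapX mmap1U yu.
    by rewrite [LHS](_ : _ = ksign (- 0) (dgm_d (u : diagR A))).
  by move=> /(congr1 (mcoeff U_(i)%MM))/eqP; rewrite mcoeff0 mcoeffXU eqxx oner_eq0.
have [eB [sfB eBQ]] := koszulE_resolution.
(* The resolution [F] is arbitrary. Comparison maps carry [t] to the dual of the explicit resolution
   and back, [phi] after [psi] being homotopic to the identity. *)
have [phi phiE] := semi_free_lift eB fQ sfB.
have phiQ : quasi_iso phi.
  by apply: (quasi_iso_cancel fQ); exact: quasi_iso_homotopic phiE _.
have [psi psiE] := semi_free_lift (dgid F) phiQ sfF.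
have [phis phisE] := dual_pullback phi; have [psis psisE] := dual_pullback psi.
pose t' := phis t.
(* In degree 0, [t'] is a multiple of the basis element of the empty set, and for [m] even the
   coefficient of the dual complex at singletons is [a3]. *)
have [u3 u3E] : exists u, a3 *: t' = dgm_d u.
  have [th [th_inj th_surj]] := koszul_dual_iso k_char0 eps_anti W_homog W_cocycle W_sym.
  have [||c cE] := dualE_degree0 (v := th t').
  - by do 2!apply: dgh_homog.
  - by rewrite -!dgh_d dt !linear0.
  have [u uE] := koszul_coef_boundary k_char0 (anticommuting_dual eps_anti)
    (dual_coef_homog W_homog) (dual_coef_cocycle W_cocycle) (dual_coef_sym W_homog W_sym) i.
  have hc : homogeneous (dga_gr (opDGA E)) 0 c%:A by exact: (homogZ (A := opDGA E) c (dga_1 _)).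
  have dc : dga_d (c%:A : opDGA E) = 0 by rewrite (@dga_dZ _ (opDGA E)) dga_d1 scaler0.
  have [u' u'E] := scale_boundary u hc dc.
  have [z zE] := th_surj u'; exists z; apply: th_inj.
  have -> : th (a3 *: t') = a3 *: th t' by exact: linearZ.
  have <- : dual_coef (env_coef y) true i = a3 by rewrite /dual_coef (negbTE m_even).
  rewrite cE dgh_d zE -u'E -uE.
  exact: (@scale_alg_swap _ (opDGA E)).
apply: a2t.
have a2t'E : exists u, a2 *: t' = dgm_d u.
  have two0 : (2%:R : k) != 0 by rewrite ((pcharf0P k).1 k_char0).
  pose c : k := 2%:R^-1.
  have hc : homogeneous (dga_gr (opDGA E)) 0 c%:A by exact: (homogZ (A := opDGA E) c (dga_1 _)).
  have dc : dga_d (c%:A : opDGA E) = 0 by rewrite (@dga_dZ _ (opDGA E)) dga_d1 scaler0.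
  have [u uE] := scale_boundary (phis u1 + u3) hc dc; exists u.
  have e1 : phis (a1 *: t) = a1 *: t' by exact: linearZ.
  have -> : a2 = c%:A * (a1 + a3).
    rewrite mulr_algl /a1 /a3 /env_coef expr1 expr0 scale1r scaleN1r addrACA addNr addr0.
    by rewrite -mulr2n -scaler_nat scalerA mulVf// scale1r.
  by rewrite -scalerA scalerDl -uE dgm_dD -u3E -dgh_d -u1E e1.
have [u uE] := a2t'E.
have [||x|v vE] := dual_homotopy (s := a2 *: t) (t := psis (phis (a2 *: t))) (n := 1) psiE.
- by rewrite -[1 : int]addr0; exact: dgm_act.
- exact: scale_cocycle a2h da2 dt.
- by rewrite psisE phisE.
by exists (psis u + v); rewrite dgm_dD -dgh_d -uE /t' vE linearZ.
Qed.

Lemma calabi_yau_of_odd : odd m -> calabi_yau cA 0.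
Proof.
move=> m_odd; have [_ smooth] := koszulA_smooth_resolution.
split=> //; have [f fres] := koszulE_resolution; exists koszulE, f; split=> //.
exact: dualE_diso.
Qed.

End Resolution.

Theorem theoremD (k : closedFieldType) (k_char0 : [pchar k] =i pred0)
    (A : dgAlgebra k) (cA : connected A)
    (m : nat) (m_gt0 : (0 < m)%N) (y : 'I_m -> A)
    (y_central : forall (i : 'I_m) (a : A), y i * a = a * y i)
    (y_cocycle : forall i : 'I_m, dga_d (y i) = 0)
    (y_deg1 : forall i : 'I_m, homogeneous (dga_gr A) 1 (y i))
    (HA : polynomial_cohomology y) :
  [/\ koszul cA, homologically_smooth cA & gorenstein cA] /\
  (calabi_yau cA 0 <-> odd m).
Proof.
have [eps eps_anti] := anticommuting_ex m.
have [kA sA] := koszulA_smooth_resolution k_char0 cA y_central y_cocycle y_deg1 HA eps_anti.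
have gA := koszulA_gorenstein k_char0 cA y_central y_cocycle y_deg1 HA eps_anti.
split; first by [].
split.
  exact: (odd_of_calabi_yau k_char0 y_central y_cocycle y_deg1 HA eps_anti m_gt0).
exact: (calabi_yau_of_odd k_char0 cA y_central y_cocycle y_deg1 HA eps_anti).
Qed.
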